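(* Let $\gamma>5$ be a real number and let $\varpi:\mathbb{N}\to\mathbb{R}_{+}$ be an arbitrary function increasing to infinity. Then there exists a real number $\alpha$ such that the inequality $$\left|\alpha-\frac{p}{q}\right|<\frac{1}{\gamma q^{2}}$$ has infinitely many solutions in reduced fractions $\frac{p}{q}$ (with $p\in\mathbb{Z}$, $q\in\mathbb{Z}_{+}$), while the inequality $$\left|\alpha-\frac{p}{q}\right|<\frac{1}{\gamma q^{2}}\left(1-\frac{\varpi(q)}{q^{2}}\right)$$ has at most finitely many rational solutions $\frac{p}{q}$. *)

(* Defs.v *)
From mathcomp Require Export all_boot all_order all_algebra.
From mathcomp Require Export all_classical all_reals all_analysis.
Export Order.TTheory GRing.Theory Num.Theory numFieldNormedType.Exports.

Set Implicit Arguments.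
Unset Strict Implicit.
Unset Printing Implicit Defensive.

(* A fraction p / q is encoded as a pair (p, q) in int * nat with q > 0; the
   denominator is a nat so that the rate function can be evaluated at it. *)

(* Main.v *)
Require Import Defs.
From Stdlib Require Import ZArith.
From mathcomp Require Import all_boot all_order all_algebra.
From mathcomp Require Import all_classical all_reals all_analysis.
From mathcomp Require Import ring lra zify ssrZ.
Import Order.TTheory GRing.Theory Num.Theory numFieldNormedType.Exports.

(* Let [alpha = [0; d_1, d_2, ...]] with convergents [p_n / q_n].  Then
   [|alpha - p_n / q_n| = 1 / (q_n^2 l_n)], where
   [l_n = d_(n+1) + [0; d_(n+2), ...] + [0; d_n, ..., d_1]], while every other
   fraction satisfies [q |q alpha - p| >= 1/4] or is a multiple [(m p_n, m q_n)].
   A digit [a] with [1/2 < gamma - a <= 3/2] is inserted infinitely often; all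
   other digits are so small that [l_n < gamma].  Around each new [a] the words
   [v] before and [u] after it are chosen such that
   [gamma < a + [0; u, ...] + [0; v, ...] <= gamma + 3 e], whatever precedes [v]
   and follows [u], with [e * q(v)^2 <= C] for a constant [C].  The history [h]
   before [v] being fixed, [q_n <= 2 q(h) q(v)] gives [3 e q_n^2 <= 12 C q(h)^2],
   and this is at most [gamma * varpi q_n] if [e] is small, because then [q_n] is
   large.  So the second inequality has no solution at all.

   The existence of [u] and [v] is a quantitative form of Hall's theorem on sums
   of continued fractions, with digits at most 3 (for [gamma > 11/2] the digits
   next to [a] may be 4).  The Cantor set of digits at most 3 is too thin for the
   usual gap argument.  Instead, pairs of cylinder intervals [I], [J] with [s]
   close to [I + J] are described by the ratio of their lengths and the relative
   position of [s], and one exhibits a region of such parameters from which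
   suitable subintervals always lead back to the region.  This invariance of the
   region is verified by computation with integers. *)

Set Implicit Arguments.
Unset Strict Implicit.
Unset Printing Implicit Defensive.

(** Digits at most 3 are forced by [gamma] close to 5: they give [l_n <= 3 + 1 + 1 < gamma] whatever
    their neighbours, while a digit 4 between two digits 1 already gives [l_n > 5]. The second
    inequality leaves for [l_n] a window of relative width about [varpi q / q^2] above [gamma]. Two
    words whose denominators are comparable to [q] determine the sum of their continued fractions up
    to a constant times [1 / q^2]. So the words need not be better than typical: [varpi] only has to
    absorb that constant and the square of the denominator of the history, both known before [q] is
    chosen. The shape of the region has an algebraic reason. For fixed [beta U] and [beta V], a move
    changes the position [sg] affinely, and a bound affine in the new ratio pulls back to a bound
    affine in the old ratio. Trapezoids therefore pull back to trapezoids, and a covering claim over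
    a whole range of ratios reduces to comparisons at its two ends. What varies with [beta U] and
    [beta V] is replaced by interval bounds, and the splits refine these where they are too
    coarse. *)

Local Open Scope classical_set_scope.
Local Open Scope ring_scope.

(** * Continuants *)

(* With p_n / q_n the convergents of [0; w], [num w = (p_n, p_(n-1))] and
   [den w = (q_n, q_(n-1))], where [n = size w]. *)
Definition cont (ab : nat * nat) (w : seq nat) : nat * nat :=
  foldl (fun ab d => (d * ab.1 + ab.2, ab.1)%N) ab w.
Definition num := cont (0, 1)%N.
Definition den := cont (1, 0)%N.

Definition pos_digits (w : seq nat) := all (leq 1) w.

Lemma cont_rcons ab w d :
  cont ab (rcons w d) = (d * (cont ab w).1 + (cont ab w).2, (cont ab w).1)%N.
Proof. by rewrite /cont foldl_rcons. Qed.

Lemma contE a b w :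
  cont (a, b) w = (a * (den w).1 + b * (num w).1, a * (den w).2 + b * (num w).2)%N.
Proof.
elim/last_ind: w => [|w d IH]; first by rewrite /den /num /=; congr pair; lia.
by rewrite /den /num !cont_rcons -/den -/num IH /=; congr pair; lia.
Qed.

Lemma den_cat x y :
  den (x ++ y) = ((den x).1 * (den y).1 + (den x).2 * (num y).1,
                  (den x).1 * (den y).2 + (den x).2 * (num y).2)%N.
Proof.
by rewrite {1}/den /cont foldl_cat -/(cont _ x) -/(den x) -/(cont _ y); case: (den x) => a b; rewrite contE.
Qed.

Lemma num_cons d w : num (d :: w) = den w.
Proof. by rewrite /num /den /= muln0. Qed.

Lemma den_cons d w :
  den (d :: w) = (d * (den w).1 + (num w).1, d * (den w).2 + (num w).2)%N.
Proof. by rewrite {1}/den /= contE; congr pair; lia. Qed.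

(** Transposing the product of the matrices [[[d, 1], [1, 0]]] reverses the word and exchanges
    [q_(n-1)] with [p_n]. *)
Lemma den_rev w : (den (rev w)).1 = (den w).1 /\ (den (rev w)).2 = (num w).1.
Proof.
elim: w => [//|d w [IH1 IH2]]; rewrite rev_cons /den cont_rcons -/den /=.
by rewrite IH1 IH2 den_cons num_cons.
Qed.

Lemma pos_rcons w d : pos_digits (rcons w d) = (0 < d)%N && pos_digits w.
Proof. by rewrite /pos_digits all_rcons. Qed.

Lemma pos_cat x y : pos_digits (x ++ y) = pos_digits x && pos_digits y.
Proof. exact: all_cat. Qed.

Lemma pos_rev w : pos_digits (rev w) = pos_digits w.
Proof. exact: all_rev. Qed.

Lemma den_gt0 w : pos_digits w -> (0 < (den w).1)%N.
Proof.
elim/last_ind: w => [//|w d IH]; rewrite pos_rcons => /andP[d0 /IH w0].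
by rewrite /den cont_rcons -/den /=; nia.
Qed.

Lemma den_le w : pos_digits w -> ((den w).2 <= (den w).1)%N.
Proof.
elim/last_ind: w => [//|w d IH]; rewrite pos_rcons => /andP[d0 /IH w0].
by rewrite /den cont_rcons -/den /=; nia.
Qed.

Lemma num_le_den w : pos_digits w -> ((num w).1 <= (den w).1)%N.
Proof.
by move=> w0; have [<- <-] := den_rev w; apply: den_le; rewrite pos_rev.
Qed.

Lemma cont_det w :
  ((num w).2 * (den w).1)%:Z - ((num w).1 * (den w).2)%:Z = (-1) ^+ size w :> int.
Proof.
elim/last_ind: w => [//|w d IH].
rewrite size_rcons exprS -IH /num /den !cont_rcons -/num -/den /=.
rewrite !PoszM !PoszD !PoszM; ring.
Qed.

Lemma den_rcons_lt w d : pos_digits w -> w != [::] -> (0 < d)%N ->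
  ((den w).1 < (den (rcons w d)).1)%N.
Proof.
case/lastP: w => [//|w c]; rewrite pos_rcons => /andP[c0 w0] _ d0.
have := den_gt0 w0; rewrite /den !cont_rcons -/den /= => h; nia.
Qed.

Lemma den_cat_ge x y : pos_digits x -> pos_digits y ->
  ((den x).1 <= (den (x ++ y)).1)%N.
Proof.
by move=> x0 y0; rewrite den_cat /=; have := den_gt0 y0; nia.
Qed.

Lemma den_cat_lt x y : pos_digits x -> pos_digits y -> x != [::] -> y != [::] ->
  ((den x).1 < (den (x ++ y)).1)%N.
Proof.
move=> x0 y0 xn; case: y y0 => [//|d y] /andP[d0 y0] _.
rewrite -cat_rcons; apply: (leq_trans (den_rcons_lt x0 xn d0)).
by apply: den_cat_ge => //; rewrite pos_rcons d0.
Qed.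

Lemma den_ge_size w : pos_digits w -> (size w <= (den w).1.+1)%N.
Proof.
elim/last_ind: w => [//|w d IH]; rewrite pos_rcons => /andP[d0 w0].
rewrite size_rcons; case: (eqVneq w [::]) => [->//|wn].
by apply: leq_ltn_trans (IH w0) _; rewrite ltnS den_rcons_lt.
Qed.

Section Value.
Variable R : realFieldType.
Implicit Types (t : R) (w x y : seq nat).

(* [cf w t = [0; w_1, ..., w_n + t]] *)
Definition cf w t : R := foldr (fun d (z : R) => (d%:R + z)^-1) t w.

(* [beta w = q_(n-1) / q_n = [0; w_n, ..., w_1]] *)
Definition beta w : R := (den w).2%:R / (den w).1%:R.

Lemma cf_cat x y t : cf (x ++ y) t = cf x (cf y t).
Proof. by rewrite /cf foldr_cat. Qed.

Lemma cf_rcons w d t : cf (rcons w d) t = cf w (d%:R + t)^-1.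
Proof. by rewrite -cats1 cf_cat. Qed.

Lemma denR_gt0 w t : pos_digits w -> 0 <= t ->
  0 < (den w).1%:R + t * (den w).2%:R :> R.
Proof.
move=> w0 t0; have : 0 < (den w).1%:R :> R by rewrite ltr0n den_gt0.
have : 0 <= (den w).2%:R :> R by rewrite ler0n.
by move=> ? ?; nra.
Qed.

Lemma cfE w t : pos_digits w -> 0 <= t ->
  cf w t = ((num w).1%:R + t * (num w).2%:R) / ((den w).1%:R + t * (den w).2%:R).
Proof.
elim/last_ind: w t => [|w d IH] t; first by move=> _ _; rewrite /num /den /=; field.
rewrite pos_rcons => /andP[d0 w0] t0; rewrite cf_rcons.
have d0R : 1 <= d%:R :> R by rewrite ler1n.
have dt : 0 < d%:R + t by lra.
rewrite IH //; last by rewrite invr_ge0 ltW.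
have h1 := denR_gt0 w0 (ltW dt).
have /= := @denR_gt0 w (d%:R + t)^-1 w0; rewrite invr_ge0 (ltW dt) => /(_ isT) h2.
rewrite /num /den !cont_rcons -/num -/den /= !natrD !natrM.
have := den_gt0 w0; rewrite -(ltr_nat R).
clear IH; move: h1 h2; move: (num w).1 (num w).2 (den w).1 (den w).2 => a b c e h1 h2 c0.
field; rewrite !lt0r_neq0 //; have e0 : 0 <= e%:R :> R by []; nra.
Qed.

Lemma cf_ge0 w t : 0 <= t -> 0 <= cf w t.
Proof.
by move=> t0; elim: w => //= d w IH; rewrite invr_ge0 addr_ge0.
Qed.

Lemma cf_le1 w t : pos_digits w -> 0 <= t <= 1 -> cf w t <= 1.
Proof.
move=> + /andP[t0 t1]; elim: w => //= d w IH /andP[d0 w0].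
rewrite -[leRHS]invr1 lef_pV2 ?posrE //.
  have := cf_ge0 w t0; have : 1 <= d%:R :> R by rewrite ler1n. lra.
have := cf_ge0 w t0; have : 1 <= d%:R :> R by rewrite ler1n. lra.
Qed.

Lemma beta_rcons w d : pos_digits w -> (0 < d)%N ->
  beta (rcons w d) = (d%:R + beta w)^-1.
Proof.
move=> w0 d0; rewrite /beta /den cont_rcons -/den /= natrD natrM.
have := den_gt0 w0; rewrite -(ltr_nat R).
have d1 : 0 < d%:R :> R by rewrite ltr0n.
move: (den w).1 (den w).2 => a b a0; have b0 : 0 <= b%:R :> R by [].
field; rewrite !lt0r_neq0 //; nra.
Qed.

(** The digits before a position, read backwards, form a continued fraction whose tail is the [beta]
    of the older history. This lets both sides of a digit be treated alike. *)
Lemma beta_cat x y : pos_digits x -> pos_digits y -> beta (x ++ y) = cf (rev y) (beta x).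
Proof.
move=> x0; elim/last_ind: y => [|y d IH]; first by rewrite cats0.
rewrite pos_rcons => /andP[d0 y0]; rewrite -rcons_cat beta_rcons //; last first.
  by rewrite pos_cat x0.
by rewrite IH // rev_rcons.
Qed.

Lemma beta_ge0 w : 0 <= beta w.
Proof. by rewrite /beta divr_ge0. Qed.

Lemma beta_le1 w : pos_digits w -> beta w <= 1.
Proof.
move=> w0; rewrite /beta ler_pdivrMr ?ltr0n ?den_gt0 // mul1r ler_nat.
exact: den_le.
Qed.

End Value.

(** * A certificate for sums of two continued fractions *)

Section Certificate.
Local Open Scope Z_scope.

(* In a state, two words [U], [V] are given and [s] should be approximated by the
   sum of a point of the interval [cf U [hull_lo, hull_hi]] and a point of
   [cf V [hull_lo, hull_hi]].  A move appends words number [i] and [j] of the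
   following list to [U] and [V].  The shape of the subdivision of the interval
   of [U] depends on [beta U] only, which is known up to the last two digits of
   [U]: a node records none, one or two of these digits, the last digit first,
   and the children of node [n] are the nodes [3 * n + d]. *)
Definition words : seq (seq nat) :=
  [:: [::]; [:: 1]; [:: 1; 1]; [:: 1; 2]; [:: 1; 3];
      [:: 2]; [:: 2; 1]; [:: 2; 2]; [:: 2; 3];
      [:: 3]; [:: 3; 1]; [:: 3; 2]; [:: 3; 3]]%N.
Definition nodes : seq (seq nat) :=
  [:: [::]; [:: 1]; [:: 2]; [:: 3]; [:: 1; 1]; [:: 1; 2]; [:: 1; 3];
      [:: 2; 1]; [:: 2; 2]; [:: 2; 3]; [:: 3; 1]; [:: 3; 2]; [:: 3; 3]]%N.

(* Bounds, scaled by [NN], for [Sv], [Tv] and [|Tv - Sv|], valid for every [beta]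
   described by a node. *)
Record row_bounds := Row { s0 : Z; s1 : Z; t0 : Z; t1 : Z; e0 : Z; e1 : Z }.

(* The state is described by the signed ratio [e * r] of the lengths of the two
   intervals, [r] being at most 1, and by the position [sg] of [s] relative to
   the sum of their base points, in units of the longer interval.  On the cell
   [gl <= NN * r <= gh], the piece [((a0, a1), (b0, b1))] is the trapezoid
   [a0 + a1 * r <= NN * sg <= b0 + b1 * r]. *)
Definition aff := (Z * Z)%type.
Definition piece := (aff * aff)%type.
Definition cells := seq (Z * seq piece).

(* [Leaf k] claims that the moves in the [k]-th list cover the piece; the other
   constructors split the information on [beta U], on [beta V], or on [r]. *)
Inductive tree :=
  | Leaf of nat | SplitU of tree & tree & tree | SplitV of tree & tree & tree
  | SplitR of tree & tree.

Definition NN : Z := 10000.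
(** Just above [NN / 7]: the lengths of the two intervals always stay within a factor 7 of each
    other. *)
Definition g0 : Z := 1429.

Definition row0 := Row 0 0 0 0 0 0.
(** Each digit reverses the order, so a word of odd length reverses the orientation of the
    interval. *)
Definition sgn i : Z := if odd (size (nth [::] words i)) then -1 else 1.

(* Exchanges the roles of [U] and [V]. *)
Definition mirror (e : Z) (p : piece) : piece :=
  let: ((a0, a1), (b0, b1)) := p in
  if 0 <? e then ((a1, a0), (b1, b0)) else ((- b1, - b0), (- a1, - a0)).

Definition hi2 a x y := if 0 <=? a then a * y else a * x.
Definition lo2 a x y := if 0 <=? a then a * x else a * y.
Definition leb2 (x y : Z * Z) := (x.1 <=? y.1) && (x.2 <=? y.2).
Definition min2 (x y : Z * Z) := (Z.min x.1 y.1, Z.min x.2 y.2).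

(** Bounds for [NN^2 * G dd a] at the two ends of the range of [r], where [G], defined below, is the
    affine bound [a] on the new position pulled back to the old one. *)
Definition bnd (f : Z -> Z -> Z -> Z) e dd (t u : row_bounds) rl rh (a : aff) : Z * Z :=
  let c := NN * (f (NN - a.1) (s0 t) (s1 t) + f a.1 (t0 t) (t1 t)) in
  let r := f (e * NN - dd * a.2) (s0 u) (s1 u) + f (dd * a.2) (t0 u) (t1 u) in
  (c + rl * r, c + rh * r).

(** A piece is acceptable if its pullback contains the level [v] at both ends; everything from [v]
    up to its upper side is then covered. For [d < 0] the move reverses the orientation, and the two
    sides change places. *)
Fixpoint pick_piece (d : Z) (dn up : aff -> Z * Z) v w (ps : seq piece) :=
  if ps is p :: ps' then
    let x := dn (if 0 <? d then p.1 else p.2) in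
    let y := up (if 0 <? d then p.2 else p.1) in
    if leb2 x v && leb2 v y then Some (min2 w y) else pick_piece d dn up v w ps'
  else None.

(** The new ratio is only known to lie in a range, so every cell that meets this range has to accept
    the move. *)
Fixpoint scan (f : Z * Z -> seq piece -> option (Z * Z)) gl ql qh w (cs : cells) :=
  if cs is (gh, ps) :: cs' then
    if (gl <=? qh) && (ql <=? gh) then
      if f w ps is Some w' then scan f gh ql qh w' cs' else None
    else scan f gh ql qh w cs'
  else Some w.

Definition cdiv a b := - ((- a) / b).

Section Checker.
Variables (region : Z -> cells) (tab : seq (seq row_bounds)).

(** The scaled new ratio lies between [ql] and [qh], its inverse between [pl] and [ph]. The one that
    is at most 1 decides which interval is the longer; both outcomes are tested, the second with
    mirrored pieces. [big] starts the minimum: on a piece [NN^3 * sg] is at most [4 * 10^12]. *)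
Definition bound_step e rl rh (t u : row_bounds) d d' v :=
  let dd := d * d' in let e' := e * dd in
  let ql := (rl * e0 u) / e1 t in let qh := cdiv (rh * e1 u) (e0 t) in
  let pl := (NN * NN * e0 t) / (rh * e1 u) in
  let ph := cdiv (NN * NN * e1 t) (rl * e0 u) in
  if (g0 <=? ql) && (g0 <=? pl) then
    let f := pick_piece d (bnd hi2 e dd t u rl rh) (bnd lo2 e dd t u rl rh) v in
    let big := 10 ^ 15 in
    if scan f g0 ql qh (big, big) (region e') is Some w then
      scan (fun w ps => f w (map (mirror e') ps)) g0 pl ph w (region e')
    else None
  else None.

Definition rowsof n := nth [::] tab n.

(* [v] is the part of the vertical chord already covered from below: it is an
   affine function of [r], given by its values at [rl] and [rh]. *)
Fixpoint run (T U : seq row_bounds) e rl rh (l : seq (nat * nat)) v :=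
  if l is (i, j) :: l' then
    if [&& 0 < i + j, i < 13 & j < 13]%N then
      if bound_step e rl rh (nth row0 T i) (nth row0 U j) (sgn i) (sgn j) v is Some w
      then run T U e rl rh l' w else None
    else None
  else Some v.

Definition ends rl rh (a : aff) : Z * Z :=
  (NN * (NN * a.1 + a.2 * rl), NN * (NN * a.1 + a.2 * rh)).

(** At a leaf the moves, taken in order, raise the covered level from the lower side of the piece,
    and it has to reach the upper side. The tests [n < 4] and [n' < 4] hold because a node records
    at most two digits. *)
Fixpoint certifies e rl rh (p : piece) (ls : seq (seq (nat * nat))) (n n' : nat) t :=
  match t with
  | Leaf k => if nth [::] ls k is (_ :: _) as l then
      if run (rowsof n) (rowsof n') e rl rh l (ends rl rh p.1) is Some w
      then leb2 (ends rl rh p.2) w else false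
    else false
  | SplitU t1 t2 t3 => [&& (n < 4)%N, certifies e rl rh p ls (3 * n + 1) n' t1,
      certifies e rl rh p ls (3 * n + 2) n' t2 & certifies e rl rh p ls (3 * n + 3) n' t3]
  | SplitV t1 t2 t3 => [&& (n' < 4)%N, certifies e rl rh p ls n (3 * n' + 1) t1,
      certifies e rl rh p ls n (3 * n' + 2) t2 & certifies e rl rh p ls n (3 * n' + 3) t3]
  | SplitR t1 t2 => let rm := (rl + rh) / 2 in
      [&& rl <=? rm, rm <=? rh, certifies e rl rm p ls n n' t1 & certifies e rm rh p ls n n' t2]
  end.

Fixpoint chk_cells e gl (cs : cells) (ct : seq (seq (seq (seq (nat * nat)) * tree))) :=
  match cs, ct with
  | (gh, ps) :: cs', c :: ct' =>
      [&& gl <? gh, size ps == size c,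
        all (fun pc : piece * _ => certifies e gl gh pc.1 pc.2.1 0 0 pc.2.2) (zip ps c)
        & chk_cells e gh cs' ct']
  | [::], [::] => gl =? NN
  | _, _ => false
  end.

End Checker.

Definition cfz (w : seq nat) (x : Z * Z) : Z * Z :=
  foldr (fun d y => (y.2, Z.of_nat d * y.2 + y.1)) x w.
(** Rational approximations to [[0; 3, 1, 3, 1, ...] = 0.2637...] and [[0; 1, 3, 1, 3, ...] =
    0.7912...], the extreme values for digits at most 3. *)
Definition mz : Z * Z := (53, 200).
Definition Mz : Z * Z := (79, 100).

(** The interval from 1/4 to 4/5 is mapped into itself by [x -> 1 / (d + x)] for [d = 1, 2, 3], and
    it contains [beta] of the one-digit word 4. It bounds what the recorded digits leave unknown of
    [beta]. *)
Definition xlo : Z * Z := (1, 4).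
Definition xhi : Z * Z := (4, 5).

(* The value of [hull_coord b t], scaled by [NN];
   [10500 = 200 * 100 * (hull_hi - hull_lo)]. *)
Definition mkfrac (f : Z -> Z -> Z) (b t : Z * Z) : Z :=
  f (NN * (200 * t.1 - 53 * t.2) * (100 * b.2 + 79 * b.1))
    (10500 * (b.2 * t.2 + b.1 * t.1)).

(** As a function of [beta], the relative length [Tv - Sv] is a quotient of two quadratic
    polynomials. [pol1] and [polm] are polarizations of its denominator and numerator, homogenized
    and up to constants. *)
Definition pol1 (x y b b' : Z * Z) : Z :=
  (b.2 * x.2 + b.1 * x.1) * (b'.2 * y.2 + b'.1 * y.1) +
  (b'.2 * x.2 + b'.1 * x.1) * (b.2 * y.2 + b.1 * y.1).
Definition polm (b b' : Z * Z) : Z :=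
  (200 * b.2 + 53 * b.1) * (100 * b'.2 + 79 * b'.1) +
  (200 * b'.2 + 53 * b'.1) * (100 * b.2 + 79 * b.1).

Definition nodeends n : (Z * Z) * (Z * Z) :=
  let w := nth [::] nodes n in
  let a := cfz w xlo in let b := cfz w xhi in
  if odd (size w) then (b, a) else (a, b).

Definition mkrow n i : row_bounds :=
  let w := nth [::] words i in let: (lo, hi) := nodeends n in
  let x := cfz w mz in let y := cfz w Mz in
  let del := sgn i * (y.1 * x.2 - x.1 * y.2) in
  let q f b b' := f (NN * del * polm b b') (10500 * pol1 x y b b') in
  Row (Z.min (mkfrac Z.div lo x) (mkfrac Z.div hi x))
      (Z.max (mkfrac cdiv lo x) (mkfrac cdiv hi x))
      (Z.min (mkfrac Z.div lo y) (mkfrac Z.div hi y))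
      (Z.max (mkfrac cdiv lo y) (mkfrac cdiv hi y))
      (Z.min (q Z.div lo lo) (Z.min (q Z.div lo hi) (q Z.div hi hi)))
      (Z.max (q cdiv lo lo) (Z.max (q cdiv lo hi) (q cdiv hi hi))).

(** Since the finished table is checked by cross-multiplication, nothing has to be proved about the
    roundings in [mkrow]. *)
Definition chk_row n i (r : row_bounds) : bool :=
  let w := nth [::] words i in let: (lo, hi) := nodeends n in
  let x := cfz w mz in let y := cfz w Mz in
  let del := sgn i * (y.1 * x.2 - x.1 * y.2) in
  let num t b := NN * (200 * t.1 - 53 * t.2) * (100 * b.2 + 79 * b.1) in
  let den t b := 10500 * (b.2 * t.2 + b.1 * t.1) in
  let between s s' t b := (s * den t b <=? num t b) && (num t b <=? s' * den t b) in
  let q b b' := (e0 r * (10500 * pol1 x y b b') <=? NN * del * polm b b') &&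
                (NN * del * polm b b' <=? e1 r * (10500 * pol1 x y b b')) in
  [&& between (s0 r) (s1 r) x lo, between (s0 r) (s1 r) x hi,
      between (t0 r) (t1 r) y lo, between (t0 r) (t1 r) y hi,
      q lo lo, q lo hi, q hi hi & 0 <? e0 r].

Definition tab : seq (seq row_bounds) :=
  Eval vm_compute in [seq [seq mkrow n i | i <- iota 0 13] | n <- iota 0 13].

Lemma tab_ok : all (fun n => all (fun i => chk_row n i (nth row0 (nth [::] tab n) i)) (iota 0 13)) (iota 0 13).
Proof. by vm_compute. Qed.

(* An initial state, valid for [rlo <= RS * s <= rhi]. *)
Record root := Root { rU : seq nat; rV : seq nat; rlo : Z; rhi : Z }.
Definition RS : Z := 1000000.

(** Integer form of [ends_in_digits3]: [beta] of the word without its last two digits lies between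
    1/4 and 4/5. The one-digit word 1 has [beta = 1], so an initial word starting with 1 needs at
    least four digits. *)
Definition ends_ok (w : seq nat) : bool :=
  if rev w is c1 :: c2 :: w' then
    let d := den (rev w') in
    [&& (0 < c1 < 4)%N, (0 < c2 < 4)%N, (d.1 <= 4 * d.2)%N & (5 * d.2 <= 4 * d.1)%N]
  else false.

Section Roots.
Variable region : Z -> cells.

Fixpoint find_cell (P : piece -> bool) (x gl : Z) (cs : cells) : bool :=
  if cs is (gh, ps) :: cs' then
    if (gl <=? x) && (x + 1 <=? gh) then has P ps else find_cell P x gh cs'
  else false.

(** The conditions on the position are affine in [s], so the two ends of the range suffice. The
    ratio is rounded down to an integer [x], and [find_cell] wants a cell containing both [x] and
    [x + 1]. *)
Definition chk_root (r : root) : bool :=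
  let aU := cfz (rU r) mz in let bU := cfz (rU r) Mz in
  let aV := cfz (rV r) mz in let bV := cfz (rV r) Mz in
  let nU := bU.1 * aU.2 - aU.1 * bU.2 in let nV := bV.1 * aV.2 - aV.1 * bV.2 in
  let e := Z.sgn nU * Z.sgn nV in
  let rn := Z.abs nV * (aU.2 * bU.2) in
  let rd := Z.abs nU * (aV.2 * bV.2) in
  let num s := s * (aU.2 * aV.2) - RS * (aU.1 * aV.2 + aV.1 * aU.2) in
  let sg s := Z.sgn nU * (NN * num s * (bU.2 * bV.2)) in
  let lhs (a : aff) := RS * (a.1 * rd + a.2 * rn) in
  let test (p : piece) := [&& lhs p.1 <=? sg (rlo r), lhs p.1 <=? sg (rhi r),
                      sg (rlo r) <=? lhs p.2 & sg (rhi r) <=? lhs p.2] in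
  [&& 0 <? rn, 0 <? rd, ends_ok (rU r), ends_ok (rV r)
    & find_cell test ((NN * rn) / rd) g0 (region e)].

Fixpoint chk_roots (P : seq nat -> bool) lo hi (rs : seq root) : bool :=
  if rs is r :: rs' then
    [&& rlo r <=? lo, P (rU r), P (rV r), chk_root r & chk_roots P (rhi r) hi rs']
  else hi <=? lo.

End Roots.

Definition digits3 (w : seq nat) := all (fun d => 0 < d < 4)%N w.
Definition digits4 (w : seq nat) :=
  if w is d :: w' then (0 < d < 5)%N && digits3 w' else true.

(** * The invariant region, its certificate and the initial states *)

Local Notation L := Leaf.
Local Notation U := SplitU.
Local Notation V := SplitV.
Local Notation H := SplitR.

(** The case of equally oriented intervals; [region_neg] is the case of opposite orientations. Cell
    ends grow by a factor of about 1.05. *)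
Definition region_pos : cells :=
  [:: (1500, [:: ((6397, 1685), (9929, 9798)); ((248, 62), (3288, 10017))]);
  (1575, [:: ((6441, 1336), (10000, 10000)); ((0, 0), (3288, 10017))]);
  (1653, [:: ((6627, 72), (10000, 10000)); ((0, 0), (3288, 10017))]);
  (1735, [:: ((0, 0), (3524, 10017)); ((6627, 71), (10000, 10000))]);
  (1822, [:: ((0, 0), (3624, 10018)); ((6627, 71), (10000, 10000))]);
  (1913, [:: ((0, 0), (3639, 10017)); ((6627, 71), (10000, 10000))]);
  (2008, [:: ((0, 0), (3639, 9980)); ((6627, 71), (10000, 10000))]);
  (2108, [:: ((0, 0), (3639, 9980)); ((6627, 69), (9999, 10000))]);
  (2213, [:: ((0, 0), (3636, 9991)); ((6627, 71), (9999, 10000))]);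
  (2324, [:: ((0, 0), (3638, 9985)); ((6629, 64), (10000, 10000))]);
  (2440, [:: ((0, 0), (3630, 9055)); ((6630, 58), (10000, 10000))]);
  (2561, [:: ((-20, 245), (3624, 9079)); ((6629, 58), (10007, 9929))]);
  (2689, [:: ((42, 19), (3852, 9146)); ((6628, 59), (9992, 9985))]);
  (2823, [:: ((14, 125), (9993, 9978))]);
  (2964, [:: ((45, 26), (9979, 10022))]);
  (3111, [:: ((62, 6311), (9192, 10020))]);
  (3266, [:: ((1401, 2138), (9422, 9182))]);
  (3429, [:: ((69, 6311), (9123, 9972))]);
  (3600, [:: ((2255, -27), (9077, 10020))]);
  (3780, [:: ((2255, -25), (9330, 9317))]);
  (3968, [:: ((72, -28), (9077, 10017))]);
  (4166, [:: ((72, -27), (9981, 10009))]);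
  (4374, [:: ((71, -26), (9988, 9991))]);
  (4592, [:: ((71, -26), (9988, 9992))]);
  (4820, [:: ((-20, 69), (9977, 10018))]);
  (5061, [:: ((-20, 69), (10000, 10000))]);
  (5313, [:: ((-20, 69), (9999, 10000))]);
  (5578, [:: ((-20, 69), (9990, 9059))]);
  (5856, [:: ((53, 2278), (9978, 9078)); ((-19, 68), (870, 770))]);
  (6148, [:: ((65, 2257), (9826, 9324)); ((-19, 68), (870, 723))]);
  (6454, [:: ((58, 2278), (9977, 9078))]);
  (6776, [:: ((72, 2257), (9992, 9055)); ((-19, 68), (870, 699))]);
  (7114, [:: ((65, 2257), (9979, 9079)); ((-19, 68), (870, 699)); ((9655, 9732), (10004, 9993))]);
  (7469, [:: ((69, 2257), (9978, 9079)); ((-19, 68), (870, 699))]);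
  (7841, [:: ((71, 2257), (9977, 9079)); ((-19, 68), (870, 699))]);
  (8232, [:: ((71, 2257), (9977, 9079)); ((11, 32), (870, 699))]);
  (8642, [:: ((71, 2257), (9976, 9080)); ((8, 37), (870, 699))]);
  (9073, [:: ((71, 2257), (9976, 9080))]);
  (9525, [:: ((72, 2256), (9650, 9422))]);
  (10000, [:: ((606, 1722), (9706, 9350))])].

Definition cert_pos :=
  [:: [:: ([:: [:: (1, 0)]; [:: (2, 0); (1, 0)]], U (U (L 0) (L 0) (L 1)) (L 1) (L 1));
   ([:: [:: (9, 0); (5, 0)]; [:: (9, 0); (5, 0); (7, 4)]], U (U (L 0) (L 0) (L 0)) (L 0) (L 1))];
  [:: ([:: [:: (1, 0)]; [:: (2, 0); (1, 0)]], U (U (L 0) (L 0) (L 1)) (L 1) (L 1));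
   ([:: [:: (9, 0); (5, 0)]; [:: (9, 0); (5, 0); (7, 4)]], U (L 0) (L 0) (L 1))];
  [:: ([:: [:: (1, 0)]; [:: (2, 0); (1, 0)]], U (U (L 0) (L 0) (L 1)) (L 1) (L 1));
   ([:: [:: (9, 0); (5, 0)]; [:: (9, 0); (5, 0); (7, 4)]], U (L 0) (L 0) (L 1))];
  [:: ([:: [:: (9, 0); (5, 0); (7, 1)]; [:: (9, 0); (5, 0)]], U (L 0) (L 1) (L 1));
   ([:: [:: (1, 0)]; [:: (2, 0); (1, 0)]], U (U (L 0) (L 0) (L 1)) (L 1) (L 1))];
  [:: ([:: [:: (9, 0); (5, 0)]], U (L 0) (L 0) (L 0));
   ([:: [:: (1, 0)]; [:: (2, 0); (1, 0)]], U (U (L 0) (L 0) (L 1)) (L 1) (L 1))];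
  [:: ([:: [:: (9, 0); (5, 0)]; [:: (9, 0); (5, 0); (8, 4)]], U (U (L 0) (L 0) (L 0)) (L 0) (L 1));
   ([:: [:: (1, 0)]; [:: (2, 0); (1, 0)]], U (U (L 0) (L 0) (L 1)) (L 1) (L 1))];
  [:: ([:: [:: (9, 0); (5, 0)]; [:: (9, 0); (5, 0); (8, 4)]], U (L 0) (L 0) (L 1));
   ([:: [:: (1, 0)]; [:: (2, 0); (1, 0)]], U (U (L 0) (L 0) (L 1)) (L 1) (L 1))];
  [:: ([:: [:: (9, 0); (5, 0)]], U (L 0) (L 0) (L 0));
   ([:: [:: (1, 0)]; [:: (2, 0); (1, 0)]], U (U (L 0) (L 0) (L 1)) (L 1) (L 1))];
  [:: ([:: [:: (9, 0); (5, 0)]], U (L 0) (L 0) (L 0));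
   ([:: [:: (1, 0)]; [:: (1, 0); (4, 4)]; [:: (2, 0); (1, 0); (4, 4)]], U (U (L 0) (L 1) (L 2)) (L 2) (L 2))];
  [:: ([:: [:: (9, 0); (5, 0)]; [:: (9, 0); (5, 0); (8, 1)]], U (L 0) (L 1) (L 1));
   ([:: [:: (1, 0); (4, 4)]; [:: (2, 0); (1, 0); (4, 4)]], U (U (L 0) (L 0) (L 1)) (L 1) (L 1))];
  [:: ([:: [:: (9, 0); (5, 0)]], U (L 0) (L 0) (L 0));
   ([:: [:: (1, 0); (4, 4)]; [:: (2, 0); (1, 0); (4, 4)]], U (U (L 0) (L 0) (L 1)) (L 1) (L 1))];
  [:: ([:: [:: (9, 0); (5, 0)]], U (L 0) (L 0) (L 0));
   ([:: [:: (1, 0)]; [:: (1, 0); (4, 4)]; [:: (2, 0); (1, 0); (4, 4)]], U (U (L 0) (L 1) (L 2)) (L 2) (L 2))];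
[:: ([:: [:: (9, 0); (5, 0)]; [:: (9, 0); (5, 0); (8, 3); (2, 9)]; [:: (9, 0); (5, 0); (2, 0); (8, 4)]], U
    (L 0) (V (L 1) (U (L 1) (L 1) (L 1)) (U (L 1) (L 1) (L 1))) (V (L 1) (U (V (H (H (L 1) (L 2)) (L 2)) (H
    (H (L 1) (L 2)) (L 2)) (H (H (L 1) (L 2)) (L 2))) (V (H (L 1) (L 2)) (H (L 1) (L 2)) (H (L 1) (L 2)))
    (V (H (L 1) (L 2)) (H (L 1) (L 2)) (H (L 1) (L 2)))) (U (V (H (H (L 1) (L 2)) (L 2)) (H (H (L 1) (L 2))
    (L 2)) (H (H (L 1) (L 2)) (L 2))) (V (H (L 1) (L 2)) (H (L 1) (L 2)) (H (L 1) (L 2))) (V (H (L 1) (L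
    2)) (H (L 1) (L 2)) (H (L 1) (L 2))))));
   ([:: [:: (1, 0)]; [:: (1, 0); (4, 1)]; [:: (2, 0); (1, 0); (4, 1)]], U (U (L 0) (L 1) (L 2)) (L 2) (L 2))];
[:: ([:: [:: (9, 0); (5, 0); (2, 0); (1, 0); (4, 1)]; [:: (9, 0); (5, 0); (2, 9); (1, 0); (4, 1)]; [:: (9,
    0); (5, 0); (2, 9); (8, 4); (1, 0)]; [:: (10, 9); (9, 0); (5, 0); (2, 9); (1, 0)]; [:: (9, 9); (9, 0);
    (5, 0); (2, 9); (8, 4); (1, 0)]], U (L 0) (V (L 1) (L 1) (U (L 2) (L 2) (L 0))) (V (L 3) (U (L 2) (L 4)
    (L 3)) (U (L 4) (L 4) (L 4))))];
[:: ([:: [:: (9, 0); (5, 0); (2, 0); (1, 0); (4, 1)]; [:: (9, 0); (5, 0); (1, 0); (4, 3); (4, 4)]; [:: (9,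
    0); (5, 0); (1, 0); (4, 1); (4, 1)]; [:: (9, 0); (5, 0); (1, 0); (4, 1); (4, 3); (4, 4)]; [:: (10, 9);
    (9, 0); (12, 7); (9, 0); (5, 0); (2, 0); (1, 0); (4, 1)]; [:: (9, 9); (9, 0); (9, 1); (5, 0); (2, 0);
    (1, 1)]; [:: (9, 9); (9, 5); (9, 1); (5, 0); (2, 0); (1, 1); (4, 1)]], U (U (L 0) (V (L 0) (L 0) (L 1))
    (V (L 0) (L 2) (L 3))) (L 0) (V (L 4) (L 5) (L 6)))];
[:: ([:: [:: (9, 0); (5, 0); (1, 0); (4, 2)]; [:: (9, 1); (5, 0); (1, 0); (4, 1)]; [:: (9, 1); (5, 0); (1,
    0); (4, 1); (4, 3)]; [:: (9, 0); (5, 0); (1, 0); (3, 4)]; [:: (9, 0); (5, 0); (2, 0); (1, 0); (4, 1)];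
    [:: (10, 2); (5, 0); (2, 0); (1, 0); (4, 1)]], U (U (V (L 0) (L 1) (L 2)) (L 3) (L 3)) (L 4) (L 5))];
[:: ([:: [:: (9, 0); (5, 0); (1, 0); (3, 4)]; [:: (6, 9); (5, 0); (1, 0); (4, 2)]; [:: (9, 1); (5, 0); (1,
    0); (4, 1); (4, 3)]; [:: (5, 0); (1, 0); (4, 1)]], U (U (L 0) (L 0) (L 0)) (V (L 1) (L 1) (L 2)) (L
    3))];
[:: ([:: [:: (10, 2); (5, 0); (1, 0)]; [:: (9, 0); (5, 0); (1, 0)]; [:: (5, 0); (1, 0); (3, 4)]; [:: (5,
    0); (1, 0); (4, 2)]; [:: (5, 0); (1, 0); (4, 1); (4, 3)]], U (U (L 0) (L 1) (L 1)) (L 2) (V (L 3) (L 3)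
    (L 4)))];
[:: ([:: [:: (5, 0); (1, 0)]; [:: (6, 9); (5, 0); (1, 0)]; [:: (5, 0); (1, 0); (3, 4)]], U (U (L 0) (L 0)
    (L 1)) (L 1) (L 2))];
  [:: ([:: [:: (5, 0); (1, 0)]; [:: (6, 9); (5, 0); (1, 0)]], U (U (L 0) (L 0) (L 1)) (L 1) (L 1))];
  [:: ([:: [:: (9, 0); (5, 0); (1, 0)]], U (U (L 0) (L 0) (L 0)) (L 0) (L 0))];
  [:: ([:: [:: (9, 0); (5, 0); (1, 0)]], U (U (L 0) (L 0) (L 0)) (L 0) (L 0))];
  [:: ([:: [:: (10, 10); (9, 0); (5, 0); (1, 0)]], U (L 0) (L 0) (L 0))];
  [:: ([:: [:: (10, 10); (9, 0); (5, 0); (1, 0)]], U (L 0) (L 0) (L 0))];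
  [:: ([:: [:: (9, 0); (5, 0); (1, 0)]], U (L 0) (L 0) (L 0))];
  [:: ([:: [:: (9, 0); (5, 0); (1, 0); (0, 1); (4, 4)]], L 0)];
  [:: ([:: [:: (9, 0); (5, 0); (1, 0); (0, 1); (4, 4)]], L 0)];
[:: ([:: [:: (9, 0); (5, 0); (1, 0); (4, 3)]; [:: (9, 0); (5, 0); (0, 1); (1, 0)]; [:: (9, 0); (9, 5); (5,
    0); (0, 1); (1, 0)]; [:: (9, 0); (12, 11); (9, 5); (5, 0); (0, 1); (1, 0)]], U (V (L 0) (L 0) (L 0)) (L
    1) (V (V (L 2) (L 2) (L 3)) (L 2) (L 2)))];
[:: ([:: [:: (9, 0); (5, 0); (0, 1); (1, 0)]; [:: (9, 5); (5, 0); (0, 1); (1, 0)]; [:: (10, 5); (5, 0); (0,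
    1); (1, 0)]], U (L 0) (V (V (L 1) (L 1) (L 2)) (L 2) (L 2)) (L 2));
([:: [:: (9, 9)]; [:: (9, 0)]; [:: (9, 0); (12, 11)]; [:: (9, 0); (10, 6)]], U (L 0) (L 1) (V (L 2) (L 3)
    (L 3)))];
[:: ([:: [:: (9, 5); (5, 0); (0, 1); (1, 0)]; [:: (12, 11); (9, 5); (5, 0); (0, 1); (1, 0)]; [:: (10, 5);
    (5, 0); (0, 1); (1, 0)]], U (V (U (V (L 0) (L 0) (L 1)) (L 1) (L 1)) (L 0) (L 0)) (V (V (L 0) (L 0) (L
    2)) (L 2) (L 2)) (L 2));
([:: [:: (9, 9)]; [:: (9, 0)]; [:: (9, 9); (12, 11)]; [:: (9, 9); (12, 11); (10, 6)]], U (L 0) (L 1) (V (L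
    0) (L 2) (L 3)))];
[:: ([:: [:: (10, 5); (5, 0); (0, 1); (1, 0)]], U (V (U (L 0) (L 0) (V (L 0) (L 0) (L 0))) (L 0) (L 0)) (L
    0) (L 0))];
[:: ([:: [:: (9, 5); (5, 0); (0, 1); (1, 0)]; [:: (10, 5); (5, 0); (0, 1); (1, 0)]], U (V (U (L 0) (V (L 0)
    (L 0) (L 0)) (V (L 0) (L 0) (L 1))) (L 1) (L 1)) (L 1) (L 0));
   ([:: [:: (9, 9)]; [:: (10, 10); (9, 9); (12, 11)]], U (L 0) (L 0) (L 1))];
[:: ([:: [:: (9, 5); (5, 0); (0, 1); (1, 0); (4, 3)]; [:: (12, 12); (9, 5); (5, 0); (0, 1); (1, 0); (4,
    3)]], U (V (U (V (L 0) (L 0) (L 1)) (L 1) (L 1)) (L 0) (L 0)) (V (V (L 0) (L 0) (L 0)) (L 0) (L 0)) (V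
    (L 0) (L 0) (L 0)));
   ([:: [:: (9, 9)]; [:: (10, 9); (9, 9)]; [:: (10, 10); (9, 9); (12, 11)]], U (L 0) (L 1) (L 2));
   ([:: [:: (4, 4)]], L 0)];
[:: ([:: [:: (9, 5); (5, 0); (1, 0)]; [:: (9, 6); (5, 0); (1, 0)]; [:: (9, 5); (5, 0); (0, 1); (1, 0)]; [::
    (9, 5); (5, 0); (1, 0); (4, 3)]], U (V (U (V (L 0) (L 0) (L 0)) (V (L 0) (L 0) (L 0)) (V (L 0) (L 0) (L
    1))) (L 2) (L 2)) (L 2) (V (L 3) (L 3) (L 3)));
   ([:: [:: (9, 9)]; [:: (10, 10); (9, 9)]; [:: (9, 9); (12, 11)]], U (L 0) (L 1) (V (L 1) (L 1) (L 2)))];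
[:: ([:: [:: (9, 5); (5, 0); (1, 0)]], U (V (U (L 0) (V (L 0) (L 0) (L 0)) (V (L 0) (L 0) (L 0))) (L 0) (L
    0)) (L 0) (L 0));
   ([:: [:: (9, 9)]; [:: (10, 10); (9, 9)]; [:: (9, 9); (12, 11)]], U (L 0) (L 1) (V (L 1) (L 2) (L 2)))];
[:: ([:: [:: (9, 5); (5, 0); (1, 0)]], U (V (U (L 0) (V (L 0) (L 0) (L 0)) (V (L 0) (L 0) (L 0))) (L 0) (L
    0)) (L 0) (L 0));
   ([:: [:: (9, 9)]; [:: (10, 10); (9, 9)]; [:: (9, 9); (12, 11)]], U (L 0) (L 1) (V (L 1) (L 2) (L 2)))];
[:: ([:: [:: (9, 5); (5, 0); (1, 0)]; [:: (9, 5); (5, 0); (0, 1)]; [:: (9, 5); (5, 0); (1, 0); (4, 3)]], U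
    (V (U (L 0) (V (L 1) (L 2) (L 2)) (V (L 2) (L 2) (L 2))) (L 2) (L 2)) (L 0) (L 0));
([:: [:: (10, 9); (9, 9)]; [:: (9, 9)]; [:: (9, 10); (11, 9)]; [:: (9, 9); (12, 11)]], U (L 0) (V (L 1) (L
    1) (L 1)) (V (L 2) (L 3) (L 3)))];
[:: ([:: [:: (9, 5); (5, 0); (0, 1)]; [:: (9, 5); (5, 0); (0, 1); (4, 3)]], U (V (U (L 0) (V (L 0) (L 0) (L
    0)) (V (L 0) (L 0) (L 0))) (L 0) (L 1)) (V (L 1) (L 1) (L 1)) (V (L 1) (L 1) (L 1)))];
[:: ([:: [:: (9, 6); (5, 0); (0, 1)]; [:: (0, 5); (5, 0); (0, 1); (4, 3)]], U (V (U (L 0) (V (L 0) (L 0) (L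
    0)) (V (L 0) (L 0) (L 0))) (L 0) (L 1)) (V (L 0) (L 1) (L 1)) (V (L 0) (L 1) (L 1)))];
[:: ([:: [:: (9, 6); (5, 0); (1, 0)]; [:: (5, 0); (1, 0); (3, 1)]; [:: (5, 0); (0, 1)]; [:: (5, 0); (0, 1);
    (4, 3)]], U (V (U (L 0) (V (L 0) (L 0) (L 0)) (V (L 0) (L 0) (L 0))) (L 0) (L 0)) (L 1) (V (L 2) (L 2)
    (L 3)))]]%N.

Definition region_neg : cells :=
  [:: (1500, [:: ((6348, -10017), (9077, 26))]);
  (1575, [:: ((6315, -10017), (9077, 25)); ((72, -9981), (765, -58))]);
  (1653, [:: ((6313, -10009), (9977, 27)); ((73, -9985), (795, -60))]);
  (1735, [:: ((6314, -10016), (9979, 12)); ((72, -9984), (3288, -72))]);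
  (1822, [:: ((6301, -9977), (9977, 26)); ((72, -9983), (3288, -71))]);
  (1913, [:: ((6301, -9980), (9977, 26)); ((73, -9986), (3287, -68))]);
  (2008, [:: ((6312, -9071), (10000, -4)); ((72, -9983), (3287, -68))]);
  (2108, [:: ((6312, -9071), (10014, -72)); ((0, -10000), (3287, -68))]);
  (2213, [:: ((6313, -9071), (10014, -72)); ((0, -10000), (3287, -68))]);
  (2324, [:: ((0, -10000), (3287, -68)); ((6313, -9071), (9979, -2260))]);
  (2440, [:: ((-23, -9080), (3287, -68)); ((6315, -9079), (9992, -2316))]);
  (2561, [:: ((-23, -9080), (3284, -56)); ((6314, -9079), (9996, -2335))]);
  (2689, [:: ((4, -9181), (3286, -62)); ((6216, -9079), (9992, -2316))]);
  (2823, [:: ((16, -9226), (6029, -9733)); ((3927, -872), (9977, -2257))]);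
  (2964, [:: ((-22, -9090), (3285, -55)); ((3928, -874), (9978, -2257))]);
  (3111, [:: ((-7, -9146), (3521, -56)); ((6216, -9079), (9977, -2257))]);
  (3266, [:: ((76, -9439), (9977, -2257))]);
  (3429, [:: ((61, -9423), (9977, -2257))]);
  (3600, [:: ((195, -9826), (9977, -2256))]);
  (3780, [:: ((0, -10000), (9910, -2080))]);
  (3968, [:: ((0, -10000), (9862, -1968))]);
  (4166, [:: ((0, -10000), (9921, -2122))]);
  (4374, [:: ((0, -10000), (9530, -1159))]);
  (4592, [:: ((0, -10000), (9076, -69))]);
  (4820, [:: ((0, -10000), (9077, -71))]);
  (5061, [:: ((0, -10000), (9076, -68))]);
  (5313, [:: ((0, -10000), (9076, -68))]);
  (5578, [:: ((0, -10000), (9076, -68))]);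
  (5856, [:: ((0, -10000), (9076, -66))]);
  (6148, [:: ((-20, -9908), (9107, -115))]);
  (6454, [:: ((31, -9985), (9065, -53))]);
  (6776, [:: ((23, -9970), (9067, -55))]);
  (7114, [:: ((53, -10009), (9067, -53))]);
  (7469, [:: ((62, -7409), (9067, -50))]);
  (7841, [:: ((1709, -9545), (9976, 24))]);
  (8232, [:: ((69, -7409), (9977, 23))]);
  (8642, [:: ((2010, -9723), (9977, 23))]);
  (9073, [:: ((2123, -9866), (10015, -68))]);
  (9525, [:: ((2255, -10017), (10009, -62))]);
  (10000, [:: ((72, -10018), (10002, -56))])].

Definition cert_neg :=
  [:: [:: ([:: [:: (2, 0); (3, 0)]; [:: (1, 0)]], U (L 0) (U (L 0) (L 0) (L 0)) (L 1))];
  [:: ([:: [:: (2, 0); (3, 0)]; [:: (2, 0); (1, 0)]], U (U (L 0) (L 0) (L 0)) (L 0) (L 1));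
   ([:: [:: (9, 0); (11, 10)]; [:: (9, 0); (11, 10); (6, 1)]], U (L 0) (U (L 1) (L 1) (L 1)) (L 1))];
  [:: ([:: [:: (1, 0)]; [:: (2, 0); (1, 0)]], U (U (L 0) (L 0) (L 0)) (L 1) (L 1));
   ([:: [:: (9, 0); (11, 10); (5, 1)]; [:: (9, 0); (11, 10)]], U (U (L 0) (L 1) (L 1)) (L 0) (L 0))];
  [:: ([:: [:: (1, 0)]], U (U (L 0) (L 0) (L 0)) (L 0) (L 0));
   ([:: [:: (9, 0); (5, 0)]; [:: (9, 0); (5, 0); (7, 10)]], U (U (L 0) (L 0) (L 0)) (L 0) (L 1))];
  [:: ([:: [:: (1, 0)]; [:: (2, 0); (1, 0)]], U (U (L 0) (L 0) (L 1)) (L 1) (L 1));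
   ([:: [:: (9, 1); (9, 0); (5, 0)]; [:: (9, 0); (5, 0); (7, 10)]], U (L 0) (L 0) (L 1))];
  [:: ([:: [:: (1, 0)]], U (U (L 0) (L 0) (L 0)) (L 0) (L 0));
   ([:: [:: (9, 0); (5, 0)]; [:: (9, 0); (5, 0); (7, 10)]], U (L 0) (L 0) (L 1))];
  [:: ([:: [:: (1, 0)]], U (U (L 0) (L 0) (L 0)) (L 0) (L 0));
   ([:: [:: (9, 0); (5, 0)]; [:: (9, 0); (5, 0); (7, 10)]], U (L 0) (L 0) (L 1))];
  [:: ([:: [:: (1, 0)]; [:: (1, 0); (4, 9)]; [:: (1, 0); (4, 0)]], U (U (L 0) (L 1) (L 2)) (L 2) (L 2));
   ([:: [:: (9, 0); (5, 0)]; [:: (9, 0); (5, 0); (7, 10)]], U (L 0) (L 0) (L 1))];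
  [:: ([:: [:: (1, 0); (4, 0)]; [:: (2, 0); (1, 0); (4, 0)]], U (U (L 0) (L 0) (L 1)) (L 1) (L 1));
   ([:: [:: (9, 0); (5, 0)]; [:: (9, 0); (5, 0); (7, 10)]], U (L 0) (L 0) (L 1))];
  [:: ([:: [:: (9, 0); (5, 0)]; [:: (10, 0); (9, 0); (5, 0); (7, 10)]], U (L 0) (L 0) (L 1));
   ([:: [:: (1, 0)]], U (U (L 0) (L 0) (L 0)) (L 0) (L 0))];
  [:: ([:: [:: (9, 0); (5, 0)]; [:: (9, 1); (9, 0); (5, 0); (7, 10)]], U (L 0) (L 0) (L 1));
   ([:: [:: (1, 0)]], U (U (L 0) (L 0) (L 0)) (L 0) (L 0))];
[:: ([:: [:: (9, 0); (5, 0)]; [:: (9, 1); (9, 0); (5, 0)]; [:: (10, 0); (9, 0); (5, 0); (7, 10)]], U (L 0)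
    (L 1) (L 2));
   ([:: [:: (1, 0)]], U (U (L 0) (L 0) (L 0)) (L 0) (L 0))];
  [:: ([:: [:: (9, 1); (9, 0); (5, 0)]; [:: (9, 0); (5, 0); (7, 10)]], U (L 0) (L 0) (L 1));
   ([:: [:: (1, 0)]; [:: (8, 10); (1, 0)]; [:: (8, 9); (1, 0)]], U (U (L 0) (L 1) (L 2)) (L 0) (L 0))];
[:: ([:: [:: (10, 0); (9, 0); (5, 0)]; [:: (9, 0); (5, 0); (7, 10); (2, 1)]; [:: (9, 0); (5, 0); (2, 1);
    (8, 9)]; [:: (9, 0); (5, 0); (5, 9)]; [:: (9, 0); (5, 0); (2, 1); (5, 9)]; [:: (9, 0); (5, 0); (1,
    0)]], U (L 0) (V (U (L 1) (L 1) (L 1)) (U (L 1) (L 1) (L 1)) (U (L 1) (L 1) (L 1))) (V (V (U (L 2) (L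
    2) (L 2)) (U (L 2) (L 2) (L 2)) (L 3)) (U (V (H (L 2) (L 4)) (L 4) (L 4)) (L 2) (L 2)) (U (V (H (L 2)
    (H (L 2) (H (L 2) (L 5)))) (H (L 2) (H (L 2) (H (L 4) (L 5)))) (H (L 2) (H (L 4) (H (L 4) (L 5))))) (L
    1) (L 1))));
   ([:: [:: (8, 9); (1, 0)]; [:: (1, 0)]], U (U (L 0) (L 0) (L 0)) (L 0) (L 1))];
  [:: ([:: [:: (9, 0); (5, 0)]; [:: (9, 0); (5, 0); (7, 10)]], U (L 0) (L 0) (L 1));
   ([:: [:: (1, 0)]; [:: (8, 9); (1, 0)]], U (U (L 0) (L 1) (L 1)) (L 1) (L 0))];
[:: ([:: [:: (9, 0); (5, 0); (7, 10)]; [:: (9, 0); (5, 0); (5, 9)]; [:: (9, 0); (5, 0); (7, 10); (5, 9)];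
    [:: (9, 0); (5, 0); (7, 10); (2, 1)]], U (L 0) (V (L 1) (U (L 2) (L 2) (L 2)) (U (L 3) (L 3) (L 3))) (L
    3));
   ([:: [:: (1, 0)]; [:: (7, 10); (1, 0)]], U (U (L 0) (L 1) (L 1)) (L 0) (L 0))];
[:: ([:: [:: (9, 1); (9, 0); (5, 0); (1, 0)]; [:: (10, 1); (9, 0); (5, 0); (1, 0)]; [:: (10, 4); (9, 0);
    (5, 0); (1, 0)]; [:: (9, 0); (5, 0); (1, 0)]; [:: (10, 3); (9, 0); (5, 0); (1, 0)]], U (U (V (L 0) (L
    1) (L 1)) (V (L 1) (V (L 2) (L 2) (L 2)) (L 2)) (V (L 2) (V (H (L 3) (L 2)) (L 4) (L 4)) (L 2))) (L 3)
    (L 3))];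
[:: ([:: [:: (9, 0); (5, 0); (1, 0)]; [:: (9, 1); (5, 0); (1, 0)]; [:: (9, 1); (9, 2); (5, 0); (1, 0)]], U
    (L 0) (L 0) (V (V (L 1) (L 2) (L 2)) (L 2) (L 2)))];
[:: ([:: [:: (10, 4); (9, 0); (5, 0); (1, 0)]; [:: (10, 1); (9, 0); (5, 0); (1, 0); (4, 6)]; [:: (10, 4);
    (9, 0); (5, 0); (1, 0); (4, 6)]; [:: (9, 1); (5, 0); (1, 0)]], U (U (L 0) (V (L 1) (L 2) (L 2)) (V (V
    (L 2) (L 1) (L 2)) (L 2) (L 2))) (V (U (L 0) (L 0) (L 0)) (L 3) (L 3)) (L 3))];
[:: ([:: [:: (9, 0); (9, 2); (5, 0); (1, 0); (4, 6)]; [:: (9, 0); (5, 0); (1, 0); (3, 10)]; [:: (9, 0); (5,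
    0); (1, 0); (4, 6)]; [:: (9, 0); (5, 0); (1, 0)]], U (U (V (V (L 0) (L 0) (L 0)) (L 0) (L 0)) (L 1) (L
    1)) (L 2) (L 3))];
[:: ([:: [:: (9, 0); (5, 0); (1, 0); (3, 10)]; [:: (9, 0); (5, 0); (1, 0); (4, 6)]], U (U (L 0) (L 0) (L
    0)) (L 1) (L 1))];
[:: ([:: [:: (9, 0); (5, 0); (1, 0)]; [:: (9, 0); (5, 0); (1, 0); (3, 10)]; [:: (9, 0); (5, 0); (2, 0); (1,
    5); (4, 6)]; [:: (0, 1); (5, 0); (1, 0); (4, 6)]], U (L 0) (L 1) (V (L 2) (L 3) (L 3)))];
  [:: ([:: [:: (0, 1); (5, 0); (1, 0)]; [:: (0, 1); (5, 0); (1, 0); (3, 10)]], U (L 0) (L 0) (L 1))];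
  [:: ([:: [:: (0, 1); (5, 0); (1, 0)]], U (L 0) (L 0) (L 0))];
  [:: ([:: [:: (0, 1); (5, 0); (1, 0)]], U (L 0) (L 0) (L 0))];
  [:: ([:: [:: (0, 1); (5, 0); (1, 0)]], U (L 0) (L 0) (L 0))];
  [:: ([:: [:: (0, 1); (5, 0); (1, 0)]], U (L 0) (L 0) (L 0))];
  [:: ([:: [:: (0, 1); (5, 0); (1, 0)]], U (L 0) (L 0) (L 0))];
  [:: ([:: [:: (0, 1); (5, 0); (1, 0)]], U (L 0) (L 0) (L 0))];
[:: ([:: [:: (9, 0); (5, 0); (1, 0)]; [:: (0, 1); (5, 0); (1, 0); (4, 9)]; [:: (0, 1); (5, 0); (1, 0); (3,
    10)]; [:: (10, 1); (0, 1); (5, 0); (1, 0); (3, 10)]], U (L 0) (L 0) (V (L 1) (L 2) (L 3)))];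
[:: ([:: [:: (9, 0); (5, 0); (1, 0)]; [:: (9, 0); (5, 0); (9, 0); (1, 0)]; [:: (0, 1); (8, 2); (9, 9); (1,
    0)]; [:: (9, 1); (5, 1); (9, 9); (1, 0)]], U (L 0) (L 1) (V (L 2) (L 3) (L 3)))];
[:: ([:: [:: (9, 0); (5, 0); (9, 0); (1, 0)]; [:: (0, 1); (9, 5); (9, 9); (1, 0)]; [:: (9, 1); (0, 1); (9,
    9); (1, 0)]; [:: (0, 1); (9, 5); (2, 4); (9, 9); (1, 0)]; [:: (0, 1); (9, 6); (8, 2); (9, 9); (1, 0)];
    [:: (0, 1); (9, 6); (10, 9); (1, 0)]; [:: (10, 4); (0, 1); (9, 9); (1, 0)]], U (L 0) (V (V (L 1) (L 1)
    (L 1)) (L 1) (L 2)) (V (V (U (L 3) (L 3) (L 3)) (L 4) (L 5)) (L 5) (L 6)))];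
[:: ([:: [:: (0, 1); (9, 5); (2, 0); (1, 0)]; [:: (0, 1); (9, 0); (1, 0)]; [:: (9, 1); (5, 1); (9, 5); (2,
    1); (1, 0)]; [:: (0, 1); (2, 4); (1, 0)]; [:: (0, 1); (9, 6); (2, 4); (1, 0)]; [:: (9, 1); (0, 1); (2,
    4); (1, 0)]; [:: (0, 1); (9, 5); (8, 2); (6, 5); (1, 0)]; [:: (9, 4); (0, 1); (1, 0)]], U (V (U (L 0)
    (L 1) (L 1)) (L 2) (L 2)) (V (V (L 3) (L 4) (L 4)) (L 5) (L 2)) (V (V (L 5) (L 4) (L 6)) (L 5) (L 7)))];
[:: ([:: [:: (9, 1); (5, 0); (9, 6); (2, 0); (1, 0)]; [:: (0, 1); (1, 0)]], U (L 0) (L 0) (V (L 0) (L 0) (L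
    1)))];
[:: ([:: [:: (0, 1); (1, 0)]; [:: (9, 1); (0, 1); (1, 0)]; [:: (9, 3); (0, 1); (1, 0)]; [:: (9, 2); (0, 1);
    (1, 0)]; [:: (5, 1); (1, 0)]; [:: (6, 4); (0, 1); (1, 0)]], U (V (L 0) (L 1) (L 2)) (V (L 1) (L 3) (U
    (L 4) (L 5) (L 1))) (L 5))];
  [:: ([:: [:: (0, 1); (1, 0); (4, 10)]; [:: (5, 0); (1, 0)]], U (V (L 0) (L 0) (L 0)) (L 1) (L 1))];
[:: ([:: [:: (0, 1); (1, 0); (4, 10)]; [:: (10, 2); (0, 1); (1, 0); (4, 10)]; [:: (5, 1); (1, 0); (4, 10)];
    [:: (6, 4); (0, 1); (1, 0); (4, 10)]], U (V (L 0) (L 1) (U (L 2) (L 2) (L 3))) (L 3) (L 3))];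
[:: ([:: [:: (9, 2); (0, 1); (1, 0); (4, 10)]; [:: (5, 1); (1, 0); (4, 10)]; [:: (6, 4); (0, 1); (1, 0);
    (4, 10)]], U (V (L 0) (U (L 1) (L 1) (L 2)) (L 2)) (L 2) (L 2))];
[:: ([:: [:: (5, 0); (1, 0); (4, 10)]; [:: (5, 0); (1, 1); (1, 0); (4, 10)]; [:: (6, 4); (0, 1); (1, 0);
    (4, 10)]; [:: (0, 1); (1, 0); (4, 10)]], U (V (U (L 0) (L 1) (L 2)) (L 2) (L 3)) (L 2) (L 2))];
[:: ([:: [:: (9, 1); (9, 3); (5, 1); (1, 1); (1, 0); (4, 10)]; [:: (9, 1); (9, 3); (6, 4); (0, 1); (1, 0);
    (3, 9); (4, 9)]; [:: (9, 1); (9, 3); (0, 1); (1, 5); (1, 9)]], U (V (U (L 0) (L 1) (V (L 1) (L 1) (L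
    1))) (L 2) (L 2)) (L 0) (L 0))]]%N.

Definition region (e : Z) : cells := if 0 <? e then region_pos else region_neg.

Lemma cert_ok :
  chk_cells region tab 1 g0 (region 1) cert_pos && chk_cells region tab (-1) g0 (region (-1)) cert_neg.
Proof. by vm_compute. Qed.
(** Covers [s] from 1/2 to 1. Digits at most 3 alone cannot do this: their sums are at least [2 *
    [0; 3, 1, 3, 1, ...] > 0.527]. *)
Definition rootsA : seq root :=
  [:: Root [:: 3; 1; 1; 1]%N [:: 4; 2; 3]%N 499759 500960;
  Root [:: 3; 2; 2]%N [:: 4; 1; 3]%N 500879 502867;
  Root [:: 3; 1; 1; 1]%N [:: 4; 2; 1]%N 502362 506275;
  Root [:: 3; 2; 1]%N [:: 4; 1; 2]%N 506239 510362;
  Root [:: 4; 1; 1]%N [:: 3; 2; 2]%N 507829 511846;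
  Root [:: 4; 1; 1]%N [:: 3; 2; 1]%N 510630 516463;
  Root [:: 4; 1; 2]%N [:: 3; 3; 1]%N 516080 519063;
  Root [:: 4; 1; 1; 1]%N [:: 3; 3; 2]%N 518679 520708;
  Root [:: 4; 1; 1]%N [:: 3; 3; 1]%N 520236 525735;
  Root [:: 3; 2; 1]%N [:: 4; 2; 1]%N 522826 526806;
  Root [:: 3; 2; 2]%N [:: 4; 3; 1]%N 525736 527600;
  Root [:: 3; 2; 1; 1]%N [:: 4; 3; 2]%N 527592 528961;
  Root [:: 3; 2; 1]%N [:: 4; 3; 1]%N 528757 531681;
  Root [:: 3; 1; 3]%N [:: 3; 1; 2; 1]%N 531595 534447;
  Root [:: 4; 2; 1]%N [:: 3; 3; 1]%N 532686 535458;
  Root [:: 3; 1; 3; 2]%N [:: 3; 1; 2; 3]%N 535430 535921;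
  Root [:: 3; 1; 2]%N [:: 3; 1; 2; 1]%N 535596 539618;
  Root [:: 3; 1; 1]%N [:: 3; 1; 3]%N 538383 546551;
  Root [:: 3; 1; 1]%N [:: 3; 1; 2]%N 542272 551737;
  Root [:: 3; 1; 1]%N [:: 3; 1; 1; 1]%N 549784 558088;
  Root [:: 3; 1; 1]%N [:: 3; 1; 1; 2]%N 557438 560611;
  Root [:: 3; 1; 2]%N [:: 3; 2; 2]%N 559717 564000;
  Root [:: 3; 1; 2]%N [:: 3; 2; 1]%N 562842 567827;
  Root [:: 2; 1; 3]%N [:: 4; 1; 3]%N 567276 570699;
  Root [:: 3; 1; 1]%N [:: 3; 2; 1]%N 569531 578742;
  Root [:: 2; 1; 2]%N [:: 4; 1; 2]%N 577131 583039;
  Root [:: 2; 1; 2]%N [:: 4; 1; 1]%N 581297 589679;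
  Root [:: 3; 2; 1]%N [:: 3; 2; 2]%N 586974 591037;
  Root [:: 2; 1; 1; 1]%N [:: 4; 1; 2]%N 589696 595870;
  Root [:: 2; 1; 1]%N [:: 4; 1; 1]%N 595039 607661;
  Root [:: 2; 1; 1; 1]%N [:: 4; 2; 1]%N 606301 612311;
  Root [:: 2; 1; 1; 2]%N [:: 4; 2; 2]%N 612135 614806;
  Root [:: 2; 1; 1; 2]%N [:: 4; 2; 1]%N 614242 617642;
  Root [:: 4; 2; 1]%N [:: 2; 1; 1; 3]%N 617564 620000;
  Root [:: 2; 1; 1; 2]%N [:: 4; 3; 1]%N 619630 622520;
  Root [:: 2; 1; 3]%N [:: 3; 1; 3]%N 622206 627153;
  Root [:: 2; 1; 3]%N [:: 3; 1; 2]%N 626216 631605;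
  Root [:: 2; 2; 1]%N [:: 4; 1; 2]%N 629919 635829;
  Root [:: 3; 1; 1]%N [:: 2; 1; 3]%N 632873 642600;
  Root [:: 3; 1; 1]%N [:: 2; 1; 2]%N 640630 650905;
  Root [:: 2; 1; 1]%N [:: 3; 1; 3]%N 650577 656103;
  Root [:: 2; 1; 1]%N [:: 3; 1; 1]%N 653170 671850;
  Root [:: 2; 1; 2]%N [:: 3; 3; 1]%N 670271 677594;
  Root [:: 3; 1; 2]%N [:: 2; 2; 3]%N 677208 681624;
  Root [:: 2; 1; 1]%N [:: 3; 2; 1]%N 681301 688617;
  Root [:: 3; 1; 1]%N [:: 2; 2; 2]%N 687735 695986;
  Root [:: 3; 1; 1]%N [:: 2; 2; 1]%N 693418 703695;
  Root [:: 2; 3; 1]%N [:: 3; 1; 3]%N 702344 707291;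
  Root [:: 2; 3; 1]%N [:: 3; 1; 2]%N 706354 711743;
  Root [:: 3; 2; 2]%N [:: 2; 2; 1; 1; 1]%N 711729 713517;
  Root [:: 3; 1; 1]%N [:: 2; 3; 1]%N 713011 722738;
  Root [:: 2; 2; 1; 1]%N [:: 3; 3; 3]%N 722071 723222;
  Root [:: 2; 2; 1]%N [:: 3; 3; 1]%N 723059 730384;
  Root [:: 3; 2; 1]%N [:: 2; 3; 2]%N 730125 734332;
  Root [:: 2; 1; 2]%N [:: 2; 1; 2; 1]%N 731487 739015;
  Root [:: 2; 1; 1]%N [:: 2; 1; 3]%N 736844 752388;
  Root [:: 2; 1; 1]%N [:: 2; 1; 2]%N 744058 762071;
  Root [:: 2; 1; 1]%N [:: 2; 1; 1; 1]%N 758212 774116;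
  Root [:: 4; 1; 1]%N [:: 1; 1; 3; 1]%N 773715 780084;
  Root [:: 2; 1; 2]%N [:: 2; 2; 2]%N 778027 786207;
  Root [:: 2; 2; 1]%N [:: 2; 1; 2]%N 784287 793916;
  Root [:: 1; 1; 2; 1]%N [:: 4; 1; 1]%N 791448 800546;
  Root [:: 2; 1; 1]%N [:: 2; 2; 1]%N 796846 814862;
  Root [:: 4; 2; 1]%N [:: 1; 1; 2; 2; 1]%N 814324 816673;
  Root [:: 2; 1; 1; 1; 1]%N [:: 2; 3; 3]%N 815053 817574;
  Root [:: 2; 1; 1]%N [:: 2; 3; 1]%N 816982 832526;
  Root [:: 1; 1; 1; 1]%N [:: 4; 1; 1]%N 824905 839893;
  Root [:: 1; 1; 2; 1]%N [:: 3; 1; 3]%N 839889 846881;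
  Root [:: 1; 1; 1; 2]%N [:: 4; 1; 1]%N 844239 853334;
  Root [:: 3; 1; 1]%N [:: 1; 1; 2; 1]%N 850613 861313;
  Root [:: 3; 1; 1]%N [:: 1; 1; 2; 2]%N 860173 868477;
  Root [:: 3; 1; 1]%N [:: 1; 1; 2; 3]%N 868007 871469;
  Root [:: 1; 1; 2; 1]%N [:: 3; 2; 1]%N 870891 878947;
  Root [:: 1; 1; 1; 1]%N [:: 3; 1; 2]%N 877057 883894;
  Root [:: 1; 1; 1; 1]%N [:: 3; 1; 1]%N 883754 901275;
  Root [:: 3; 1; 2]%N [:: 1; 1; 1; 2; 1]%N 900094 904712;
  Root [:: 3; 1; 1]%N [:: 1; 1; 1; 2]%N 903404 914100;
  Root [:: 3; 1; 1]%N [:: 1; 1; 1; 3]%N 913629 922751;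
  Root [:: 4; 1; 1]%N [:: 1; 2; 2; 2]%N 922443 927215;
  Root [:: 2; 1; 2]%N [:: 1; 1; 3; 1]%N 924301 932829;
  Root [:: 2; 1; 2]%N [:: 1; 1; 3; 2]%N 932780 935913;
  Root [:: 1; 2; 1; 1]%N [:: 4; 1; 1]%N 934451 944145;
  Root [:: 1; 1; 2; 1]%N [:: 2; 1; 2]%N 941486 952936;
  Root [:: 2; 1; 2]%N [:: 1; 1; 2; 2]%N 951026 958693;
  Root [:: 2; 1; 1]%N [:: 1; 1; 2; 1]%N 955715 972588;
  Root [:: 2; 1; 1]%N [:: 1; 1; 2; 2]%N 971823 978313;
  Root [:: 1; 1; 1; 1]%N [:: 2; 1; 2]%N 974625 991495;
  Root [:: 1; 1; 1; 1]%N [:: 2; 1; 1; 1]%N 987775 1003574].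

(** Covers [s] from 1 to 151/100: the bound 3/2 for [gamma - a], and 1/100 for the shift of the
    target in [extend]. *)
Definition rootsB : seq root :=
  [:: Root [:: 2; 1; 1]%N [:: 1; 1; 1; 1; 1]%N 996426 1012225;
  Root [:: 2; 1; 1]%N [:: 1; 1; 1; 2]%N 1008505 1025375;
  Root [:: 2; 1; 1]%N [:: 1; 1; 1; 3]%N 1025091 1032311;
  Root [:: 1; 1; 1; 1]%N [:: 2; 2; 1]%N 1027412 1044285;
  Root [:: 1; 1; 1; 2]%N [:: 2; 2; 2]%N 1041307 1048974;
  Root [:: 2; 2; 1]%N [:: 1; 1; 1; 2]%N 1047064 1058514;
  Root [:: 2; 2; 1]%N [:: 1; 1; 1; 3]%N 1057227 1065758;
  Root [:: 3; 2; 1]%N [:: 1; 3; 2; 1]%N 1065744 1070006;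
  Root [:: 2; 1; 2]%N [:: 1; 2; 2; 1]%N 1068265 1076319;
  Root [:: 1; 3; 1; 1]%N [:: 3; 2; 1]%N 1076307 1081939;
  Root [:: 2; 1; 1; 1]%N [:: 1; 2; 2; 1]%N 1081463 1088074;
  Root [:: 1; 2; 1; 1]%N [:: 2; 1; 2]%N 1085900 1096596;
  Root [:: 2; 1; 2]%N [:: 1; 2; 1; 2]%N 1095302 1103577;
  Root [:: 2; 1; 1]%N [:: 1; 2; 1; 1]%N 1098725 1116246;
  Root [:: 2; 1; 1]%N [:: 1; 2; 1; 2]%N 1116106 1122943;
  Root [:: 2; 2; 1]%N [:: 1; 2; 2; 1]%N 1121053 1129109;
  Root [:: 1; 2; 1; 1]%N [:: 2; 2; 3]%N 1128531 1131993;
  Root [:: 1; 2; 1; 1]%N [:: 2; 2; 2]%N 1131523 1139827;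
  Root [:: 1; 2; 1; 1]%N [:: 2; 2; 1]%N 1138687 1149387;
  Root [:: 2; 2; 1]%N [:: 1; 2; 1; 2]%N 1148090 1156367;
  Root [:: 1; 1; 2; 1]%N [:: 1; 1; 2; 1; 1]%N 1155555 1162972;
  Root [:: 2; 1; 1]%N [:: 1; 3; 1; 1]%N 1160107 1175095;
  Root [:: 1; 1; 1; 1]%N [:: 1; 1; 3; 1]%N 1167474 1183018;
  Root [:: 1; 1; 1; 1; 1]%N [:: 1; 1; 3; 3]%N 1182852 1184894;
  Root [:: 2; 2; 2]%N [:: 1; 3; 2; 1]%N 1183336 1187249;
  Root [:: 1; 1; 1; 1]%N [:: 1; 1; 2; 1]%N 1185138 1203154;
  Root [:: 1; 1; 1; 1; 1]%N [:: 1; 1; 2; 2]%N 1202181 1208907;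
  Root [:: 1; 1; 1; 2]%N [:: 1; 1; 2; 1; 1]%N 1208346 1215759;
  Root [:: 1; 1; 2; 1]%N [:: 1; 1; 1; 3]%N 1215172 1223149;
  Root [:: 1; 1; 1; 1]%N [:: 1; 1; 1; 1; 2]%N 1221039 1227132;
  Root [:: 1; 1; 1; 1]%N [:: 1; 1; 1; 1; 1]%N 1225884 1241788;
  Root [:: 1; 1; 1; 1]%N [:: 1; 1; 1; 2]%N 1237929 1255942;
  Root [:: 1; 1; 1; 1; 1]%N [:: 1; 1; 1; 3]%N 1255601 1263159;
  Root [:: 1; 1; 1; 2]%N [:: 1; 1; 1; 2; 1]%N 1260985 1268513;
  Root [:: 1; 1; 1; 2]%N [:: 1; 1; 1; 3]%N 1267963 1275937;
  Root [:: 1; 1; 2; 1; 1]%N [:: 1; 2; 3; 2]%N 1275835 1277097;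
  Root [:: 1; 1; 2; 1; 1]%N [:: 1; 2; 3; 2]%N 1277085 1278447;
  Root [:: 1; 2; 1; 1]%N [:: 1; 1; 3; 1]%N 1277262 1286989;
  Root [:: 1; 2; 1; 1; 1]%N [:: 1; 1; 3; 2]%N 1286595 1290190;
  Root [:: 1; 2; 1; 2]%N [:: 1; 1; 3; 1; 1]%N 1289635 1293656;
  Root [:: 1; 1; 3; 1]%N [:: 1; 2; 1; 3]%N 1292709 1297656;
  Root [:: 1; 2; 1; 1]%N [:: 1; 1; 2; 1]%N 1296305 1306582;
  Root [:: 1; 1; 2; 1]%N [:: 1; 2; 1; 2]%N 1305257 1313783;
  Root [:: 1; 1; 1; 1]%N [:: 1; 2; 2; 1]%N 1311383 1318699;
  Root [:: 1; 2; 1; 2]%N [:: 1; 1; 2; 3]%N 1318376 1322792;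
  Root [:: 1; 1; 1; 2]%N [:: 1; 2; 3; 1]%N 1322406 1329729;
  Root [:: 1; 1; 1; 1]%N [:: 1; 2; 1; 1]%N 1328150 1346830;
  Root [:: 1; 1; 2; 1]%N [:: 1; 3; 2; 1]%N 1346564 1353978;
  Root [:: 1; 2; 1; 1]%N [:: 1; 1; 1; 2; 1]%N 1351201 1359381;
  Root [:: 1; 2; 1; 1]%N [:: 1; 1; 1; 3]%N 1357400 1367127;
  Root [:: 1; 3; 1; 1]%N [:: 1; 1; 2; 2]%N 1366207 1371779;
  Root [:: 1; 3; 1; 1]%N [:: 1; 1; 2; 3]%N 1370599 1374648;
  Root [:: 1; 1; 1; 3]%N [:: 1; 2; 1; 3]%N 1372847 1377794;
  Root [:: 1; 1; 1; 1; 2]%N [:: 1; 3; 3; 1]%N 1377480 1380370;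
  Root [:: 1; 3; 2; 1]%N [:: 1; 1; 1; 1; 3]%N 1380000 1382436;
  Root [:: 1; 1; 1; 1; 2]%N [:: 1; 3; 2; 1]%N 1382358 1385758;
  Root [:: 1; 1; 1; 1; 2]%N [:: 1; 3; 2; 2]%N 1385194 1387865;
  Root [:: 1; 1; 1; 1; 1]%N [:: 1; 3; 2; 1]%N 1387689 1393699;
  Root [:: 1; 1; 1; 1]%N [:: 1; 3; 1; 1]%N 1392339 1404961;
  Root [:: 1; 1; 1; 1; 1]%N [:: 1; 3; 1; 2]%N 1404130 1410304;
  Root [:: 1; 1; 1; 3]%N [:: 1; 3; 2; 1]%N 1408968 1413986;
  Root [:: 1; 3; 1; 1]%N [:: 1; 1; 1; 2; 1]%N 1412862 1418705;
  Root [:: 1; 1; 1; 2]%N [:: 1; 3; 1; 2]%N 1416961 1422869;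
  Root [:: 1; 2; 1; 1]%N [:: 1; 2; 2; 1]%N 1421258 1430469;
  Root [:: 1; 2; 1; 1; 1]%N [:: 1; 2; 2; 2]%N 1429875 1433342;
  Root [:: 1; 2; 1; 2]%N [:: 1; 2; 2; 1]%N 1432173 1437158;
  Root [:: 1; 2; 2; 1]%N [:: 1; 2; 1; 3]%N 1437097 1441146;
  Root [:: 1; 2; 1; 1]%N [:: 1; 2; 1; 1; 2]%N 1439389 1442562;
  Root [:: 1; 2; 1; 1]%N [:: 1; 2; 1; 1; 1]%N 1441912 1450216;
  Root [:: 1; 2; 1; 1]%N [:: 1; 2; 1; 2]%N 1448263 1457728;
  Root [:: 1; 2; 1; 1]%N [:: 1; 2; 1; 3]%N 1453449 1461617;
  Root [:: 1; 2; 1; 2]%N [:: 1; 2; 1; 2; 1]%N 1460382 1464404;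
  Root [:: 1; 2; 1; 3]%N [:: 1; 2; 1; 2; 2]%N 1464372 1465437;
  Root [:: 1; 3; 2; 1]%N [:: 1; 2; 3; 1; 1]%N 1465220 1467329;
  Root [:: 1; 2; 3; 1]%N [:: 1; 3; 2; 2]%N 1466835 1469172;
  Root [:: 1; 2; 2; 1]%N [:: 1; 3; 3; 1]%N 1468319 1471243;
  Root [:: 1; 2; 2; 1; 1]%N [:: 1; 3; 3; 2]%N 1471039 1472408;
  Root [:: 1; 2; 2; 2]%N [:: 1; 3; 3; 1]%N 1472400 1474264;
  Root [:: 1; 2; 2; 1]%N [:: 1; 3; 2; 1]%N 1473194 1477174;
  Root [:: 1; 2; 3; 1]%N [:: 1; 3; 1; 1; 1]%N 1477012 1479765;
  Root [:: 1; 3; 2; 1]%N [:: 1; 2; 2; 3]%N 1479328 1481697;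
  Root [:: 1; 3; 1; 2]%N [:: 1; 2; 3; 1; 1]%N 1481619 1483934;
  Root [:: 1; 3; 1; 1]%N [:: 1; 2; 2; 1]%N 1483537 1489370;
  Root [:: 1; 3; 1; 1]%N [:: 1; 2; 2; 2]%N 1488154 1492171;
  Root [:: 1; 3; 1; 1; 1]%N [:: 1; 2; 2; 3]%N 1491948 1494006;
  Root [:: 1; 2; 1; 1; 1]%N [:: 1; 3; 2; 1]%N 1493725 1497638;
  Root [:: 1; 2; 2; 2]%N [:: 1; 3; 1; 3; 1]%N 1497533 1499122;
  Root [:: 1; 3; 1; 3]%N [:: 1; 2; 2; 3]%N 1499084 1500666;
  Root [:: 1; 2; 1; 1]%N [:: 1; 3; 1; 1]%N 1500542 1509571;
  Root [:: 1; 2; 1; 1]%N [:: 1; 3; 1; 2]%N 1507178 1513736].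

Lemma rootsA_ok : chk_roots region digits4 500000 1000000 rootsA.
Proof. by vm_compute. Qed.

Lemma rootsB_ok : chk_roots region digits3 1000000 1510000 rootsB.
Proof. by vm_compute. Qed.
End Certificate.

(** * Soundness of the certificate *)

Section Zr.
Variable R : realFieldType.

Definition zr (z : Z) : R := (int_of_Z z)%:~R.

Lemma zrD a b : zr (Z.add a b) = zr a + zr b.
Proof. by rewrite /zr -intrD; congr _%:~R; lia. Qed.
Lemma zrM a b : zr (Z.mul a b) = zr a * zr b.
Proof. by rewrite /zr -intrM; congr _%:~R; nia. Qed.
Lemma zrN a : zr (Z.opp a) = - zr a.
Proof. by rewrite /zr -intrN; congr _%:~R; lia. Qed.
Lemma zrB a b : zr (Z.sub a b) = zr a - zr b.
Proof. by rewrite -Z.add_opp_r zrD zrN. Qed.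
Definition zrE := (zrD, zrM, zrN, zrB).

Lemma zr_le a b : Z.leb a b -> zr a <= zr b.
Proof. by move=> ab; rewrite ler_int; lia. Qed.
Lemma zr_lt a b : Z.ltb a b -> zr a < zr b.
Proof. by move=> ab; rewrite ltr_int; lia. Qed.
Lemma zr_leP a b : (zr a <= zr b) = Z.leb a b.
Proof. by rewrite ler_int; apply/idP/idP; lia. Qed.
Lemma zr_nat n : zr (Z.of_nat n) = n%:R.
Proof. by rewrite /zr pmulrn; congr _%:~R; lia. Qed.
Lemma zr1 : zr 1 = 1. Proof. by []. Qed.
End Zr.

Local Arguments Z.add : simpl never.
Local Arguments Z.sub : simpl never.
Local Arguments Z.mul : simpl never.
Local Arguments Z.opp : simpl never.
Local Opaque zr NN.

Section Sound.
Variable R : realFieldType.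
Local Notation zr := (zr R).
Local Notation N := (zr NN).

Lemma N_gt0 : 0 < N.
Proof. exact: (@zr_lt R 0). Qed.

Lemma hi2_ge a x y (z : R) : zr x <= z <= zr y -> zr a * z <= zr (hi2 a x y).
Proof.
rewrite /hi2 => /andP[xz zy]; case: ifPn => a0; rewrite zrM.
  by rewrite ler_wpM2l // (@zr_le R 0).
by rewrite ler_wnM2l // -[0]/(zr 0) zr_leP; lia.
Qed.

Lemma lo2_le a x y (z : R) : zr x <= z <= zr y -> zr (lo2 a x y) <= zr a * z.
Proof.
rewrite /lo2 => /andP[xz zy]; case: ifPn => a0; rewrite zrM.
  by rewrite ler_wpM2l // (@zr_le R 0).
by rewrite ler_wnM2l // -[0]/(zr 0) zr_leP; lia.
Qed.

Lemma zr_div a b : Z.ltb 0 b -> zr (Z.div a b) * zr b <= zr a.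
Proof.
move=> b0; rewrite -zrM zr_leP Z.mul_comm; apply/Z.leb_le.
by apply: Z.mul_div_le; lia.
Qed.

Lemma zr_cdiv a b : Z.ltb 0 b -> zr a <= zr (cdiv a b) * zr b.
Proof. by move=> b0; have := zr_div (Z.opp a) b0; rewrite /cdiv !zrN; lra. Qed.

Lemma zr_gt0 a : Z.ltb 0 a = (0 < zr a).
Proof. by rewrite -[0]/(zr 0) ltNge zr_leP; lia. Qed.

Lemma leb2_trans y x z : leb2 x y -> leb2 y z -> leb2 x z.
Proof. rewrite /leb2; lia. Qed.

Lemma leb2_refl x : leb2 x x.
Proof. rewrite /leb2; lia. Qed.

Lemma min2_l x y : leb2 (min2 x y) x.
Proof. by apply/andP; split; apply/Z.leb_le; apply: Z.le_min_l. Qed.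

Lemma min2_r x y : leb2 (min2 x y) y.
Proof. by apply/andP; split; apply/Z.leb_le; apply: Z.le_min_r. Qed.

Lemma pick_piece_sound d dn up v w ps w' : pick_piece d dn up v w ps = Some w' ->
  leb2 w' w /\ exists2 p, p \in ps &
    leb2 (dn (if Z.ltb 0 d then p.1 else p.2)) v &&
    leb2 w' (up (if Z.ltb 0 d then p.2 else p.1)).
Proof.
elim: ps => //= p ps IH; case: ifP => [/andP[h _] [<-]|_ /IH[? [q qps h]]].
  split; first exact: min2_l.
  by exists p; rewrite ?mem_head // h min2_r.
by split=> //; exists q; rewrite ?inE ?qps ?orbT.
Qed.

Fixpoint in_cell (x : R) gl (cs : cells) (ps : seq piece) : Prop :=
  if cs is (gh, ps') :: cs' then
    (zr gl <= x <= zr gh /\ ps = ps') \/ in_cell x gh cs' ps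
  else False.

Lemma scan_sound f gl ql qh w cs w' :
  (forall w1 ps w2, f w1 ps = Some w2 -> leb2 w2 w1) ->
  scan f gl ql qh w cs = Some w' ->
  leb2 w' w /\
  forall x ps, zr ql <= x <= zr qh -> in_cell x gl cs ps ->
    exists w1 w2, f w1 ps = Some w2 /\ leb2 w' w2.
Proof.
move=> fm; elim: cs gl w => [gl w [<-]|[gh ps] cs IH gl w] /=.
  by split=> //; exact: leb2_refl.
case: ifP => [hq|/negbT hq].
  case E : (f w ps) => [w1|//] /IH[h1 h2].
  split; first exact: leb2_trans h1 (fm _ _ _ E).
  move=> x ps' hx [[_ ->]|]; first by exists w, w1.
  exact: h2.
move=> /IH[h1 h2]; split=> // x ps' hx [[hx' _]|]; last exact: h2.
exfalso; move: hq; rewrite negb_and -!(zr_leP R) -!ltNge.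
by case/orP=> ?; lra.
Qed.

Definition isgn (z : Z) := z = Zpos xH \/ z = Zneg xH.

Lemma zr_sgn z : isgn z -> zr z = 1 \/ zr z = -1.
Proof. by case=> ->; [left|right; rewrite (zrN R (Zpos xH))]. Qed.

Section Move.
Variable region : Z -> cells.

Definition in_piece (p : piece) (r s : R) :=
  zr p.1.1 + zr p.1.2 * r <= N * s <= zr p.2.1 + zr p.2.2 * r.

Definition in_region e (r s : R) :=
  exists2 ps, in_cell (N * r) g0 (region e) ps & exists2 p, p \in ps & in_piece p r s.

Variables (th : R) (rl rh : Z).
Hypothesis th01 : 0 <= th <= 1.
(** With [th] the relative position of [N * r] between [rl] and [rh], this is the value at [r] of
    the affine function with end values [v]. *)
Definition chord (v : Z * Z) : R := (1 - th) * zr v.1 + th * zr v.2.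

Lemma chord_le v w : leb2 v w -> chord v <= chord w.
Proof.
case/andP=> /(zr_le R) h1 /(zr_le R) h2; rewrite /chord; move/andP: th01 => [a b].
by apply: lerD; apply: ler_wpM2l => //; lra.
Qed.

Variables (e : Z) (r S T S' T' : R) (d d' : Z) (t u : row_bounds).
Hypothesis rE : N * r = chord (rl, rh).
Hypothesis r_gt0 : 0 < r.
Hypotheses (hS : zr (s0 t) <= N * S <= zr (s1 t)) (hT : zr (t0 t) <= N * T <= zr (t1 t)).
Hypotheses (hS' : zr (s0 u) <= N * S' <= zr (s1 u)) (hT' : zr (t0 u) <= N * T' <= zr (t1 u)).

(** With [dd] the product of the two orientations, [N * sg = G dd a] is the line
    [N * sg2 = a.1 + a.2 * r2] written in the coordinates before the move. *)
Definition G dd (a : aff) : R :=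
  (N - zr a.1) * S + zr a.1 * T + r * ((zr e * N - zr dd * zr a.2) * S' + zr dd * zr a.2 * T').

Lemma GE dd a : N ^+ 2 * G dd a =
  N * ((N - zr a.1) * (N * S) + zr a.1 * (N * T)) +
  (N * r) * ((zr e * N - zr dd * zr a.2) * (N * S') + zr dd * zr a.2 * (N * T')).
Proof. rewrite /G; ring. Qed.

Lemma rl_rh : 0 <= N * r.
Proof. by rewrite mulr_ge0 ?ltW // N_gt0. Qed.

Lemma bnd_hi dd a : N ^+ 2 * G dd a <= chord (bnd hi2 e dd t u rl rh a).
Proof.
rewrite GE.
have h1 := hi2_ge (Z.sub NN a.1) hS; have h2 := hi2_ge a.1 hT.
have h3 := hi2_ge (Z.sub (Z.mul e NN) (Z.mul dd a.2)) hS'; have h4 := hi2_ge (Z.mul dd a.2) hT'.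
rewrite /chord /bnd /=; rewrite !zrE in h1 h2 h3 h4 *.
have N0 := N_gt0; have r0 := rl_rh.
have hc : N * ((N - zr a.1) * (N * S) + zr a.1 * (N * T)) <=
  N * (zr (hi2 (Z.sub NN a.1) (s0 t) (s1 t)) + zr (hi2 a.1 (t0 t) (t1 t))).
  by apply: ler_wpM2l; [exact: ltW|exact: lerD].
apply: le_trans (lerD hc (ler_wpM2l r0 (lerD h3 h4))) _.
by rewrite rE /chord /= le_eqVlt; apply/orP; left; apply/eqP; ring.
Qed.

Lemma bnd_lo dd a : chord (bnd lo2 e dd t u rl rh a) <= N ^+ 2 * G dd a.
Proof.
rewrite GE.
have h1 := lo2_le (Z.sub NN a.1) hS; have h2 := lo2_le a.1 hT.
have h3 := lo2_le (Z.sub (Z.mul e NN) (Z.mul dd a.2)) hS'; have h4 := lo2_le (Z.mul dd a.2) hT'.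
rewrite /chord /bnd /=; rewrite !zrE in h1 h2 h3 h4 *.
have N0 := N_gt0; have r0 := rl_rh.
have hc : N * (zr (lo2 (Z.sub NN a.1) (s0 t) (s1 t)) + zr (lo2 a.1 (t0 t) (t1 t))) <=
   N * ((N - zr a.1) * (N * S) + zr a.1 * (N * T)).
  by apply: ler_wpM2l; [exact: ltW|exact: lerD].
apply: le_trans (lerD hc (ler_wpM2l r0 (lerD h3 h4))).
by rewrite rE /chord /= le_eqVlt; apply/orP; left; apply/eqP; ring.
Qed.

Hypotheses (hd : isgn d) (hd' : isgn d') (he : isgn e).
Let E := zr d * (T - S).
Let E' := zr d' * (T' - S').
Hypotheses (et : Z.ltb 0 (e0 t)) (eu : Z.ltb 0 (e0 u)).
Hypotheses (hE : zr (e0 t) <= N * E <= zr (e1 t)) (hE' : zr (e0 u) <= N * E' <= zr (e1 u)).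
Hypotheses (rl0 : Z.ltb 0 rl) (rlrh : Z.leb rl rh).
Hypothesis cover : forall e x, zr g0 <= x <= N -> exists ps, in_cell x g0 (region e) ps.

Variable sg : R.
Let dd := Z.mul d d'.
Let e2 := Z.mul e dd.
Let r2 := r * E' / E.
Let sg2 := (sg - S - zr e * r * S') / (T - S).

Lemma E_gt0 : 0 < E.
Proof.
have N0 := N_gt0; have := et; rewrite zr_gt0 => h; have /andP[h1 _] := hE.
by rewrite -(pmulr_rgt0 _ N0); lra.
Qed.

Lemma E'_gt0 : 0 < E'.
Proof.
have N0 := N_gt0; have := eu; rewrite zr_gt0 => h; have /andP[h1 _] := hE'.
by rewrite -(pmulr_rgt0 _ N0); lra.
Qed.

Lemma TS_neq0 : T - S != 0.
Proof. by apply/eqP => h; have := E_gt0; rewrite /E h mulr0 ltxx. Qed.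

Lemma r2_gt0 : 0 < r2.
Proof. exact: divr_gt0 (mulr_gt0 r_gt0 E'_gt0) E_gt0. Qed.

Lemma r2E : r2 = r * zr dd * (T' - S') / (T - S).
Proof.
have := TS_neq0; rewrite /r2 /E /E' /dd zrM => h.
by have [->|->] := zr_sgn hd; field; rewrite // h ?oppr_eq0 ?oner_neq0.
Qed.

(* The image of an affine bound in the new coordinates, pulled back to the old
   ones, is again affine in [r]. *)
Lemma Gkey a : N * sg - G dd a = (T - S) * (N * sg2 - zr a.1 - zr a.2 * r2).
Proof. by have h := TS_neq0; rewrite /G r2E /sg2; field. Qed.

Lemma r_bounds : zr rl <= N * r <= zr rh.
Proof.
rewrite rE /chord /=; have := zr_le R rlrh; move/andP: th01 => [h0 h1] h2.
by apply/andP; split; nra.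
Qed.

Lemma cube_mul (x y : R) : x ^+ 3 * y = x ^+ 2 * (x * y).
Proof. by rewrite mulrA -exprSr. Qed.

Lemma piece_between v w p :
  leb2 (bnd hi2 e dd t u rl rh (if Z.ltb 0 d then p.1 else p.2)) v ->
  leb2 w (bnd lo2 e dd t u rl rh (if Z.ltb 0 d then p.2 else p.1)) ->
  chord v <= N ^+ 3 * sg <= chord w -> in_piece p r2 sg2.
Proof.
move=> /chord_le h1 /chord_le h2 /andP[h3 h4].
have N0 := N_gt0; have N2 : 0 < N ^+ 2 by rewrite exprn_gt0.
have N3 : N ^+ 3 * sg = N ^+ 2 * (N * sg) by exact: cube_mul.
have {h1 h3} : G dd (if Z.ltb 0 d then p.1 else p.2) <= N * sg.
  rewrite -(ler_pM2l N2) -N3; apply: le_trans h3.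
  by apply: le_trans h1; exact: bnd_hi.
have {h2 h4} : N * sg <= G dd (if Z.ltb 0 d then p.2 else p.1).
  rewrite -(ler_pM2l N2) -N3; apply: le_trans h4 _.
  by apply: le_trans h2 _; exact: bnd_lo.
have := E_gt0; rewrite /in_piece /E; move: hd => [dE|dE]; rewrite dE /=.
  rewrite mul1r => W0; rewrite -subr_le0 Gkey pmulr_rle0 // => h1.
  by rewrite -subr_ge0 Gkey pmulr_rge0 // => h2; apply/andP; lra.
rewrite (zrN R (Zpos xH)) mulN1r oppr_gt0 => W0.
rewrite -subr_le0 Gkey nmulr_rle0 // => h1.
by rewrite -subr_ge0 Gkey nmulr_rge0 // => h2; apply/andP; lra.
Qed.

Lemma in_piece_mirror p : in_piece (mirror e2 p) r2 sg2 ->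
  in_piece p r2^-1 (sg2 / (zr e2 * r2)).
Proof.
have r0 := r2_gt0; have rn := lt0r_neq0 r0.
case: p => [[a0 a1] [b0 b1]]; rewrite /in_piece /mirror.
have ha : (zr a0 + zr a1 / r2) * r2 = zr a0 * r2 + zr a1 by field.
have hb : (zr b0 + zr b1 / r2) * r2 = zr b0 * r2 + zr b1 by field.
have [-> | ->] : isgn e2.
- by rewrite /e2 /dd; move: he hd hd' => [->|->] [->|->] [->|->]; [left|right|right|left|right|left|left|right].
- rewrite (zr1 R) mul1r /= => /andP[h1 h2].
  have hy : N * sg2 = N * (sg2 / r2) * r2 by field.
  by apply/andP; split; rewrite -(ler_pM2r r0) -hy ?ha ?hb; lra.
rewrite (zrN R (Zpos xH)) (zr1 R) mulN1r /= !zrE => /andP[h1 h2].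
have hy : - (N * sg2) = N * (sg2 / (- r2)) * r2 by field.
by apply/andP; split; rewrite -(ler_pM2r r0) -hy ?ha ?hb; lra.
Qed.

Lemma bound_step_sound v w : bound_step region e rl rh t u d d' v = Some w ->
  chord v <= N ^+ 3 * sg <= chord w ->
  in_region e2 r2 sg2 \/ in_region e2 r2^-1 (sg2 / (zr e2 * r2)).
Proof.
rewrite /bound_step -/dd -/e2; case: ifP => // /andP[hql hpl].
set f := pick_piece _ _ _ _.
case E1 : (scan f _ _ _ _ _) => [w1|//] E2 hsg.
have fm w2 ps w3 : f w2 ps = Some w3 -> leb2 w3 w2 by case/pick_piece_sound.
have [h1 H1] := scan_sound fm E1.
have [h2 H2] := scan_sound (fun a b => fm a (map (mirror e2) b)) E2.
have N0 := N_gt0; have r20 := r2_gt0.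
have /andP[r_l r_h] := r_bounds.
have /andP[hEl hEh] := hE; have /andP[hEl' hEh'] := hE'.
have et0 := et; have eu0 := eu; have rl0' := rl0; rewrite !zr_gt0 in et0 eu0 rl0'.
have E0 := E_gt0; have E'0 := E'_gt0.
have NE0 : 0 < N * E by rewrite mulr_gt0.
have NE'0 : 0 < N * E' by rewrite mulr_gt0.
have key : (N * r2) * (N * E) = (N * r) * (N * E').
  by rewrite /r2; field; rewrite lt0r_neq0.
have key' : (N / r2) * ((N * r) * (N * E')) = N * N * (N * E).
  by rewrite -key; field; rewrite lt0r_neq0.
have b1 : (N * r) * (N * E') <= zr rh * zr (e1 u) by apply: ler_pM => //; apply: ltW; lra.
have b2 : zr rl * zr (e0 u) <= (N * r) * (N * E') by apply: ler_pM => //; apply: ltW.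
have t1p : 0 < zr (e1 t) by lra.
have ru0 : 0 < zr rl * zr (e0 u) by rewrite mulr_gt0.
have Nr2 : 0 < N * r2 by rewrite mulr_gt0.
have Nr2' : 0 < N / r2 by rewrite divr_gt0.
(* If [r2 > 1], the second interval has become the longer one, and the state is described with the
   roles exchanged. *)
have [r1|r1] := lerP r2 1.
- left.
  have x_in : zr (Z.div (Z.mul rl (e0 u)) (e1 t)) <= N * r2 <=
              zr (cdiv (Z.mul rh (e1 u)) (e0 t)).
    apply/andP; split.
      rewrite -(ler_pM2r t1p); apply: le_trans (zr_div _ _) _; first by rewrite zr_gt0.
      rewrite zrM; apply: le_trans b2 _; rewrite -key.
      by rewrite ler_pM2l.
    rewrite -(ler_pM2r et0); apply: le_trans (zr_cdiv _ _); last by rewrite zr_gt0.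
    rewrite zrM; apply: le_trans b1; rewrite -key.
    by rewrite ler_pM2l.
  have [ps hps] : exists ps, in_cell (N * r2) g0 (region e2) ps.
    apply: cover; apply/andP; split.
      by move/(zr_le R): hql => hql; case/andP: x_in => x_in _; lra.
    by rewrite -[leRHS]mulr1 ler_pM2l.
  have [v1 [v2 [fv vw]]] := H1 _ _ x_in hps.
  have [_ [p pps /andP[p1 p2]]] := pick_piece_sound fv.
  exists ps => //; exists p => //; apply: piece_between p1 p2 _.
  case/andP: hsg => -> hsg /=; apply: le_trans hsg _; apply: chord_le.
  exact: leb2_trans h2 vw.
right.
have x_in : zr (Z.div (Z.mul (Z.mul NN NN) (e0 t)) (Z.mul rh (e1 u))) <= N * r2^-1 <=
            zr (cdiv (Z.mul (Z.mul NN NN) (e1 t)) (Z.mul rl (e0 u))).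
  have ru1 : 0 < zr rh * zr (e1 u) by apply: lt_le_trans b1; rewrite mulr_gt0 // ; lra.
  apply/andP; split.
    rewrite -(ler_pM2r ru1) -zrM; apply: le_trans (zr_div _ _) _; first by rewrite zr_gt0 zrM.
    rewrite !zrM; apply: (@le_trans _ _ (N * N * (N * E))).
      by apply: ler_wpM2l hEl; apply: mulr_ge0; exact: ltW.
    by apply: le_trans (ler_wpM2l (ltW Nr2') b1); rewrite key'.
  rewrite -(ler_pM2r ru0) -zrM; apply: le_trans (zr_cdiv _ _); last by rewrite zr_gt0 zrM.
  rewrite !zrM; apply: (@le_trans _ _ (N * N * (N * E))).
    by apply: le_trans (ler_wpM2l (ltW Nr2') b2) _; rewrite key'.
  by apply: ler_wpM2l hEh; apply: mulr_ge0; exact: ltW.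
have [ps hps] : exists ps, in_cell (N * r2^-1) g0 (region e2) ps.
  apply: cover; apply/andP; split.
    by move/(zr_le R): hpl => hpl; case/andP: x_in => x_in _; lra.
  by rewrite -[leRHS]mulr1 ler_pM2l // invf_le1 // ltW.
have [v1 [v2 [fv vw]]] := H2 _ _ x_in hps.
have [_ [q /mapP[p pps ->] /andP[p1 p2]]] := pick_piece_sound fv.
exists ps => //; exists p => //; apply: in_piece_mirror; apply: piece_between p1 p2 _.
case/andP: hsg => -> hsg /=; apply: le_trans hsg _; apply: chord_le; exact: vw.
Qed.
End Move.
End Sound.

(** * Every piece of the region admits a move *)

Section Step.
Variable R : realFieldType.
Local Notation zr := (zr R).
Local Notation N := (zr NN).

Definition hull_lo : R := 53%:R / 200%:R.
Definition hull_hi : R := 79%:R / 100%:R.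
Local Notation mR := hull_lo.
Local Notation MR := hull_hi.
(** For [b = beta w], the position of [cf w x] between [cf w hull_lo] (value 0) and [cf w hull_hi]
    (value 1). By [cfB_lam] it depends on [w] only through [beta w]. *)
Definition hull_coord (b x : R) := (x - mR) * (1 + b * MR) / ((MR - mR) * (1 + b * x)).
Definition word i := nth [::] words i.
Definition Sv b i := hull_coord b (cf (word i) mR).
Definition Tv b i := hull_coord b (cf (word i) MR).

Definition satisfies_bounds b i (t : row_bounds) :=
  [/\ zr (s0 t) <= N * Sv b i <= zr (s1 t), zr (t0 t) <= N * Tv b i <= zr (t1 t),
      Z.ltb 0 (e0 t) & zr (e0 t) <= N * (zr (sgn i) * (Tv b i - Sv b i)) <= zr (e1 t)].

Definition goodstep b b' e r sg i j :=
  let e2 := Z.mul e (Z.mul (sgn i) (sgn j)) in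
  let r2 := r * (zr (sgn j) * (Tv b' j - Sv b' j)) / (zr (sgn i) * (Tv b i - Sv b i)) in
  let sg2 := (sg - Sv b i - zr e * r * Sv b' j) / (Tv b i - Sv b i) in
  in_region region e2 r2 sg2 \/ in_region region e2 r2^-1 (sg2 / (zr e2 * r2)).

Lemma isgn_sgn i : isgn (sgn i).
Proof. by rewrite /isgn /sgn; case: ifP; [right|left]. Qed.

Lemma all_zip_mem (T1 : eqType) T2 (P : T1 * T2 -> bool) s1 s2 x :
  size s1 = size s2 -> all P (zip s1 s2) -> x \in s1 -> exists y, P (x, y).
Proof.
elim: s1 s2 => [//|a s1 IH] [//|c s2] /= [sz] /andP[Pa Ps]; rewrite inE.
by case/predU1P => [->|]; [exists c|exact: IH sz Ps].
Qed.

Lemma chk_cells_cover e gl cs ct x : chk_cells region tab e gl cs ct -> cs != [::] ->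
  zr gl <= x <= N -> exists ps, in_cell x gl cs ps.
Proof.
elim: cs gl ct => [//|[gh ps] cs IH] gl [//|c ct] /= /and4P[_ _ _ h] _ /andP[h1 h2].
have [xh|hx] := lerP x (zr gh); first by exists ps; left; split; [apply/andP|].
case: cs ct IH h => [|[gh' q] cs] [|c' ct] IH h; try by [].
  by move/Z.eqb_eq: h hx => ->; rewrite ltNge h2.
have hx' : zr gh <= x <= N by rewrite (ltW hx).
by have [ps' ?] := IH gh _ h isT hx'; exists ps'; right.
Qed.

Lemma chk_cells_piece e gl cs ct x ps p : chk_cells region tab e gl cs ct ->
  in_cell x gl cs ps -> p \in ps ->
  exists rl rh ls t, [/\ certifies region tab e rl rh p ls 0 0 t, zr rl <= x <= zr rh,
    Z.ltb rl rh & Z.leb gl rl].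
Proof.
elim: cs gl ct => [//|[gh ps'] cs IH] gl [//|c ct] /= /and4P[glh /eqP sz hall hrec].
case=> [[hx ->] pps|/(IH _ _ hrec) h /h [rl [rh [ls [t [h1 h2 h3 h4]]]]]]; last first.
  by exists rl, rh, ls, t; split=> //; lia.
have [[ls t] ht] := all_zip_mem sz hall pps.
by exists gl, gh, ls, t; split=> //; exact: Z.leb_refl.
Qed.

Variables (d1 d2 d1' d2' : nat) (b b' : R).

(** The nodes whose recorded digits agree with the last digit [d1] and the digit [d2] before it. *)
Definition known_node (d1 d2 n : nat) := [|| n == 0, n == d1 | n == 3 * d1 + d2]%N.

Hypotheses (hd1 : (0 < d1 < 4)%N) (hd2 : (0 < d2 < 4)%N).
Hypotheses (hd1' : (0 < d1' < 4)%N) (hd2' : (0 < d2' < 4)%N).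
Hypothesis rowsb : forall n i, known_node d1 d2 n -> (i < 13)%N ->
  satisfies_bounds b i (nth row0 (rowsof tab n) i).
Hypothesis rowsb' : forall n i, known_node d1' d2' n -> (i < 13)%N ->
  satisfies_bounds b' i (nth row0 (rowsof tab n) i).

Lemma region_or e : region e = region (Zpos xH) \/ region e = region (Zneg xH).
Proof. by rewrite /region; case: ifP => _; [left|right]. Qed.

Lemma region_neq0 e : region e != [::].
Proof. by case: (region_or e) => ->. Qed.

Lemma region_cover e (x : R) : zr g0 <= x <= N -> exists ps, in_cell x g0 (region e) ps.
Proof.
have /andP[cP cM] := cert_ok; have := region_neq0 e.
case: (region_or e) => ->; [exact: (chk_cells_cover cP)|exact: (chk_cells_cover cM)].
Qed.

(** A position above the current level is either settled by the next move or above the next level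
    too. The alternative [l = [::]] is there because an empty list leaves the level where it was. *)
Lemma run_sound n n' e rl rh th r sg l v w :
  known_node d1 d2 n -> known_node d1' d2' n' -> isgn e -> 0 <= th <= 1 ->
  N * r = chord th (rl, rh) -> 0 < r -> Z.ltb 0 rl -> Z.leb rl rh ->
  run region (rowsof tab n) (rowsof tab n') e rl rh l v = Some w ->
  chord th v <= N ^+ 3 * sg ->
  (exists i j, [/\ (0 < i + j)%N, (i < 13)%N, (j < 13)%N & goodstep b b' e r sg i j])
  \/ chord th w < N ^+ 3 * sg \/ l = [::].
Proof.
move=> an an' he th01 rE r0 rl0 rlrh; elim: l v => [|[i j] l IH] v; first by right; right.
rewrite /=; case: ifP => // /and3P[ij i13 j13].
case E: (bound_step _ _ _ _ _ _ _ _ _) => [v1|//] hr hv.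
have [h|h] := lerP (N ^+ 3 * sg) (chord th v1); last first.
  have [h'|[h'|h']] := IH _ hr (ltW h); [by left|by right; left|].
  by right; left; move: hr; rewrite h' /= => -[<-].
left; exists i, j; split=> //.
have [hS hT et hE] := rowsb an i13; have [hS' hT' eu hE'] := rowsb' an' j13.
apply: (bound_step_sound th01 rE r0 hS hT hS' hT' (isgn_sgn i) (isgn_sgn j) he et eu hE hE' rl0 rlrh _ E).
  exact: region_cover.
by rewrite hv.
Qed.

Local Arguments run : simpl never.

Lemma eq_imp_le (x y : R) : x = y -> x <= y.
Proof. by move=> ->. Qed.

Lemma chk_sound e rl rh p ls n n' t r sg :
  known_node d1 d2 n -> known_node d1' d2' n' -> isgn e ->
  0 < r -> Z.ltb 0 rl -> Z.leb rl rh -> zr rl <= N * r <= zr rh ->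
  certifies region tab e rl rh p ls n n' t -> in_piece p r sg ->
  exists i j, [/\ (0 < i + j)%N, (i < 13)%N, (j < 13)%N & goodstep b b' e r sg i j].
Proof.
move=> + + he r0; elim: t n n' rl rh => [k|t1 IH1 t2 IH2 t3 IH3|t1 IH1 t2 IH2 t3 IH3|t1 IH1 t2 IH2]
   n n' rl rh an an' rl0 rlrh hx /=.
- case El: (nth _ _ _) => [//|o l].
  case E: (run _ _ _ _ _ _ _ _) => [w|//] hw /andP[p1 p2].
  have [th [th01 rE]] : exists th, 0 <= th <= 1 /\ N * r = chord th (rl, rh).
    move: hx => /andP[x1 x2]; have := zr_le R rlrh; rewrite le_eqVlt => /orP[/eqP q|q].
      by exists 0; rewrite /chord /=; split; [rewrite lexx ler01|lra].
    have q0 : 0 < zr rh - zr rl by lra.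
    exists ((N * r - zr rl) / (zr rh - zr rl)); rewrite /chord /=; split.
      by rewrite divr_ge0 ?ler_pdivrMr //=; lra.
    by field; rewrite lt0r_neq0.
  have N0 := N_gt0 R.
  have ch a : chord th (ends rl rh a) = N ^+ 2 * (zr a.1 + zr a.2 * r).
    rewrite /ends /chord /= !zrE; move: rE; rewrite /chord /= => rE.
    transitivity (N * (N * zr a.1 + zr a.2 * (N * r))); last by ring.
    by rewrite rE; ring.
  have N2 : 0 < N ^+ 2 by rewrite exprn_gt0.
  have e3 := cube_mul N sg.
  have hst : chord th (ends rl rh p.1) <= N ^+ 3 * sg.
    by rewrite ch; apply: le_trans (ler_wpM2l (ltW N2) p1) (eq_imp_le (esym e3)).
  case: (run_sound an an' he th01 rE r0 rl0 rlrh E hst) => [h|[h|h]]; first exact: h.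
    exfalso; move: h; rewrite ltNge => /negP; apply.
    apply: le_trans (chord_le th01 hw); rewrite ch.
    by apply: le_trans (eq_imp_le e3) (ler_wpM2l (ltW N2) p2).
  by rewrite h in El.
- move=> /and4P[n4 h1 h2 h3] pr.
  have : known_node d1 d2 (3 * n + 1) || known_node d1 d2 (3 * n + 2) || known_node d1 d2 (3 * n + 3).
    by move: an; rewrite /known_node; lia.
  by case/orP => [/orP[]|] a; [apply: IH1 a an' _ _ _ h1 pr|apply: IH2 a an' _ _ _ h2 pr|apply: IH3 a an' _ _ _ h3 pr].
- move=> /and4P[n4 h1 h2 h3] pr.
  have : known_node d1' d2' (3 * n' + 1) || known_node d1' d2' (3 * n' + 2) || known_node d1' d2' (3 * n' + 3).
    by move: an'; rewrite /known_node; lia.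
  by case/orP => [/orP[]|] a; [apply: IH1 an a _ _ _ h1 pr|apply: IH2 an a _ _ _ h2 pr|apply: IH3 an a _ _ _ h3 pr].
move=> /and4P[m1 m2 h1 h2] pr; move: hx => /andP[x1 x2].
set rm := Z.div _ _ in m1 m2 h1 h2.
have [xm|xm] := lerP (N * r) (zr rm).
  by apply: IH1 an an' _ _ _ h1 pr; rewrite ?x1.
by apply: IH2 an an' _ _ _ h2 pr; rewrite ?x2 ?(ltW xm) //; lia.
Qed.

End Step.

Local Transparent zr NN.

(** * Correctness of the table of bounds *)

Section Rows.
Variable R : realFieldType.
Local Notation zr := (zr R).
Local Notation N := (zr NN).
Local Notation mR := (@hull_lo R).
Local Notation MR := (@hull_hi R).

Definition pr (y : Z * Z) : R := zr y.1 / zr y.2.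
Definition posz (y : Z * Z) := 0 < zr y.1 /\ 0 < zr y.2.

Lemma cfzE w x : pos_digits w -> posz x -> posz (cfz w x) /\ pr (cfz w x) = cf w (pr x).
Proof.
move=> + hx; elim: w => [//|d w IH] /= /andP[d0 /IH [[h1 h2] h3]].
have dR : 0 < d%:R :> R by rewrite ltr0n.
rewrite /posz /pr /= !zrE zr_nat; split; first by split=> //; nra.
rewrite -h3 /pr; field; rewrite lt0r_neq0 //=; nra.
Qed.

Lemma cf_mono w (x y : R) : pos_digits w -> 0 < x <= y ->
  if odd (size w) then cf w y <= cf w x else cf w x <= cf w y.
Proof.
elim: w => [_ /andP[_]//|d w IH] /= /andP[d0 w0] xy; have := IH w0 xy.
have dR : 0 < d%:R :> R by rewrite ltr0n.
have [x0 y0] : 0 < x /\ 0 < y by case/andP: xy => ? ?; lra.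
have := cf_ge0 w (ltW x0); have := cf_ge0 w (ltW y0).
by case: odd => /= h1 h2 h; rewrite lef_pV2 ?posrE; lra.
Qed.

Definition tnum (n : R) (t b : R * R) : R :=
  n * (200%:R * t.1 - 53%:R * t.2) * (100%:R * b.2 + 79%:R * b.1).
Definition tden (t b : R * R) : R := 10500%:R * (b.2 * t.2 + b.1 * t.1).
Definition ratio (t : R * R) := t.1 / t.2.

Definition conv (u : R) (x y : R) := (1 - u) * x + u * y.

Lemma tnum_tden n s t b : 0 < t.2 -> 0 < b.2 ->
  tnum n t b - s * tden t b = 20000%:R * b.2 * t.2 *
   (n * ((ratio t - mR) * (1 + ratio b * MR)) - s * ((MR - mR) * (1 + ratio b * ratio t))).
Proof.
by move=> t2 b2; rewrite /tnum /tden /ratio /hull_lo /hull_hi; field; rewrite !lt0r_neq0.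
Qed.

(** After multiplication by the positive denominator the claim is affine in [beta], so the two ends
    of its interval decide. Upper bounds come from the same lemma with the signs of [n] and [s]
    changed. *)
Lemma lam_ge n s t b b' u :  0 < t.1 -> 0 < t.2 -> 0 < b.1 -> 0 < b.2 -> 0 < b'.1 -> 0 < b'.2 ->
  0 <= u <= 1 ->
  s * tden t b <= tnum n t b -> s * tden t b' <= tnum n t b' ->
  s <= n * hull_coord (conv u (ratio b) (ratio b')) (ratio t).
Proof.
move=> t1 t2 p1 p2 p1' p2' /andP[u0 u1].
rewrite -subr_ge0 tnum_tden // pmulr_rge0; last by rewrite !mulr_gt0 // ltr0n.
move=> h1; rewrite -subr_ge0 tnum_tden // pmulr_rge0; last by rewrite !mulr_gt0 // ltr0n.
move=> h2.
have r0 : 0 < ratio t by rewrite divr_gt0.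
have r1 : 0 < ratio b by rewrite divr_gt0.
have r2 : 0 < ratio b' by rewrite divr_gt0.
move: (ratio t) (ratio b) (ratio b') r0 r1 r2 h1 h2 => T B B' r0 r1 r2 h1 h2.
have c0 : 0 < conv u B B' by rewrite /conv; nra.
have mM : 0 < MR - mR by rewrite /hull_lo /hull_hi; lra.
rewrite /hull_coord mulrA ler_pdivlMr; last by rewrite mulr_gt0 //; nra.
rewrite -subr_ge0.
have -> : n * ((T - mR) * (1 + conv u B B' * MR)) - s * ((MR - mR) * (1 + conv u B B' * T)) =
  (1 - u) * (n * ((T - mR) * (1 + B * MR)) - s * ((MR - mR) * (1 + B * T))) +
  u * (n * ((T - mR) * (1 + B' * MR)) - s * ((MR - mR) * (1 + B' * T))).
  by rewrite /conv; ring.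
by rewrite addr_ge0 // mulr_ge0 // subr_ge0.
Qed.

Definition rpol1 (x y b b' : R * R) : R :=
  (b.2 * x.2 + b.1 * x.1) * (b'.2 * y.2 + b'.1 * y.1) +
  (b'.2 * x.2 + b'.1 * x.1) * (b.2 * y.2 + b.1 * y.1).
Definition rpolm (b b' : R * R) : R :=
  (200%:R * b.2 + 53%:R * b.1) * (100%:R * b'.2 + 79%:R * b'.1) +
  (200%:R * b'.2 + 53%:R * b'.1) * (100%:R * b.2 + 79%:R * b.1).

(* A symmetric bilinear form: nonnegativity on pairs of end points of an interval
   gives nonnegativity on the diagonal over the whole interval. *)
Definition qpol (n s x y B B' : R) : R :=
  n * (y - x) * ((1 + B * mR) * (1 + B' * MR) + (1 + B' * mR) * (1 + B * MR)) -
  s * ((MR - mR) * ((1 + B * x) * (1 + B' * y) + (1 + B' * x) * (1 + B * y))).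

Lemma qpolE n s x y b b' : 0 < x.2 -> 0 < y.2 -> 0 < b.2 -> 0 < b'.2 ->
  n * (y.1 * x.2 - x.1 * y.2) * rpolm b b' - s * (10500%:R * rpol1 x y b b') =
  20000%:R * b.2 * b'.2 * x.2 * y.2 * qpol n s (ratio x) (ratio y) (ratio b) (ratio b').
Proof.
move=> x2 y2 b2 b2'; rewrite /rpolm /rpol1 /qpol /ratio /hull_lo /hull_hi.
by field; rewrite !lt0r_neq0.
Qed.

Lemma lamB (x y B : R) : 0 < x -> 0 < y -> 0 < B ->
  hull_coord B y - hull_coord B x = (y - x) * ((1 + B * mR) * (1 + B * MR)) /
    ((MR - mR) * ((1 + B * x) * (1 + B * y))).
Proof.
move=> x0 y0 B0; rewrite /hull_coord /hull_lo /hull_hi; field.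
by rewrite !lt0r_neq0 //; nra.
Qed.

Lemma lamB_ge n s x y b b' u :
  0 < x.1 -> 0 < x.2 -> 0 < y.1 -> 0 < y.2 -> 0 < b.1 -> 0 < b.2 -> 0 < b'.1 -> 0 < b'.2 ->
  0 <= u <= 1 ->
  let q c c' := s * (10500%:R * rpol1 x y c c') <= n * (y.1 * x.2 - x.1 * y.2) * rpolm c c' in
  q b b -> q b b' -> q b' b' ->
  s <= n * (hull_coord (conv u (ratio b) (ratio b')) (ratio y) - hull_coord (conv u (ratio b) (ratio b')) (ratio x)).
Proof.
move=> x1 x2 y1 y2 p1 p2 p1' p2' /andP[u0 u1] q.
have qE c c' : 0 < c.2 -> 0 < c'.2 -> q c c' -> 0 <= qpol n s (ratio x) (ratio y) (ratio c) (ratio c').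
  move=> c0 c0'; rewrite /q -subr_ge0 qpolE // pmulr_rge0 //.
  by rewrite !mulr_gt0 // ltr0n.
move=> /(qE _ _ p2 p2) h1 /(qE _ _ p2 p2') h2 /(qE _ _ p2' p2') h3.
set B := conv u _ _.
have r0 : 0 < ratio x by rewrite divr_gt0.
have r0' : 0 < ratio y by rewrite divr_gt0.
have r1 : 0 < ratio b by rewrite divr_gt0.
have r2 : 0 < ratio b' by rewrite divr_gt0.
have c0 : 0 < B by rewrite /B /conv; nra.
have mM : 0 < MR - mR by rewrite /hull_lo /hull_hi; lra.
have d1 : 0 < 1 + B * ratio x by nra.
have d2 : 0 < 1 + B * ratio y by nra.
rewrite lamB // (mulrA n) ler_pdivlMr; last by rewrite !mulr_gt0.
have : 0 <= qpol n s (ratio x) (ratio y) B B.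
  have -> : qpol n s (ratio x) (ratio y) B B =
    (1 - u) ^+ 2 * qpol n s (ratio x) (ratio y) (ratio b) (ratio b) +
    2%:R * (u * (1 - u)) * qpol n s (ratio x) (ratio y) (ratio b) (ratio b') +
    u ^+ 2 * qpol n s (ratio x) (ratio y) (ratio b') (ratio b').
    by rewrite /qpol /B /conv; ring.
  have u1' : 0 <= 1 - u by lra.
  by rewrite !addr_ge0 // mulr_ge0 // ?sqr_ge0 // mulr_ge0 // mulr_ge0.
rewrite /qpol; set k1 := (1 + B * mR) * (1 + B * MR); set k2 := (MR - mR) * _.
have -> : k2 = 2%:R * ((MR - mR) * ((1 + B * ratio x) * (1 + B * ratio y))) by rewrite /k2; ring.
lra.
Qed.

Definition zp (t : Z * Z) : R * R := (zr t.1, zr t.2).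

Lemma words_pos i : pos_digits (nth [::] words i).
Proof. by do 13?[case: i => [//|i]]; rewrite nth_default. Qed.

Lemma nodes_pos i : pos_digits (nth [::] nodes i).
Proof. by do 13?[case: i => [//|i]]; rewrite nth_default. Qed.

Lemma posz_pos p q : posz (Zpos p, Zpos q).
Proof. by split; apply: (@zr_lt R 0). Qed.

Lemma pr_pos p q : pr (Zpos p, Zpos q) = (Pos.to_nat p)%:R / (Pos.to_nat q)%:R.
Proof. by []. Qed.

Lemma between_conv (x y z : R) : x <= z <= y -> exists2 u, 0 <= u <= 1 & z = conv u x y.
Proof.
case/andP=> xz zy; have [xy|xy] := ltrP x y; last first.
  by exists 0; rewrite ?lexx ?ler01 // /conv; lra.
have d : 0 < y - x by lra.
exists ((z - x) / (y - x)); first by rewrite divr_ge0 ?ler_pdivrMr //=; lra.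
by rewrite /conv; field; rewrite lt0r_neq0.
Qed.

Lemma nodeends_between n x : 1%:R / 4%:R <= x <= 4%:R / 5%:R ->
  [/\ posz (nodeends n).1, posz (nodeends n).2 & exists2 u, 0 <= u <= 1 &
      cf (nth [::] nodes n) x = conv u (pr (nodeends n).1) (pr (nodeends n).2)].
Proof.
have w0 := nodes_pos n; rewrite -!(pr_pos 1 4) -!(pr_pos 4 5) => /andP[h1 h2].
have [a1 b1] := cfzE w0 (posz_pos 1 4); have [a2 b2] := cfzE w0 (posz_pos 4 5).
have x0 : 0 < pr xlo by rewrite /pr divr_gt0 //; case: (posz_pos 1 4).
have xx0 : 0 < x by apply: lt_le_trans h1.
have c1 := @cf_mono _ (pr xlo) x w0 (introT andP (conj x0 h1)).
have c2 := @cf_mono _ x (pr xhi) w0 (introT andP (conj xx0 h2)).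
rewrite /nodeends; move: c1 c2; case: odd => c1 c2 /=; split=> //; rewrite b1 b2;
  apply: between_conv; exact/andP.
Qed.

Lemma tnum_zp t b : zr (Z.mul (Z.mul NN (Z.sub (Z.mul 200 t.1) (Z.mul 53 t.2)))
   (Z.add (Z.mul 100 b.2) (Z.mul 79 b.1))) = tnum N (zp t) (zp b).
Proof. by rewrite !zrE. Qed.

Lemma tden_zp t b : zr (Z.mul 10500 (Z.add (Z.mul b.2 t.2) (Z.mul b.1 t.1))) = tden (zp t) (zp b).
Proof. by rewrite !zrE. Qed.

Lemma le_num s t b :
  Z.leb (Z.mul s (Z.mul 10500 (Z.add (Z.mul b.2 t.2) (Z.mul b.1 t.1))))
    (Z.mul (Z.mul NN (Z.sub (Z.mul 200 t.1) (Z.mul 53 t.2))) (Z.add (Z.mul 100 b.2) (Z.mul 79 b.1))) ->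
  zr s * tden (zp t) (zp b) <= tnum N (zp t) (zp b).
Proof. by move/(zr_le R); rewrite tnum_zp zrM tden_zp. Qed.

Lemma ge_num s t b :
  Z.leb (Z.mul (Z.mul NN (Z.sub (Z.mul 200 t.1) (Z.mul 53 t.2))) (Z.add (Z.mul 100 b.2) (Z.mul 79 b.1)))
   (Z.mul s (Z.mul 10500 (Z.add (Z.mul b.2 t.2) (Z.mul b.1 t.1)))) ->
  (- zr s) * tden (zp t) (zp b) <= tnum (- N) (zp t) (zp b).
Proof.
move/(zr_le R); rewrite tnum_zp zrM tden_zp mulNr => h.
by rewrite /tnum !mulNr lerN2.
Qed.

Lemma pol1_zp x y b b' : zr (Z.mul 10500 (pol1 x y b b')) = 10500%:R * rpol1 (zp x) (zp y) (zp b) (zp b').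
Proof. by rewrite /pol1 !zrE. Qed.

Lemma polm_zp b b' : zr (polm b b') = rpolm (zp b) (zp b').
Proof. by rewrite /polm !zrE. Qed.

Lemma del_zp i x y b b' :
  zr (Z.mul (Z.mul NN (Z.mul (sgn i) (Z.sub (Z.mul y.1 x.2) (Z.mul x.1 y.2)))) (polm b b')) =
  (N * zr (sgn i)) * ((zp y).1 * (zp x).2 - (zp x).1 * (zp y).2) * rpolm (zp b) (zp b').
Proof.
have e := zrM R NN (Z.mul (sgn i) (Z.sub (Z.mul y.1 x.2) (Z.mul x.1 y.2))).
have e' := zrM R (sgn i) (Z.sub (Z.mul y.1 x.2) (Z.mul x.1 y.2)).
rewrite zrM polm_zp e e' (mulrA N (zr (sgn i))); congr (_ * _ * _).
by rewrite zrB; congr (_ - _); exact: zrM.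
Qed.

Lemma le_pol s i x y b b' :
  Z.leb (Z.mul s (Z.mul 10500 (pol1 x y b b')))
   (Z.mul (Z.mul NN (Z.mul (sgn i) (Z.sub (Z.mul y.1 x.2) (Z.mul x.1 y.2)))) (polm b b')) ->
  zr s * (10500%:R * rpol1 (zp x) (zp y) (zp b) (zp b')) <=
  (N * zr (sgn i)) * ((zp y).1 * (zp x).2 - (zp x).1 * (zp y).2) * rpolm (zp b) (zp b').
Proof.
move/(zr_le R) => h; have e := del_zp i x y b b'; have e' := zrM R s (Z.mul 10500 (pol1 x y b b')).
by have h2 := eq_ind _ (fun z => _ <= z) h _ e; have h3 := eq_ind _ (fun z => z <= _) h2 _ e';
   rewrite pol1_zp in h3.
Qed.

Lemma oppM3 (a k1 k2 k3 k4 : R) : k1 * k2 * k3 <= a * k4 -> - a * k4 <= - k1 * k2 * k3.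
Proof. by rewrite !mulNr lerN2. Qed.

Lemma ge_pol s i x y b b' :
  Z.leb (Z.mul (Z.mul NN (Z.mul (sgn i) (Z.sub (Z.mul y.1 x.2) (Z.mul x.1 y.2)))) (polm b b'))
    (Z.mul s (Z.mul 10500 (pol1 x y b b'))) ->
  (- zr s) * (10500%:R * rpol1 (zp x) (zp y) (zp b) (zp b')) <=
  (- (N * zr (sgn i))) * ((zp y).1 * (zp x).2 - (zp x).1 * (zp y).2) * rpolm (zp b) (zp b').
Proof.
move/(zr_le R) => h; have e := del_zp i x y b b'; have e' := zrM R s (Z.mul 10500 (pol1 x y b b')).
have h2 := eq_ind _ (fun z => z <= _) h _ e; have h3 := eq_ind _ (fun z => _ <= z) h2 _ e'.
by rewrite pol1_zp in h3; exact: oppM3 h3.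
Qed.

Lemma row_sound n i t (x : R) : chk_row n i t -> 1%:R / 4%:R <= x <= 4%:R / 5%:R ->
  satisfies_bounds (cf (nth [::] nodes n) x) i t.
Proof.
rewrite /chk_row => hc /(@nodeends_between n); move: hc.
case: (nodeends n) => lo hi hc /= [[l1 l2] [r1 r2] [u u01 ->]]; move: hc.
have [[xp1 xp2] Ex] := cfzE (words_pos i) (posz_pos 53 200).
have [[yp1 yp2] Ey] := cfzE (words_pos i) (posz_pos 79 100).
rewrite -/mz in xp1 xp2 Ex; rewrite -/Mz in yp1 yp2 Ey.
move: (cfz _ mz) (cfz _ Mz) xp1 xp2 Ex yp1 yp2 Ey => X Y xp1 xp2 Ex yp1 yp2 Ey.
move=> /andP[/andP[/le_num a1 /ge_num a2] /andP[/andP[/le_num a3 /ge_num a4]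
  /andP[/andP[/le_num a5 /ge_num a6] /andP[/andP[/le_num a7 /ge_num a8]
  /andP[/andP[/le_pol q1 /ge_pol q1'] /andP[/andP[/le_pol q2 /ge_pol q2']
  /andP[/andP[/le_pol q3 /ge_pol q3'] e]]]]]]].
have S1 := lam_ge (t := zp X) (b := zp lo) (b' := zp hi) xp1 xp2 l1 l2 r1 r2 u01 a1 a3.
have S2 := lam_ge (t := zp X) (b := zp lo) (b' := zp hi) xp1 xp2 l1 l2 r1 r2 u01 a2 a4.
have T1 := lam_ge (t := zp Y) (b := zp lo) (b' := zp hi) yp1 yp2 l1 l2 r1 r2 u01 a5 a7.
have T2 := lam_ge (t := zp Y) (b := zp lo) (b' := zp hi) yp1 yp2 l1 l2 r1 r2 u01 a6 a8.
have E1 := lamB_ge (x := zp X) (y := zp Y) (b := zp lo) (b' := zp hi)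
  xp1 xp2 yp1 yp2 l1 l2 r1 r2 u01 q1 q2 q3.
have E2 := lamB_ge (x := zp X) (y := zp Y) (b := zp lo) (b' := zp hi)
  xp1 xp2 yp1 yp2 l1 l2 r1 r2 u01 q1' q2' q3'.
rewrite -![ratio (zp _)]/(pr _) Ex Ey in S1 S2 T1 T2 E1 E2.
rewrite -/(Sv _ i) -/(Tv _ i) in S1 S2 T1 T2 E1 E2.
rewrite !mulNr !lerN2 in S2 T2 E2.
by split; rewrite // ?S1 ?S2 ?T1 ?T2 // mulrA E1.
Qed.

End Rows.

Local Opaque zr NN.

(** * Approximation of s by [0; u] + [0; v] *)

Section Words.
Variable R : realFieldType.
Local Notation zr := (zr R).
Local Notation N := (zr NN).
Local Notation mR := (@hull_lo R).
Local Notation MR := (@hull_hi R).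

Lemma mR_gt0 : 0 < mR. Proof. by rewrite /hull_lo; lra. Qed.
Lemma mR_lt_MR : mR < MR. Proof. by rewrite /hull_lo /hull_hi; lra. Qed.
Lemma MR_gt0 : 0 < MR. Proof. exact: lt_trans mR_gt0 mR_lt_MR. Qed.

Definition det w : R := (num w).2%:R * (den w).1%:R - (num w).1%:R * (den w).2%:R.

Lemma detE w : det w = (-1) ^+ size w.
Proof.
have := congr1 (fun z : int => z%:~R : R) (cont_det w).
by rewrite rmorphB /= rmorphXn /= rmorphN1 -!pmulrn !natrM => <-.
Qed.

Lemma det_norm w : `|det w| = 1.
Proof. by rewrite detE normrX normrN1 expr1n. Qed.

Lemma cfB w (x y : R) : pos_digits w -> 0 <= x -> 0 <= y ->
  cf w y - cf w x = (y - x) * det w /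
   (((den w).1%:R + x * (den w).2%:R) * ((den w).1%:R + y * (den w).2%:R)).
Proof.
move=> w0 x0 y0; rewrite !cfE //.
have := denR_gt0 w0 x0; have := denR_gt0 w0 y0; rewrite /det.
move: (num w).1 (num w).2 (den w).1 (den w).2 => a b c d h1 h2.
by field; rewrite !lt0r_neq0.
Qed.

Lemma cfB_lam w (x : R) : pos_digits w -> 0 < x ->
  cf w x - cf w mR = (cf w MR - cf w mR) * hull_coord (beta R w) x.
Proof.
move=> w0 x0; have m0 := mR_gt0; have M0 := MR_gt0; have mM := mR_lt_MR.
rewrite !cfB ?ltW //.
have h1 := denR_gt0 w0 (ltW m0); have h2 := denR_gt0 w0 (ltW M0).
have h3 := denR_gt0 w0 (ltW x0).
have := den_gt0 w0; rewrite -(ltr_nat R) /hull_coord /beta.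
move: (det w) (den w).1 (den w).2 h1 h2 h3 => D c d h1 h2 h3 c0.
move: mR MR m0 M0 mM h1 h2 => m M m0 M0 mM h1 h2.
field; rewrite !lt0r_neq0 //; lra.
Qed.

Definition hull_len w := cf w MR - cf w mR.

Lemma hull_len_neq0 w : pos_digits w -> hull_len w != 0.
Proof.
move=> w0; have m0 := mR_gt0; have M0 := MR_gt0; have mM := mR_lt_MR.
have D0 : det w != 0 by rewrite -normr_gt0 det_norm.
have d0 : MR - mR != 0 by rewrite lt0r_neq0 // subr_gt0.
have n1 := denR_gt0 w0 (ltW m0); have n2 := denR_gt0 w0 (ltW M0).
by rewrite /hull_len cfB ?ltW // !mulf_neq0 // invr_eq0 mulf_neq0 // lt0r_neq0.
Qed.

Lemma cf_dist w (x y : R) : pos_digits w -> 0 <= x <= 1 -> 0 <= y <= 1 ->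
  `|cf w x - cf w y| <= ((den w).1%:R ^+ 2)^-1.
Proof.
move=> w0 /andP[x0 x1] /andP[y0 y1]; rewrite cfB // normrM normrM det_norm mulr1.
have q0 : 0 < (den w).1%:R :> R by rewrite ltr0n den_gt0.
have h1 : (den w).1%:R <= (den w).1%:R + x * (den w).2%:R :> R by rewrite lerDl mulr_ge0.
have h2 : (den w).1%:R <= (den w).1%:R + y * (den w).2%:R :> R by rewrite lerDl mulr_ge0.
have xy : `|x - y| <= 1 by rewrite ler_norml; lra.
move: (den w).1%:R (_ + x * _) (_ + y * _) q0 h1 h2 => q u v q0 h1 h2.
rewrite (@ger0_norm _ (_^-1)) ?invr_ge0; last by rewrite mulr_ge0; lra.
rewrite -[leRHS]mul1r; apply: ler_pM => //; first by rewrite invr_ge0 mulr_ge0; lra.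
rewrite lef_pV2 ?posrE ?exprn_gt0 //; last by rewrite mulr_gt0; lra.
by rewrite expr2; apply: ler_pM; lra.
Qed.

(** Used to bound a denominator from below: a word whose values vary little has a large
    denominator. *)
Lemma cf_dist_ge w : pos_digits w ->
  (2%:R * (den w).1%:R ^+ 2)^-1 <= `|cf w 0 - cf w (1 : R)|.
Proof.
move=> w0; rewrite cfB ?ler01 // normrM normrM det_norm mulr1 sub0r normrN1 mul1r.
have q0 : 0 < (den w).1%:R :> R by rewrite ltr0n den_gt0.
have qq : (den w).2%:R <= (den w).1%:R :> R by rewrite ler_nat den_le.
have q20 : 0 <= (den w).2%:R :> R by [].
move: (den w).1%:R (den w).2%:R q0 qq q20 => q q' q0 qq q20.
rewrite ger0_norm ?invr_ge0; last by rewrite mulr_ge0; lra.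
rewrite mul1r mul0r addr0 lef_pV2 ?posrE; first by nra.
  by rewrite mulr_gt0 ?exprn_gt0.
by rewrite mulr_gt0 //; lra.
Qed.

Lemma hull_len_le w : pos_digits w -> `|hull_len w| <= ((den w).1%:R ^+ 2)^-1.
Proof. by move=> w0; apply: cf_dist => //; rewrite /hull_lo /hull_hi; lra. Qed.

(** The constant 5 exceeds [(1 + hull_lo) * (1 + hull_hi) / (hull_hi - hull_lo)], which is about
    4.3. *)
Lemma hull_len_ge w : pos_digits w -> (5%:R * (den w).1%:R ^+ 2)^-1 <= `|hull_len w|.
Proof.
move=> w0; rewrite /hull_len cfB ?(ltW mR_gt0) ?(ltW MR_gt0) // normrM normrM det_norm mulr1.
have q0 : 0 < (den w).1%:R :> R by rewrite ltr0n den_gt0.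
have qq : (den w).2%:R <= (den w).1%:R :> R by rewrite ler_nat den_le.
have q20 : 0 <= (den w).2%:R :> R by [].
move: (den w).1%:R (den w).2%:R q0 qq q20 => q q' q0 qq q20.
rewrite /hull_lo /hull_hi.
have d0 : 0 < (q + 53%:R / 200%:R * q') * (q + 79%:R / 100%:R * q') by rewrite mulr_gt0 //; lra.
rewrite (@ger0_norm _ (79%:R / 100%:R - _)) ?ger0_norm ?invr_ge0 ?(ltW d0) //; last by lra.
rewrite invfM ler_pdivlMr //.
have q2 : 0 < q ^+ 2 by rewrite exprn_gt0.
rewrite mulrAC ler_pdivrMr //; nra.
Qed.

Definition ends_in_digits3 (w : seq nat) := exists d1 d2 x,
  [/\ (0 < d1 < 4)%N, (0 < d2 < 4)%N, 1%:R / 4%:R <= x <= 4%:R / 5%:R &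
      beta R w = cf [:: d1; d2] x].

(** [U] belongs to the longer interval, because membership in the region implies [r <= 1]. *)
Definition oriented_state U V s := [/\ pos_digits U, pos_digits V, ends_in_digits3 U, ends_in_digits3 V &
  exists e r sg, [/\ isgn e, 0 < r, hull_len V = zr e * r * hull_len U,
    s - cf U mR - cf V mR = sg * hull_len U & in_region region e r sg]].

Lemma chk_cells_range e gl cs ct ps (x : R) : chk_cells region tab e gl cs ct ->
  in_cell x gl cs ps -> zr gl <= x <= N.
Proof.
have gt g c t : chk_cells region tab e g c t -> zr g <= N.
  elim: c g t => [|[gh q] c IH] g [|c' t] //=; first by move=> /Z.eqb_eq ->.
  case/and4P => /(zr_lt R) h _ _ /IH h2; lra.
elim: cs gl ct => [//|[gh ps'] cs IH] gl [//|c ct] /= /and4P[/(zr_lt R) glh _ _ h].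
have gN := gt _ _ _ h.
by case=> [[/andP[h1 h2] _]|/(IH _ _ h)/andP[h1 h2]]; apply/andP; split; lra.
Qed.

Lemma region_chk e : isgn e -> exists ct, chk_cells region tab e g0 (region e) ct.
Proof.
by have /andP[h1 h2] := cert_ok; case=> ->; [exists cert_pos|exists cert_neg].
Qed.

Lemma cf1_range d (x : R) : (0 < d < 4)%N -> 1%:R / 4%:R <= x <= 4%:R / 5%:R ->
  1%:R / 4%:R <= cf [:: d] x <= 4%:R / 5%:R.
Proof.
move=> /andP[d0 d4] /andP[x1 x2] /=.
have d1 : 1 <= d%:R :> R by rewrite ler1n.
have d3 : d%:R <= 3%:R :> R by rewrite ler_nat.
have p : 0 < d%:R + x by lra.
apply/andP; split; rewrite -[(d%:R + x)^-1]mul1r; first by rewrite ler_pdivlMr //; lra.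
by rewrite ler_pdivrMr //; lra.
Qed.

Lemma known_node_cf d1 d2 n (x : R) : (0 < d1 < 4)%N -> (0 < d2 < 4)%N ->
  1%:R / 4%:R <= x <= 4%:R / 5%:R -> known_node d1 d2 n ->
  (n < 13)%N /\ exists2 y, 1%:R / 4%:R <= y <= 4%:R / 5%:R &
    cf [:: d1; d2] x = cf (nth [::] nodes n) y.
Proof.
move=> h1 h2 hx; have hx2 := cf1_range h2 hx; have hx1 := cf1_range h1 hx2.
rewrite /known_node => /or3P[] /eqP ->.
- by split=> //; exists (cf [:: d1; d2] x).
- split; first by lia.
  exists (cf [:: d2] x) => //.
  by move: h1 {hx1}; case: d1 => [|[|[|[|?]]]] // _.
split; first by lia.
exists x => //; move: h1 h2 {hx1 hx2}.
by case: d1 => [|[|[|[|?]]]] // _; case: d2 => [|[|[|[|?]]]].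
Qed.

Lemma known_node_bounds d1 d2 n (x : R) i : (0 < d1 < 4)%N -> (0 < d2 < 4)%N ->
  1%:R / 4%:R <= x <= 4%:R / 5%:R -> known_node d1 d2 n -> (i < 13)%N ->
  satisfies_bounds (cf [:: d1; d2] x) i (nth row0 (rowsof tab n) i).
Proof.
move=> h1 h2 hx a i13; have [n13 [y hy ->]] := known_node_cf h1 h2 hx a.
apply: row_sound => //.
have /allP/(_ n) := tab_ok; rewrite mem_iota n13 => /(_ isT) /allP/(_ i).
by rewrite mem_iota i13 => /(_ isT).
Qed.

Lemma word_pos i : pos_digits (word i). Proof. exact: words_pos. Qed.

Lemma word_digits i : digits3 (word i) && (size (word i) <= 2)%N.
Proof. by rewrite /word; do 13?[case: i => [//|i]]; rewrite nth_default. Qed.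

Lemma ends_in_digits3_cat U i : pos_digits U -> ends_in_digits3 U -> ends_in_digits3 (U ++ word i).
Proof.
move=> U0 [d1 [d2 [x [h1 h2 hx hb]]]].
have hx2 := cf1_range h2 hx; have hx1 := cf1_range h1 hx2.
rewrite /ends_in_digits3 beta_cat ?word_pos // hb; have := word_digits i.
case: (word i) => [|c1 [|c2 [|c3 w]]] //=; rewrite ?andbF // ?andbT.
- by exists d1, d2, x.
- by move=> hc; exists c1, d1, (cf [:: d2] x).
by case/andP=> hc1 hc2; exists c2, c1, (cf [:: d1; d2] x).
Qed.

Lemma cf_gt0 w (x : R) : 0 < x -> 0 < cf w x.
Proof. by move=> x0; elim: w => //= d w IH; rewrite invr_gt0 ltr_wpDl. Qed.

Lemma hull_len_cat U i : pos_digits U ->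
  hull_len (U ++ word i) = hull_len U * (Tv (beta R U) i - Sv (beta R U) i) /\
  cf (U ++ word i) mR = cf U mR + hull_len U * Sv (beta R U) i.
Proof.
move=> U0; rewrite /hull_len !cf_cat.
have := cfB_lam U0 (cf_gt0 (word i) mR_gt0); rewrite -/(Sv _ i) => e1.
have := cfB_lam U0 (cf_gt0 (word i) MR_gt0); rewrite -/(Tv _ i) => e2.
by split; lra.
Qed.

Lemma in_region_gt0 e (r sg : R) : isgn e -> in_region region e r sg -> 0 < r.
Proof.
move=> he [ps hps _]; have [ct hct] := region_chk he.
have /andP[h _] := chk_cells_range hct hps.
have g : 0 < zr g0 by rewrite -zr_gt0.
by rewrite -(pmulr_rgt0 _ (N_gt0 R)); exact: lt_le_trans h.
Qed.

Lemma oriented_state_step U V s : oriented_state U V s -> exists i j,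
  [/\ (0 < i + j)%N, (i < 13)%N, (j < 13)%N &
   oriented_state (U ++ word i) (V ++ word j) s \/ oriented_state (V ++ word j) (U ++ word i) s].
Proof.
case=> U0 V0 nU nV [e [r [sg [he r0 lenE sE [ps hps [p pps hp]]]]]].
have [ct hct] := region_chk he.
have [rl [rh [ls [t [hchk hx rlrh grl]]]]] := chk_cells_piece hct hps pps.
have [d1 [d2 [x [h1 h2 hx0 hb]]]] := nU.
have [d1' [d2' [x' [h1' h2' hx0' hb']]]] := nV.
have [||||i [j [ij i13 j13 gs]]] := @chk_sound R d1 d2 d1' d2' (beta R U) (beta R V) h1 h2 h1' h2'
   _ _ e rl rh p ls 0 0 t r sg isT isT he r0 _ _ hx hchk hp.
- by move=> n i an i13; rewrite hb; apply: known_node_bounds.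
- by move=> n i an i13; rewrite hb'; apply: known_node_bounds.
- by move: grl rlrh; clear; rewrite /g0; lia.
- by move: rlrh; clear; lia.
exists i, j; split=> //.
have [lU aU] := hull_len_cat i U0; have [lV aV] := hull_len_cat j V0.
have pU : pos_digits (U ++ word i) by rewrite pos_cat U0 word_pos.
have pV : pos_digits (V ++ word j) by rewrite pos_cat V0 word_pos.
have L0 := hull_len_neq0 U0; have L1 := hull_len_neq0 pU; have L2 := hull_len_neq0 pV.
have W0 : Tv (beta R U) i - Sv (beta R U) i != 0.
  by apply: contraNneq L1 => z; rewrite lU z mulr0.
move: gs; rewrite /goodstep.
move: lU aU lV aV W0; move: (Tv _ i) (Sv _ i) (Tv _ j) (Sv _ j) => T S T' S' lU aU lV aV W0.
set e2 := Z.mul e _.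
have e2s : isgn e2.
  rewrite /e2; move: he (isgn_sgn i) (isgn_sgn j) => [->|->] [->|->] [->|->];
  by [left|right].
have H2 := zr_sgn R (isgn_sgn i); have H3 := zr_sgn R (isgn_sgn j).
have H1 := zr_sgn R e2s.
have e2E : zr e2 = zr e * (zr (sgn i) * zr (sgn j)) by rewrite /e2 !zrM.
have r20 := in_region_gt0 e2s.
set r2 := (X in in_region region e2 X _ \/ _); set sg2 := (X in in_region region e2 _ X \/ _) => gs.
have key : [/\ hull_len (V ++ word j) = zr e2 * r2 * hull_len (U ++ word i) &
  s - cf (U ++ word i) mR - cf (V ++ word j) mR = sg2 * hull_len (U ++ word i)].
  rewrite lU lV aU aV lenE e2E /r2 /sg2; split.
    by move: H2 H3; case=> ->; case=> ->; field; rewrite ?oppr_eq0 ?oner_neq0.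
  have -> : s - (cf U mR + hull_len U * S) - (cf V mR + zr e * r * hull_len U * S') =
    s - cf U mR - cf V mR - hull_len U * S - zr e * r * hull_len U * S' by ring.
  by rewrite sE; field.
case: key => k1 k2.
case: gs => gs; [left|right]; split=> //; try exact: ends_in_digits3_cat.
  by exists e2, r2, sg2; split=> //; exact: r20 gs.
have r2i := r20 _ _ gs; have r2p : 0 < r2 by rewrite -invr_gt0.
exists e2, r2^-1, (sg2 / (zr e2 * r2)); split=> //.
  rewrite k1; move: H1; case=> ->; field; rewrite ?oppr_eq0 ?oner_neq0 lt0r_neq0 //.
rewrite addrAC k2 k1; move: H1; case=> ->; field; rewrite ?oppr_eq0 ?oner_neq0 lt0r_neq0 //.
Qed.

(** With [r <= 1], coefficients of size at most [2 * NN] give [|sg| <= 4]. *)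
Definition small_piece (p : piece) :=
  let ok c := Z.leb (Z.abs c) (Z.mul 2 NN) in [&& ok p.1.1, ok p.1.2, ok p.2.1 & ok p.2.2].

Lemma region_small e : all (fun c : Z * seq piece => all small_piece c.2) (region e).
Proof. by case: (region_or e) => ->; vm_compute. Qed.

Lemma in_cell_all (P : seq piece -> bool) (x : R) gl (cs : cells) ps :
  all (fun c : Z * seq piece => P c.2) cs -> in_cell x gl cs ps -> P ps.
Proof.
by elim: cs gl => [//|[gh q] cs IH] gl /= /andP[Pq /IH h] [[_ ->]|/h].
Qed.

(** Here 35 is 5 times 7: a length agrees with the inverse square of the denominator up to a factor
    5, and the two lengths differ at most by a factor 7. *)
Lemma oriented_state_bounds U V s : oriented_state U V s ->
  [/\ (den U).1%:R ^+ 2 <= 35%:R * (den V).1%:R ^+ 2 :> R,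
      (den V).1%:R ^+ 2 <= 35%:R * (den U).1%:R ^+ 2 :> R &
      `|s - cf U mR - cf V mR| <= 4%:R / (den U).1%:R ^+ 2].
Proof.
case=> U0 V0 _ _ [e [r [sg [he r0 lenE -> [ps hps [p pps hp]]]]]].
have [ct hct] := region_chk he; have /andP[r1 r2] := chk_cells_range hct hps.
have N0 := N_gt0 R.
have g7 : N <= 7%:R * zr g0 by have := @zr_le R NN (Z.mul 7 g0) isT; rewrite zrM.
have r7 : 1 <= 7%:R * r by rewrite -(ler_pM2l N0); lra.
have rle1 : r <= 1 by rewrite -(ler_pM2l N0); lra.
have /allP/(_ p pps) := in_cell_all (P := all small_piece) (region_small e) hps.
have sm c : Z.leb (Z.abs c) (Z.mul 2 NN) -> - (2%:R * N) <= zr c <= 2%:R * N.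
  move=> h; have h1 : Z.leb (Z.opp (Z.mul 2 NN)) c by move: h; clear; lia.
  have h2 : Z.leb c (Z.mul 2 NN) by move: h; clear; lia.
  by have := zr_le R h1; have := zr_le R h2; rewrite zrN zrM => -> ->.
rewrite /small_piece => /and4P[/sm/andP[p1 p1'] /sm/andP[p2 p2'] /sm/andP[p3 p3'] /sm/andP[p4 p4']].
have sg4 : `|sg| <= 4%:R.
  move: hp; rewrite /in_piece ler_norml => /andP[h1 h2].
  have k2 : - (2%:R * N) <= zr p.1.2 * r by nra.
  have k4 : zr p.2.2 * r <= 2%:R * N by nra.
  by apply/andP; split; rewrite -(ler_pM2l N0); lra.
have qU : 0 < (den U).1%:R ^+ 2 :> R by rewrite exprn_gt0 // ltr0n den_gt0.
have qV : 0 < (den V).1%:R ^+ 2 :> R by rewrite exprn_gt0 // ltr0n den_gt0.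
have lV : `|hull_len V| = r * `|hull_len U|.
  rewrite lenE 2!normrM (gtr0_norm r0); have [->|->] := zr_sgn R he;
  by rewrite ?normrN normr1 mul1r.
have := hull_len_le U0; have := hull_len_ge U0; have := hull_len_le V0; have := hull_len_ge V0; rewrite lV !(invfM 5%:R).
move: ((den U).1%:R ^+ 2) ((den V).1%:R ^+ 2) qU qV => u v u0 v0.
move: (`|hull_len U|) (normr_ge0 (hull_len U)) (normrM sg (hull_len U)) => l l0 -> hV1 hV2 hU1 hU2.
have ui : u * u^-1 = 1 by rewrite mulfV ?lt0r_neq0.
have vi : v * v^-1 = 1 by rewrite mulfV ?lt0r_neq0.
have ui0 : 0 < u^-1 by rewrite invr_gt0.
have vi0 : 0 < v^-1 by rewrite invr_gt0.
have rl : r * l <= l by rewrite -[leRHS]mul1r ler_wpM2r.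
have rl7 : l <= 7%:R * (r * l) by rewrite mulrA -[leLHS]mul1r ler_wpM2r.
have a1 : v^-1 <= 5%:R * u^-1 by lra.
have a2 : u^-1 <= 35%:R * v^-1 by lra.
have uv : 0 <= u * v by rewrite mulr_ge0 // ltW.
split; last by apply: ler_pM.
  have := ler_wpM2l uv a1; rewrite mulfK ?lt0r_neq0 //.
  rewrite (_ : u * v * (5%:R * u^-1) = 5%:R * v); last by field; rewrite lt0r_neq0.
  lra.
have := ler_wpM2l uv a2; rewrite (mulrC u) mulfK ?lt0r_neq0 //.
by rewrite (_ : v * u * (35%:R * v^-1) = 35%:R * u) //; field; rewrite lt0r_neq0.
Qed.
End Words.

(** * Growing the two words to a prescribed size *)

Section Grow.
Variable R : realFieldType.
Local Notation zr := (zr R).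
Local Notation N := (zr NN).
Local Notation mR := (@hull_lo R).
Local Notation MR := (@hull_hi R).

Definition state U V (s : R) := oriented_state U V s \/ oriented_state V U s.

Lemma state_pos U V s : state U V s -> pos_digits U /\ pos_digits V.
Proof. by case=> -[]. Qed.

Lemma sqr_lt_nat (a b : nat) : a%:R ^+ 2 <= 35%:R * b%:R ^+ 2 :> R -> (a <= 6 * b)%N.
Proof. by rewrite -!natrX -natrM ler_nat => h; nia. Qed.

Lemma state_den U V s : state U V s ->
  ((den U).1 <= 6 * (den V).1)%N /\ ((den V).1 <= 6 * (den U).1)%N.
Proof. by case=> /oriented_state_bounds[/sqr_lt_nat h1 /sqr_lt_nat h2 _]. Qed.

(** The bound 4 of [oriented_state_bounds], times 35 for the passage from the denominator of [U] to
    that of [V]. *)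
Lemma state_dist U V s : state U V s -> `|s - cf U mR - cf V mR| <= 140%:R / (den V).1%:R ^+ 2.
Proof.
case=> h; have [U0 V0 _ _ _] := h; have [h1 h2 h3] := oriented_state_bounds h.
  have qU : 0 < (den U).1%:R ^+ 2 :> R by rewrite exprn_gt0 // ltr0n den_gt0.
  have qV : 0 < (den V).1%:R ^+ 2 :> R by rewrite exprn_gt0 // ltr0n den_gt0.
  by apply: le_trans h3 _; rewrite ler_pdivrMr // mulrAC ler_pdivlMr //; lra.
have qV : 0 < (den V).1%:R ^+ 2 :> R by rewrite exprn_gt0 // ltr0n den_gt0.
rewrite -addrA (addrC (- _)) addrA; apply: le_trans h3 _.
by move: qV; rewrite -invr_gt0; move: (_^-1) => x; lra.
Qed.

Lemma state_step U V s : state U V s -> exists i j, (0 < i + j)%N /\ state (U ++ word i) (V ++ word j) s /\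
  (i < 13)%N /\ (j < 13)%N.
Proof.
case=> /oriented_state_step[i [j [ij i13 j13 h]]]; first by exists i, j.
by exists j, i; rewrite addnC; case: h; split=> //; split=> //; [right|left].
Qed.

Lemma word_size i : (i < 13)%N -> word i = [::] -> i = 0%N.
Proof. by do 13?[case: i => [|i] //]. Qed.

Lemma den_word_le V j : pos_digits V -> ((den (V ++ word j)).1 <= 16 * (den V).1)%N.
Proof.
move=> /den_le V0; rewrite den_cat /=.
have : ((den (word j)).1 + (num (word j)).1 <= 16)%N.
  by rewrite /word; do 13?[case: j => [//|j]]; rewrite nth_default.
nia.
Qed.

Lemma digits3_cat x y : digits3 (x ++ y) = digits3 x && digits3 y.
Proof. exact: all_cat. Qed.

(** Each move increases the sum of the denominators, so [k] bounds the number of moves; once the sum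
    reaches [7 * X], comparability up to a factor 6 gives [X] for [V]. Growth stops as soon as [V]
    reaches [X], and one move multiplies its denominator at most by 16. This upper bound makes the
    constant in [hall] uniform. *)
Lemma state_grow s X k (U V : seq nat) : U != [::] -> V != [::] -> state U V s ->
  (7 * X <= k + ((den U).1 + (den V).1))%N ->
  exists w1 w2, [/\ digits3 w1, digits3 w2, state (U ++ w1) (V ++ w2) s,
    (X <= (den (V ++ w2)).1)%N & ((den (V ++ w2)).1 <= maxn (16 * X) (den V).1)%N].
Proof.
elim: k U V => [|k IH] U V Un Vn h hk; have [h1 h2] := state_den h.
  exists [::], [::]; rewrite !cats0; split=> //; first by move: hk h1; lia.
  by rewrite leq_maxr.
have [XV|VX] := leqP X (den V).1.
  by exists [::], [::]; rewrite !cats0; split=> //; rewrite leq_maxr.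
have [i [j [ij [h' [i13 j13]]]]] := state_step h.
have [U0 V0] := state_pos h; have [U1 V1] := state_pos h'.
have dU := den_cat_ge U0 (word_pos i); have dV := den_cat_ge V0 (word_pos j).
have dlt : ((den U).1 + (den V).1 < (den (U ++ word i)).1 + (den (V ++ word j)).1)%N.
  have [w0|w0] := eqVneq (word i) [::].
    have [z0|z0] := eqVneq (word j) [::].
      by move: ij; rewrite (word_size i13 w0) (word_size j13 z0).
    by rewrite -addnS leq_add // (den_cat_lt V0 (word_pos j) Vn z0).
  by rewrite -addSn leq_add // (den_cat_lt U0 (word_pos i) Un w0).
have Un' : U ++ word i != [::] by case: (U) Un.
have Vn' : V ++ word j != [::] by case: (V) Vn.
have hk' : (7 * X <= k + ((den (U ++ word i)).1 + (den (V ++ word j)).1))%N.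
  by apply: leq_trans hk _; rewrite addSnnS leq_add2l.
have [w1 [w2 [d1 d2 h'' g1 g2]]] := IH _ _ Un' Vn' h' hk'.
have /andP[di _] := word_digits i; have /andP[dj _] := word_digits j.
exists (word i ++ w1), (word j ++ w2); rewrite -!catA in h'' g1 g2 *; rewrite !digits3_cat di dj; split=> //.
apply: leq_trans g2 _; rewrite geq_max leq_maxl /=; apply: leq_trans (leq_maxl _ _).
by apply: leq_trans (den_word_le j V0) _; rewrite leq_mul2l ltnW.
Qed.

Lemma ends_ok_digits3 w : pos_digits w -> ends_ok w -> ends_in_digits3 R w.
Proof.
rewrite /ends_ok => w0; case E : (rev w) => [//|c1 [//|c2 w']] /and4P[h1 h2 h3 h4].
have wE : w = rev w' ++ [:: c2; c1] by rewrite -[w]revK E !rev_cons -!cats1 -catA.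
move: w0; rewrite wE pos_cat => /andP[p1 p2].
exists c1, c2, (beta R (rev w')); split=> //; last by rewrite beta_cat.
have q0 : 0 < (den (rev w')).1%:R :> R by rewrite ltr0n den_gt0.
rewrite /beta ler_pdivlMr // ler_pdivrMr //.
move: h3 h4; rewrite -!(ler_nat R) !natrM; lra.
Qed.

Lemma zr_abs z : z <> 0%R -> exists e, [/\ isgn e, Z.sgn z = e, zr (Z.abs z) = zr e * zr z & 0 < zr e * zr z].
Proof.
case: z => // p _; [exists (Zpos xH)|exists (Zneg xH)]; split=> //; try by [left|right].
- by rewrite zr1 mul1r.
- by rewrite zr1 mul1r -zr_gt0.
- by rewrite -zrM; congr (zr _); lia.
- by rewrite -zrM -zr_gt0; lia.
Qed.
End Grow.

Local Opaque RS.

(** * Soundness of the initial states *)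

Section Roots.
Variable R : realFieldType.
Local Notation zr := (zr R).
Local Notation N := (zr NN).
Local Notation mR := (@hull_lo R).
Local Notation MR := (@hull_hi R).

Lemma find_cell_sound P x gl cs (y : R) : find_cell P x gl cs ->
  zr x <= y <= zr x + 1 -> exists2 ps, in_cell y gl cs ps & has P ps.
Proof.
move=> h hy; elim: cs gl h => [//|[gh ps] cs IH] gl /=; case: ifP => [/andP[h1 h2] hP|_ /IH[q h1 h2]].
  exists ps => //; left; split=> //.
  by move: (zr_le R h1) (zr_le R h2) hy; rewrite zrD zr1; lra.
by exists q => //; right.
Qed.

Lemma Zdiv_up a b : Z.lt 0 b -> Z.le a (Z.mul (Z.add (Z.div a b) 1) b).
Proof. by move/(Z.mul_succ_div_gt a); move: (Z.div a b) => q; nia. Qed.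

Lemma affine_ge (A B x lo hi y : R) : lo <= y <= hi ->
  x <= A * lo + B -> x <= A * hi + B -> x <= A * y + B.
Proof. by move=> /andP[h1 h2]; have [a|a] := lerP 0 A; nra. Qed.

Lemma affine_le (A B x lo hi y : R) : lo <= y <= hi ->
  A * lo + B <= x -> A * hi + B <= x -> A * y + B <= x.
Proof. by move=> /andP[h1 h2]; have [a|a] := lerP 0 A; nra. Qed.

Lemma RS_gt0 : 0 < zr RS. Proof. exact: (@zr_lt R 0). Qed.

Lemma root_sound r s : pos_digits (rU r) -> pos_digits (rV r) -> chk_root region r ->
  zr (rlo r) <= zr RS * s <= zr (rhi r) -> oriented_state (rU r) (rV r) s.
Proof.
move=> U0 V0; have [m0 M0] := (posz_pos R 53 200, posz_pos R 79 100).
have mE : pr R mz = mR by [].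
have ME : pr R Mz = MR by [].
rewrite /chk_root.
have [aUp aUE] := cfzE U0 m0; have [aVp aVE] := cfzE V0 m0.
have [bUp bUE] := cfzE U0 M0; have [bVp bVE] := cfzE V0 M0.
rewrite -/mz in aUp aUE aVp aVE; rewrite -/Mz in bUp bUE bVp bVE.
rewrite mE in aUE aVE; rewrite ME in bUE bVE.
have LU := hull_len_neq0 R U0; have LV := hull_len_neq0 R V0.
rewrite /hull_len -aUE -bUE in LU; rewrite /hull_len -aVE -bVE in LV.
move: (cfz (rU r) mz) (cfz (rU r) Mz) (cfz (rV r) mz) (cfz (rV r) Mz) aUp aVp bUp bVp aUE aVE bUE bVE LU LV.
move=> [a1 a2] [b1 b2] [c1 c2] [d1 d2]; rewrite /posz /pr /=.
move=> [a10 a20] [c10 c20] [b10 b20] [d10 d20] aUE cUE bUE dUE LU LV.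
set nU := Z.sub (Z.mul b1 a2) _; set nV := Z.sub (Z.mul d1 c2) _.
case/and5P => rn0 rd0 /(@ends_ok_digits3 R _ U0) eU /(@ends_ok_digits3 R _ V0) eV hf hs.
set rn := Z.mul (Z.abs nV) _ in rn0 hf; set rd := Z.mul (Z.abs nU) _ in rd0 hf.
have nUE : zr nU = zr b1 * zr a2 - zr a1 * zr b2 by rewrite /nU !zrE.
have nVE : zr nV = zr d1 * zr c2 - zr c1 * zr d2 by rewrite /nV !zrE.
have nU0 : nU <> 0%R.
  by move=> z; move: rd0; rewrite /rd z.
have nV0 : nV <> 0%R.
  by move=> z; move: rn0; rewrite /rn z.
have [eu [eu1 euE absU absU0]] := zr_abs R nU0.
have [ev [ev1 evE absV absV0]] := zr_abs R nV0.
have rnR : zr rn = zr ev * zr nV * (zr a2 * zr b2) by rewrite /rn !zrM absV.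
have rdR : zr rd = zr eu * zr nU * (zr c2 * zr d2) by rewrite /rd !zrM absU.
have rn1 : 0 < zr rn by rewrite -zr_gt0.
have rd1 : 0 < zr rd by rewrite -zr_gt0.
have lUE : hull_len R (rU r) = zr nU / (zr a2 * zr b2).
  by rewrite /hull_len -aUE -bUE nUE; field; rewrite !lt0r_neq0.
have lVE : hull_len R (rV r) = zr nV / (zr c2 * zr d2).
  by rewrite /hull_len -cUE -dUE nVE; field; rewrite !lt0r_neq0.
have hx : zr (Z.div (Z.mul NN rn) rd) <= N * (zr rn / zr rd) <= zr (Z.div (Z.mul NN rn) rd) + 1.
  rewrite mulrA ler_pdivlMr // ler_pdivrMr //; apply/andP; split.
    by rewrite -[leRHS]zrM; apply: zr_div.
  rewrite -zr1 -[leLHS]zrM -zrD -[leRHS]zrM zr_leP; apply/Z.leb_le.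
  by apply/Zdiv_up/Z.ltb_lt.
clearbody rn rd nU nV.
have [ps hps /hasP[p pps /and4P[p1 p2 p3 p4]]] := find_cell_sound hf hx.
split=> //; exists (Z.mul eu ev), (zr rn / zr rd), ((s - cf (rU r) mR - cf (rV r) mR) / hull_len R (rU r)).
have nU1 : zr nU != 0 by move: absU0; rewrite ltNge; apply: contraNneq => ->; rewrite mulr0.
(* After multiplication by the positive number [zr RS * zr rd], the position is affine in
   [zr RS * s], with the coefficients that [chk_root] computes. *)
have key : zr RS * zr rd * (N * ((s - cf (rU r) mR - cf (rV r) mR) / hull_len R (rU r))) =
   (zr eu * N * zr a2 * zr c2 * zr b2 * zr d2) * (zr RS * s) +
   - (zr eu * N * zr RS * (zr a1 * zr c2 + zr c1 * zr a2) * zr b2 * zr d2).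
  rewrite lUE -aUE -cUE rdR.
  move: a20 b20 c20 d20 nU1; clear.
  move: (zr a2) (zr b2) (zr c2) (zr d2) (zr nU) (zr a1) (zr c1) (zr eu) (zr RS) N => x1 x2 x3 x4 x5 x6 x7 x8 x9 x10.
  by move=> h1 h2 h3 h4 h5; field; rewrite h5 !lt0r_neq0.
split.
- by case: eu1 => ->; case: ev1 => ->; [left|right|right|left].
- by rewrite divr_gt0.
- rewrite lUE lVE rnR rdR zrM.
  have := zr_sgn R eu1; have := zr_sgn R ev1.
  move: a20 b20 c20 d20 nU1; clear.
  move: (zr a2) (zr b2) (zr c2) (zr d2) (zr nU) (zr nV) (zr eu) (zr ev) => x1 x2 x3 x4 x5 x6 x7 x8.
  by move=> h1 h2 h3 h4 h5 [->|->] [->|->]; field; rewrite ?h5 ?oppr_eq0 ?oner_neq0 !lt0r_neq0.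
- by rewrite divfK // (hull_len_neq0 R U0).
rewrite euE evE in hps; exists ps; first exact: hps.
exists p; first exact: pps.
have pos : 0 < zr RS * zr rd by rewrite mulr_gt0 // RS_gt0.
have lhsE x y : zr RS * zr rd * (zr x + zr y * (zr rn / zr rd)) =
    zr (Z.mul RS (Z.add (Z.mul x rd) (Z.mul y rn))).
  rewrite !zrE; move: rd1; move: (zr rd) (zr rn) (zr RS) (zr x) (zr y); clear => x1 x2 x3 x4 x5 h.
  have {}h : x1 != 0 by rewrite lt0r_neq0.
  by field.
have sgE x : zr (Z.mul (Z.sgn nU) (Z.mul (Z.mul NN (Z.sub (Z.mul x (Z.mul a2 c2)) (Z.mul RS (Z.add (Z.mul a1 c2) (Z.mul c1 a2))))) (Z.mul b2 d2))) =
   (zr eu * N * zr a2 * zr c2 * zr b2 * zr d2) * zr x +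
   - (zr eu * N * zr RS * (zr a1 * zr c2 + zr c1 * zr a2) * zr b2 * zr d2).
  rewrite euE !zrE.
  move: (zr a2) (zr b2) (zr c2) (zr d2) (zr a1) (zr c1) (zr eu) (zr RS) (zr x) N; clear => x1 x2 x3 x4 x6 x7 x8 x9 x10 x11.
  by ring.
have {}p1 := zr_le R p1; have {}p2 := zr_le R p2; have {}p3 := zr_le R p3; have {}p4 := zr_le R p4.
rewrite sgE in p1; rewrite sgE in p2; rewrite sgE in p3; rewrite sgE in p4.
rewrite /in_piece; apply/andP; split; rewrite -(ler_pM2l pos) lhsE key.
  exact: affine_ge hs p1 p2.
exact: affine_le hs p3 p4.
Qed.
End Roots.

Local Transparent RS.

Lemma digits3_pos w : digits3 w -> pos_digits w.
Proof. by apply: sub_all => d /andP[]. Qed.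

Lemma digits4_pos w : digits4 w -> pos_digits w.
Proof. by case: w => //= d w /andP[/andP[-> _] /digits3_pos]. Qed.

Lemma digits4_cat x y : x != [::] -> digits4 x -> digits3 y -> digits4 (x ++ y).
Proof. by case: x => //= d x _ /andP[-> hx] hy; rewrite digits3_cat hx hy. Qed.

Lemma digits34 w : digits3 w -> digits4 w.
Proof. by case: w => //= d w /andP[/andP[-> h] ->]; rewrite ltnW. Qed.

Definition root_small r :=
  [&& rU r != [::], rV r != [::] & ((den (rV r)).1 <= 1000)%N].

(** * The quantitative form of Hall's theorem *)

Section Hall.
Variable R : archiRealFieldType.
Local Notation zr := (zr R).
Local Notation mR := (@hull_lo R).

Lemma zr_prod a b c (x : R) : zr a = x -> c = Z.mul a b -> zr c = x * zr b.
Proof. by move=> <- ->; rewrite zrM. Qed.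

Lemma chk_roots_sound (P : seq nat -> bool) (Q : root -> bool) lo hi rs (x : R) :
  chk_roots region P lo hi rs -> all Q rs -> zr lo < x <= zr hi ->
  exists r, [/\ P (rU r), P (rV r), Q r, chk_root region r & zr (rlo r) <= x <= zr (rhi r)].
Proof.
move=> + + /andP[]; elim: rs lo => [|r rs IH] lo /=.
  by move=> /(zr_le R) h _ h1 h2; lra.
case/and5P => h1 h2 h3 h4 h5 /andP[q1 q2] lx xh.
have [xr|rx] := lerP x (zr (rhi r)); last exact: IH h5 q2 rx xh.
by exists r; split=> //; rewrite xr andbT; move: (zr_le R h1); lra.
Qed.

Lemma roots_small : all root_small rootsA && all root_small rootsB.
Proof. by vm_compute. Qed.

Lemma root_exists (s : R) : 1 / 2%:R < s <= 151%:R / 100%:R -> exists U V,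
  [/\ digits4 U, digits4 V, 1 < s -> digits3 U && digits3 V,
      [&& U != [::], V != [::] & ((den V).1 <= 1000)%N] & oriented_state U V (s : R)].
Proof.
move=> /andP[s0 s1]; have /andP[smA smB] := roots_small.
have EA := zr_prod (zr_nat R 2) (erefl : RS = Z.mul 2 500000).
have EB := zr_prod (zr_nat R 100) (erefl : RS = Z.mul 100 10000).
have EC : zr 1510000 = _ := zr_prod (zr_nat R 151) (erefl (Z.mul 151 10000)).
have RS0 := RS_gt0 R.
have [s1'|s1'] := lerP s 1.
  have hx : zr 500000 < zr RS * s <= zr RS.
    move: EA EB EC RS0 s0 s1 s1'; clear. move: (zr RS) (zr 500000) (zr 1510000) (zr 10000) => a b c d EA EB EC RS0 s0 s1 s1'.
    by apply/andP; split; nra.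
  have [r [h1 h2 h3 h4 h5]] := chk_roots_sound rootsA_ok smA hx.
  exists (rU r), (rV r); split; [exact: h1|exact: h2| |exact: h3|].
    by [].  
  exact: root_sound (digits4_pos h1) (digits4_pos h2) h4 h5.
have hx : zr RS < zr RS * s <= zr 1510000.
  move: EA EB EC RS0 s0 s1 s1'; clear. move: (zr RS) (zr 500000) (zr 1510000) (zr 10000) => a b c d EA EB EC RS0 s0 s1 s1'.
    by apply/andP; split; nra.
have [r [h1 h2 h3 h4 h5]] := chk_roots_sound rootsB_ok smB hx.
exists (rU r), (rV r); split; [exact: digits34|exact: digits34| |exact: h3|].
  by rewrite h1 h2.
exact: root_sound (digits3_pos h1) (digits3_pos h2) h4 h5.
Qed.

(** The least [X] with [c <= e * X^2]: minimality costs a factor 4 if [X >= 2], and the summand 1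
    takes care of [X = 1]. *)
Lemma small_scale (c e : R) : 0 < c -> 0 < e <= 1 ->
  exists X : nat, [/\ (0 < X)%N, c <= e * X%:R ^+ 2 & e * X%:R ^+ 2 <= 4%:R * c + 1].
Proof.
move=> c0 /andP[e0 e1].
pose P n := c <= e * n.+1%:R ^+ 2.
have exP : exists n, P n.
  have := Num.Theory.archi_boundP (ltW (divr_gt0 c0 e0)); set n := Num.bound _ => hn.
  exists n; rewrite /P mulrC -ler_pdivrMr //; apply: le_trans (ltW hn) _.
  rewrite -natrX ler_nat; nia.
have [n Pn minn] := ex_minnP exP.
exists n.+1; split=> //; case: n Pn minn => [_ _|n Pn minn]; first by rewrite expr1n; lra.
have lt : e * n.+1%:R ^+ 2 < c by rewrite ltNge; apply/negP => /minn; rewrite ltnn.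
have n0 : 0 <= n%:R :> R by [].
have h : n.+2%:R <= 2%:R * n.+1%:R :> R by rewrite -natrM ler_nat; lia.
have : n.+2%:R ^+ 2 <= 4%:R * n.+1%:R ^+ 2 :> R by nra.
nra.
Qed.

(* The essential point is that [C] does not depend on [s] and [e]. *)
Lemma hall : exists2 C : R, 0 < C & forall s e : R,
  1 / 2%:R < s <= 151%:R / 100%:R -> 0 < e <= 1 ->
  exists u v, [/\ digits4 u, digits4 v, 1 < s -> digits3 u && digits3 v,
    forall t t' : R, 0 <= t <= 1 -> 0 <= t' <= 1 -> `|cf u t + cf v t' - s| <= e &
    e * (den v).1%:R ^+ 2 <= C].
Proof.
(* If the initial [V] is already long enough, its denominator is at most 1000, which gives [10^6];
   otherwise the bound is [256 * (4 * 177 + 1)]. *)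
exists (2%:R * 10%:R ^+ 6); first by lra.
move=> s e hs he; have [U [V [dU dV d3 /and3P[Un Vn V1000] h]]] := root_exists hs.
have [e0 e1] := andP he.
(* In units of [1 / q(v)^2], the error is at most 140 from [state_dist], 36 from the tail of [u] and
   1 from the tail of [v], together 177. *)
have [X [X0 hX1 hX2]] := @small_scale 177%:R e (ltr0Sn R 176) he.
have [w1 [w2 [g1 g2 hO hd1 hd2]]] := state_grow Un Vn (or_introl h) (leq_addr ((den U).1 + (den V).1) (7 * X)).
have [p1 p2] := state_pos hO; have [b1 b2] := state_den hO; have b3 := state_dist hO.
exists (U ++ w1), (V ++ w2); split; try exact: digits4_cat.
- by rewrite !digits3_cat g1 g2 !andbT.
- move=> t t' ht ht'.
  have mm : 0 <= mR <= 1 by rewrite /hull_lo; lra.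
  have c1 := cf_dist p1 ht mm; have c2 := cf_dist p2 ht' mm.
  have qu : 0 < (den (U ++ w1)).1%:R :> R by rewrite ltr0n den_gt0.
  have qv : 0 < (den (V ++ w2)).1%:R :> R by rewrite ltr0n den_gt0.
  have quv : (den (V ++ w2)).1%:R <= 6%:R * (den (U ++ w1)).1%:R :> R by rewrite -natrM ler_nat.
  have Xv : X%:R <= (den (V ++ w2)).1%:R :> R by rewrite ler_nat.
  have X1 : 0 < X%:R :> R by rewrite ltr0n.
  move: qu qv quv Xv X1 hX1 b3 c1 c2 e0; clear.
  move: (den (U ++ w1)).1%:R (den (V ++ w2)).1%:R X%:R => qu qv x.
  move: (cf (U ++ w1) t) (cf (V ++ w2) t') (cf (U ++ w1) mR) (cf (V ++ w2) mR) => a b c d.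
  move=> qu0 qv0 quv xv x0 hx b3 c1 c2 e0.
  have i1 : (qu ^+ 2)^-1 <= 36%:R / qv ^+ 2.
    by rewrite ler_pdivlMr ?exprn_gt0 // mulrC ler_pdivrMr ?exprn_gt0 //; nra.
  have i2 : 177%:R / qv ^+ 2 <= e.
    by rewrite ler_pdivrMr ?exprn_gt0 //; apply: le_trans hx _; apply: ler_wpM2l; [exact: ltW|nra].
  move: b3 c1 c2 i1 i2; rewrite !ler_norml; move: (_^-1) (_^-1) => y z.
  by move=> /andP[? ?] /andP[? ?] /andP[? ?] ? ?; apply/andP; split; lra.
have q0 : 0 <= (den (V ++ w2)).1%:R :> R by [].
move: hd2; rewrite leq_max => /orP[] hd.
  have : (den (V ++ w2)).1%:R <= 16%:R * X%:R :> R by rewrite -natrM ler_nat.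
  move: (den _).1%:R X%:R q0 hX2 => q x q0 hX2 qx.
  have : q ^+ 2 <= 256%:R * x ^+ 2 by nra.
  by nra.
have : (den (V ++ w2)).1%:R <= 1000%:R :> R by rewrite ler_nat (leq_trans hd).
by move: (den _).1%:R q0 => q q0 qx; nra.
Qed.
End Hall.

(** * Approximation by convergents *)

Lemma cat_cons_eq (T : Type) (x y h b : seq T) d : h ++ b = x ++ d :: y ->
  (exists2 z, h = x ++ d :: z & y = z ++ b) \/ (exists2 z, x = h ++ z & b = z ++ d :: y).
Proof.
elim: h x => [|c h IH] [|c' x] /=.
- by move=> ->; right; exists [::].
- by move=> ->; right; exists (c' :: x).
- by case=> -> <-; left; exists h.
by case=> -> /IH[[z -> ->]|[z -> ->]]; [left|right]; exists z.
Qed.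

Lemma den_bracket h q : (0 < q < (den h).1)%N ->
  exists x d y, [/\ h = x ++ d :: y, ((den x).1 <= q)%N & (q < (den (rcons x d)).1)%N].
Proof.
elim/last_ind: h => [|h d IH] /andP[q0]; first by rewrite ltnNge q0.
move=> hq; have [qh|hq'] := ltnP q (den h).1.
  have [|x [c [y [-> h1 h2]]]] := IH; first by rewrite q0.
  by exists x, c, (rcons y d); rewrite rcons_cat.
by exists h, d, [::]; rewrite cats1.
Qed.

Section Analysis.
Variable R : realFieldType.

Lemma cf_conv w (t : R) : pos_digits w -> 0 <= t <= 1 ->
  exists2 c, 0 <= c <= 1 & cf w t = (1 - c) * cf w 0 + c * cf w 1.
Proof.
move=> w0 /andP[t0 t1].
have := cfB w0 (lexx 0) t0; have := cfB w0 (lexx 0) (@ler01 R).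
rewrite !mul0r !addr0 !subr0 !mul1r.
have q0 : 0 < (den w).1%:R :> R by rewrite ltr0n den_gt0.
have r0 : 0 <= (den w).2%:R :> R by [].
move: (den w).1%:R (den w).2%:R (det R w) q0 r0 => q r D q0 r0 e1 et.
have h1 : 0 < q + r by lra.
have ht : 0 < q + t * r by nra.
exists (t * (q + r) / (q + t * r)).
  apply/andP; split; first by rewrite divr_ge0 ?mulr_ge0 // ltW.
  by rewrite ler_pdivrMr //; nra.
have -> : cf w t = cf w 0 + t * D / (q * (q + t * r)) by rewrite -et; ring.
have -> : cf w 1 = cf w 0 + D / (q * (q + r)) by rewrite -e1; ring.
by field; rewrite !lt0r_neq0.
Qed.

Lemma cf_onto w (c : R) : pos_digits w -> 0 <= c <= 1 ->
  exists2 t, 0 <= t <= 1 & cf w t = (1 - c) * cf w 0 + c * cf w 1.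
Proof.
move=> w0 /andP[c0 c1].
have q0 : 0 < (den w).1%:R :> R by rewrite ltr0n den_gt0.
have r0 : 0 <= (den w).2%:R :> R by [].
(* The inverse of the parameter change [c = t * (q + r) / (q + t * r)] in [cf_conv]. *)
pose t := c * (den w).1%:R / ((den w).1%:R + (1 - c) * (den w).2%:R).
have dt : 0 < (den w).1%:R + (1 - c) * (den w).2%:R by nra.
have t0 : 0 <= t by rewrite divr_ge0 ?mulr_ge0 // ltW.
have t1 : t <= 1 by rewrite ler_pdivrMr //; nra.
exists t; first by apply/andP.
have := cfB w0 (lexx 0) t0; have := cfB w0 (lexx 0) (@ler01 R).
rewrite !mul0r !addr0 !subr0 !mul1r /t.
have ht : 0 < (den w).1%:R + t * (den w).2%:R by nra.
rewrite /t in ht.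
move: (den w).1%:R (den w).2%:R (det R w) q0 r0 dt ht {t t0 t1} => q r D q0 r0 dt ht e1 et.
have h1 : 0 < q + r by lra.
set ct := cf w _ in et *.
have -> : ct = cf w 0 + (ct - cf w 0) by ring.
rewrite et.
have -> : cf w 1 = cf w 0 + D / (q * (q + r)) by rewrite -e1; ring.
have h2 : (c * q / (q + (1 - c) * r)) * (q + (1 - c) * r) = c * q by rewrite divfK ?lt0r_neq0.
have h3 : (q + c * q / (q + (1 - c) * r) * r) = q * (q + r) / (q + (1 - c) * r).
  by field; rewrite lt0r_neq0.
rewrite h3; field; rewrite !lt0r_neq0 //.
Qed.

Lemma cf_approx x d y (t : R) : pos_digits (x ++ d :: y) -> 0 <= t ->
  `|cf (x ++ d :: y) t - (num x).1%:R / (den x).1%:R| =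
  ((den x).1%:R ^+ 2 * (d%:R + cf y t + beta R x))^-1.
Proof.
rewrite pos_cat /= => /andP[x0 /andP[d0 y0]] t0.
have z0 : 0 < d%:R + cf y t by rewrite ltr_pwDl ?ltr0n // cf_ge0.
have v0 : 0 <= (d%:R + cf y t)^-1 by rewrite invr_ge0 ltW.
have -> : (num x).1%:R / (den x).1%:R = cf x (0 : R) by rewrite cfE // !mul0r !addr0.
rewrite cf_cat /= (cfB x0 (lexx 0) v0) subr0 mul0r addr0 normrM normrM det_norm mulr1.
have q0 : 0 < (den x).1%:R :> R by rewrite ltr0n den_gt0.
have r0 : 0 <= (den x).2%:R :> R by [].
rewrite /beta; move: (den x).1%:R (den x).2%:R (_ + cf y t) q0 r0 z0 v0 => q r z q0 r0 z0 v0.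
have h : 0 < q + z^-1 * r by nra.
rewrite !ger0_norm ?invr_ge0 ?mulr_ge0 ?ltW //.
have h2 : 0 < z * q + r by nra.
have -> : q + z^-1 * r = (z * q + r) / z by field; rewrite lt0r_neq0.
by field; rewrite !lt0r_neq0.
Qed.

(* Here [(p, q)] is, up to sign, [X (p_(n+1), q_(n+1)) - Y (p_n, q_n)], and
   [q < q_(n+1)] prevents cancellation in [q alpha - p]. *)
Lemma same_sign (Q q' q X Y e : int) : 0 < q' -> q' <= q -> q < Q -> X != 0 ->
  (e == 1) || (e == -1) -> X * Q - Y * q' = e * q ->
  0 < X * Y /\ Q <= `|Y| * q' + q.
Proof.
move=> h1 h2 h3 hX he E.
by case/orP: he E => /eqP ->; nia.
Qed.

(** Because [gamma > 4], such a fraction does not even satisfy the first inequality. *)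
Lemma far_from_nonconvergent x d (t : R) (p : int) (q : nat) :
  pos_digits (rcons x d) -> 0 <= t <= 1 -> ((den x).1 <= q < (den (rcons x d)).1)%N ->
  p * (den x).1%:Z != q%:Z * (num x).1%:Z ->
  (4%:R * q%:R ^+ 2)^-1 <= `|cf (rcons x d) t - p%:~R / q%:R|.
Proof.
set w := rcons x d => w0 /andP[t0 t1] /andP[h1 h2] hX.
have w2 : (den w).2 = (den x).1 by rewrite /w /den cont_rcons.
have w2' : (num w).2 = (num x).1 by rewrite /w /num cont_rcons.
have x0 : pos_digits x by move: w0; rewrite pos_rcons => /andP[].
have q0' := den_gt0 x0.
pose X : int := p * (den x).1%:Z - q%:Z * (num x).1%:Z.
pose Y : int := p * (den w).1%:Z - q%:Z * (num w).1%:Z.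
have X0 : X != 0 by rewrite subr_eq0.
pose e : int := (-1) ^+ (size w).+1.
have he : (e == 1) || (e == -1).
  by rewrite /e -signr_odd; case: (odd _); rewrite ?expr1 ?expr0 eqxx ?orbT.
have E : X * (den w).1%:Z - Y * (den x).1%:Z = e * q%:Z.
  have := cont_det w; rewrite w2 w2' /e exprS !PoszM /X /Y => <-; ring.
have [XY hQ] := @same_sign (den w).1 (den x).1 q X Y e q0' h1 h2 X0 he E.
rewrite cfE // w2 w2'.
have qR : 0 < q%:R :> R by rewrite ltr0n (leq_trans q0').
have qxR : 0 < (den x).1%:R :> R by rewrite ltr0n.
have qwR : 0 < (den w).1%:R :> R by rewrite ltr0n den_gt0.
have D0 : 0 < (den w).1%:R + t * (den x).1%:R :> R by rewrite ltr_pwDl // mulr_ge0 // ltW.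
have -> : ((num w).1%:R + t * (num x).1%:R) / ((den w).1%:R + t * (den x).1%:R) - p%:~R / q%:R =
    - (Y%:~R + t * X%:~R) / (((den w).1%:R + t * (den x).1%:R) * q%:R) :> R.
  rewrite /X /Y !rmorphB !rmorphM /= -!pmulrn.
  move: (num w).1%:R (num x).1%:R (den w).1%:R (den x).1%:R q%:R p%:~R qR D0 => a b c f g k h g0.
  by field; rewrite !lt0r_neq0.
have qq : (den x).1%:R <= q%:R :> R by rewrite ler_nat.
have Y1 : 1 <= `|Y%:~R : R|.
  rewrite -intr_norm -[1]/(1%:~R) ler_int -gtz0_ge1 normr_gt0.
  by apply: contraTneq XY => ->; rewrite mulr0.
have hQR : (den w).1%:R <= `|Y%:~R : R| * (den x).1%:R + q%:R.
  by rewrite -intr_norm !pmulrn -rmorphM -rmorphD ler_int.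
have YX : `|Y%:~R : R| <= `|Y%:~R + t * X%:~R|.
  have XYR : 0 < X%:~R * Y%:~R :> R by rewrite -rmorphM ltr0z.
  move: (X%:~R) (Y%:~R) XYR => x' y' xy'.
  have [hy|hy] := lerP 0 y'.
    have hx : 0 <= x' by nra.
    by rewrite !ger0_norm ?addr_ge0 ?mulr_ge0 // lerDl mulr_ge0.
  have hx : x' <= 0 by nra.
  by rewrite (ltr0_norm hy) ler0_norm; nra.
rewrite normrM normrN normfV (gtr0_norm (mulr_gt0 D0 qR)).
move: (`|_ + t * _|) (`|Y%:~R|) YX Y1 hQR => z y yz y1 hQR.
move: (den w).1%:R (den x).1%:R q%:R qR qxR qwR qq D0 hQR => a b c c0 b0 a0 bc D0 hQ'.
rewrite -[_^-1]mul1r ler_pdivrMr ?mulr_gt0 ?exprn_gt0 // mulrAC ler_pdivlMr ?mulr_gt0 //.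
rewrite mul1r expr2 !mulrA [leRHS](_ : _ = (4%:R * z * c) * c); last by ring.
apply: ler_wpM2r; first exact: ltW.
have : y * b <= z * c by nra.
have : t * b <= z * c by nra.
have : c <= z * c by nra.
lra.
Qed.
End Analysis.

(** * Construction of the number *)

Section Construction.
Variables (R : realType) (gamma : R) (varpi : nat -> R).
Hypothesis hgamma : 5 < gamma.
Hypothesis varpi_ge0 : forall n, 0 <= varpi n.

(** The second condition says, with denominators cleared, that the convergent violates the second
    inequality. The first condition disposes of its multiples: for [(m p, m q)] with [m >= 2] the
    distance is the same and [q^2] is at least 4 times as large. *)
Definition good (q : nat) (l : R) :=
  l <= 4%:R * gamma /\ l * (q%:R ^+ 2 - varpi q) <= gamma * q%:R ^+ 2.

(** Requiring the bound for all tails [t] makes it independent of the digits still to come, so it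
    survives every extension. *)
Definition admissible (h : seq nat) := pos_digits h /\
  forall x d y, h = x ++ d :: y -> forall t : R, 0 <= t <= 1 ->
    good (den x).1 (d%:R + cf y t + beta R x).

Lemma good_le q l : 0 <= l <= gamma -> good q l.
Proof.
move=> /andP[l0 l1]; split; first by have := hgamma; lra.
have : 0 <= q%:R ^+ 2 :> R by rewrite exprn_ge0.
have := varpi_ge0 q; move: (varpi q) (q%:R ^+ 2) => a b; nra.
Qed.

Lemma good_special q l e : 0 <= e <= 1 -> 0 <= l <= gamma + e ->
  e * q%:R ^+ 2 <= gamma * varpi q -> good q l.
Proof.
move=> /andP[e0 e1] /andP[l0 l1] h; split; first by have := hgamma; lra.
have : 0 <= q%:R ^+ 2 :> R by rewrite exprn_ge0.
have := hgamma; have := varpi_ge0 q; move: (varpi q) (q%:R ^+ 2) h => a b h a0 g5 b0.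
have [ab|ab] := lerP b a.
  have h1 : 0 <= l * (a - b) by rewrite mulr_ge0 // subr_ge0.
  have h2 : 0 <= gamma * b by rewrite mulr_ge0 //; lra.
  lra.
have h1 : l * (b - a) <= (gamma + e) * (b - a) by rewrite ler_wpM2r // subr_ge0 ltW.
have h2 : 0 <= e * a by rewrite mulr_ge0.
lra.
Qed.

(** Either [3 + 1 + 1 = 5 < gamma], or the digit is 4 beside some [a >= 5], and
    [4 + 1/5 + 1 < 11/2 <= gamma]. *)
Lemma good_digit q d (s b : R) : (d <= 4)%N -> 0 <= s <= 1 -> 0 <= b <= 1 ->
  [\/ (d <= 3)%N, 11%:R / 2%:R <= gamma /\ s <= 1 / 5%:R | 11%:R / 2%:R <= gamma /\ b <= 1 / 5%:R] ->
  good q (d%:R + s + b).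
Proof.
move=> hd /andP[s0 s1] /andP[b0 b1] h; apply: good_le.
have d0 : 0 <= d%:R :> R by [].
have d4 : d%:R <= 4%:R :> R by rewrite ler_nat.
apply/andP; split; first lra.
have := hgamma; case: h => [|[]|[]]; try lra.
by rewrite -(ler_nat R); lra.
Qed.

Lemma cf01 w (t : R) : pos_digits w -> 0 <= t <= 1 -> 0 <= cf w t <= 1.
Proof. by move=> w0 ht; rewrite cf_ge0 ?cf_le1 //; case/andP: ht. Qed.

Lemma beta01 w : pos_digits w -> 0 <= beta R w <= 1.
Proof. by move=> w0; rewrite beta_ge0 beta_le1. Qed.

Lemma inv_digit_le a (t : R) : (5 <= a)%N -> 0 <= t -> (a%:R + t)^-1 <= 1 / 5%:R.
Proof.
move=> a5 t0; have : 5%:R <= a%:R :> R by rewrite ler_nat.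
move=> h; rewrite -[_^-1]mul1r ler_pdivrMr; lra.
Qed.

Lemma digits4_split z d y : digits4 (z ++ d :: y) -> (0 < d <= 4)%N && ((z != [::]) ==> (d <= 3)%N).
Proof.
case: z => [|c z] /=; first by rewrite andbT => /andP[].
by case/andP=> _; rewrite /digits3 all_cat => /and3P[_ /= /andP[d0 d3] _]; rewrite d0 (ltnW d3).
Qed.

(** Take the least [n] with [gamma <= n + 3/2]. If [n = 4], then [gamma > 5] gives [gamma - n > 1],
    where digits at most 3 suffice; if [n >= 5], then [gamma > 11/2], and digits 4 beside [a] are
    harmless. *)
Lemma special_digit : exists a : nat, [/\ (0 < a)%N, 1 / 2%:R < gamma - a%:R <= 3%:R / 2%:R &
  (1 < gamma - a%:R) \/ ((5 <= a)%N /\ 11%:R / 2%:R <= gamma)].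
Proof.
have exP : exists n, gamma <= n%:R + 3%:R / 2%:R.
  exists (Num.bound gamma); have := Num.Theory.archi_boundP (ltW (lt_trans (ltr0Sn R 4) hgamma)).
  lra.
have [n Pn minn] := ex_minnP exP.
have n4 : (4 <= n)%N.
  have : 3%:R < n%:R :> R by have := hgamma; lra.
  by rewrite ltr_nat.
have hn : 1 / 2%:R < gamma - n%:R.
  rewrite ltNge; apply/negP => h.
  have E : n%:R = n.-1%:R + 1 :> R by rewrite natr1 prednK // (leq_trans _ n4).
  have /minn : gamma <= n.-1%:R + 3%:R / 2%:R by lra.
  by move: n4; clear; lia.
exists n; split; [by apply: leq_trans n4|apply/andP; split=> //; lra|].
have [n5|] := leqP 5 n.
  right; split=> //; have : 5%:R <= n%:R :> R by rewrite ler_nat.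
  lra.
move=> n5; left; have -> : n = 4%N by lia.
by have := hgamma; lra.
Qed.

Hypothesis varpi_incr : {homo varpi : m n / (m <= n)%N >-> m <= n}.
Hypothesis varpi_unb : forall A : R, exists n, A <= varpi n.

Lemma den_cat_le2 x y : pos_digits x -> pos_digits y ->
  ((den (x ++ y)).1 <= 2 * (den x).1 * (den y).1)%N.
Proof.
move=> x0 y0; rewrite den_cat /=; have := den_le x0; have := num_le_den y0.
by move: (den x).1 (den x).2 (num y).1 (den y).1 => a b c d; clear; nia.
Qed.

Lemma den_cat_ge_r x y : pos_digits x -> pos_digits y -> ((den y).1 <= (den (x ++ y)).1)%N.
Proof. by move=> x0 y0; rewrite den_cat /=; have := den_gt0 x0; nia. Qed.

Lemma small_width (n : R) : 1 <= n ->
  exists2 e, 0 < e <= 1 / 200%:R & e * (200%:R * n ^+ 2) = 1.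
Proof.
move=> n1; have n0 : 0 < 200%:R * n ^+ 2 by rewrite mulr_gt0 ?exprn_gt0 //; lra.
exists (200%:R * n ^+ 2)^-1; last by rewrite mulVf ?lt0r_neq0.
rewrite invr_gt0 n0 -[leLHS]mul1r ler_pdivrMr //; nra.
Qed.

Lemma extend (a : nat) (h : seq nat) :
  (0 < a)%N -> 1 / 2%:R < gamma - a%:R <= 3%:R / 2%:R ->
  (1 < gamma - a%:R) \/ ((5 <= a)%N /\ 11%:R / 2%:R <= gamma) ->
  admissible h ->
  exists x y, admissible (h ++ x ++ a :: y) /\
    forall t : R, 0 <= t <= 1 -> gamma < a%:R + cf y t + beta R (h ++ x).
Proof.
move=> a0 /andP[s0 s1] ha [h0 adm].
have [C C0 hallC] := hall R.
pose D : R := (den h).1%:R.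
(* The factor 12 is 3 from the width [3 * e] of the window times 4 from the square of
   [2 * q(h) * q(v)]. *)
have [N1 hN1] := varpi_unb (12%:R * C * D ^+ 2).
pose N0 := N1.+1.
have N01 : 1 <= N0%:R :> R by rewrite ler1n.
have [e /andP[e0 e200] eN] := small_width N01.
(* Aiming at [2 * e] above [gamma - a] with error [e] puts the sum between [gamma + e] and
   [gamma + 3 * e], strictly above [gamma]; [e <= 1/200] keeps the target within 151/100. *)
have [||u [v [du dv d3 hd hq]]] := hallC (gamma - a%:R + 2%:R * e) e.
- by apply/andP; split; lra.
- by apply/andP; split; lra.
have u0 := digits4_pos du; have v0 := digits4_pos dv.
have rv0 : pos_digits (rev v) by rewrite pos_rev.
have hv0 : pos_digits (h ++ rev v) by rewrite pos_cat h0.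
have au0 : pos_digits (a :: u) by rewrite /= a0.
have b0 : 0 <= beta R h <= 1 by exact: beta01.
exists (rev v), u.
have hull_coord t : 0 <= t <= 1 ->
    gamma < a%:R + cf u t + beta R (h ++ rev v) <= gamma + 3%:R * e.
  move=> ht; rewrite beta_cat // revK; have := hd _ _ ht b0; rewrite ler_norml => /andP[? ?].
  by apply/andP; split; lra.
split; last by move=> t /hull_coord/andP[].
have all3 : (5 <= a)%N /\ 11%:R / 2%:R <= gamma \/ digits3 u && digits3 v.
  by case: ha => [h1|]; [right; apply: d3; lra|left].
split; first by rewrite catA pos_cat hv0.
(* The digit [d] lies in [h], in [rev v], at [a] or in [u]. In [h], the new digits only amount to
   another tail. *)
move=> x d y E0 t ht; have [[z hE ->]|[z -> E]] := cat_cons_eq E0.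
  rewrite cf_cat; apply: adm => //; apply: cf01 => //.
  by rewrite pos_cat rv0.
have {E} [[z' vE ->]|[z' -> E']] := cat_cons_eq E.
  have vE' : v = rev z' ++ d :: rev z by rewrite -[v]revK vE rev_cat rev_cons cat_rcons.
  have := rv0; rewrite vE pos_cat => /andP[z0 /andP[d0 z0']].
  have {}z0' : pos_digits z' := z0'.
  have := dv; rewrite vE' => /digits4_split/andP[/andP[_ d4] d4'].
  apply: good_digit => //.
  - by apply: cf01 => //; rewrite pos_cat z0'.
  - by apply: beta01; rewrite pos_cat h0.
  case: all3 => [[a5 g]|/andP[_]]; last first.
    by rewrite vE' /digits3 all_cat => /and3P[_ /andP[_ ?] _]; constructor 1.
  case: z' d4' {vE vE' z0'} => [_|c z'].
    constructor 2; split=> //=; apply: inv_digit_le => //; apply: cf_ge0.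
    by case/andP: ht.
  rewrite rev_cons -size_eq0 size_rcons /= => d3'.
  by constructor 1.
case: z' E' => [[<- <-]|a' z' [<- uE]].
  rewrite cats0; have /andP[l1 l2] := hull_coord t ht.
  have q0 : 0 <= (den (h ++ rev v)).1%:R :> R by [].
  apply: (@good_special _ _ (3%:R * e)).
  - by apply/andP; split; lra.
  - by rewrite l2 andbT; have := hgamma; lra.
  have qv : (den (rev v)).1 = (den v).1 by have [] := den_rev v.
  have q1 : (den (h ++ rev v)).1%:R <= 2%:R * D * (den v).1%:R.
    by rewrite -!natrM ler_nat -qv den_cat_le2.
  (* As the tail of [v] runs from 0 to 1, the sum stays within [e] of the target, so the values of
     [v] vary by at most [2 * e]. By [cf_dist_ge] and the choice of [e] this forces [q(v) >= N0]. *)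
  have q2 : N0%:R <= (den (h ++ rev v)).1%:R :> R.
    have := den_cat_ge_r h0 rv0; rewrite qv -(ler_nat R); apply: le_trans.
    have z01 : 0 <= (0 : R) <= 1 by rewrite lexx ler01.
    have z11 : 0 <= (1 : R) <= 1 by rewrite lexx ler01.
    have := hd _ _ z01 z01; have := hd _ _ z01 z11; have := cf_dist_ge R v0.
    rewrite !ler_norml => k1 /andP[k2 k3] /andP[k4 k5].
    have k6 : (2%:R * (den v).1%:R ^+ 2)^-1 <= 2%:R * e.
      by apply: le_trans k1 _; rewrite ler_norml; apply/andP; split; lra.
    have p0 : 0 < (den v).1%:R :> R by rewrite ltr0n den_gt0.
    move: k6; rewrite -[_^-1]mul1r ler_pdivrMr ?mulr_gt0 ?exprn_gt0 //.
    move: (den v).1%:R N0%:R p0 N01 eN => q n qp n1 eN k6.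
    rewrite leNgt; apply/negP => qn.
    have : e * q ^+ 2 <= e * n ^+ 2 by apply: ler_wpM2l; [exact: ltW|nra].
    lra.
  have q3 : varpi N1 <= varpi (den (h ++ rev v)).1.
    by apply: varpi_incr; rewrite ltnW // -(ler_nat R).
  have k : e * (den (h ++ rev v)).1%:R ^+ 2 <= 4%:R * D ^+ 2 * C.
    have D0 : 0 <= D by [].
    have k3 : (den (h ++ rev v)).1%:R ^+ 2 <= 4%:R * D ^+ 2 * (den v).1%:R ^+ 2.
      rewrite [leRHS](_ : _ = (2%:R * D * (den v).1%:R) ^+ 2); last by ring.
      by rewrite !expr2; apply: ler_pM.
    have k1 : 0 <= 4%:R * D ^+ 2 by rewrite mulr_ge0 ?exprn_ge0.
    apply: le_trans (ler_wpM2l (ltW e0) k3) _; apply: le_trans (ler_wpM2l k1 hq).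
    by rewrite mulrCA.
  have w0 := varpi_ge0 (den (h ++ rev v)).1.
  have : 5%:R * varpi (den (h ++ rev v)).1 <= gamma * varpi (den (h ++ rev v)).1.
    by rewrite ler_wpM2r // ltW.
  by lra.
have := u0; rewrite uE pos_cat => /andP[z0 /andP[d0 y0]].
have {}y0 : pos_digits y := y0.
have := du; rewrite uE => /digits4_split/andP[/andP[_ d4] d4'].
apply: good_digit => //.
- exact: cf01.
- by apply: beta01; rewrite catA pos_cat hv0 /= a0.
case: all3 => [[a5 g]|/andP[+ _]]; last first.
  by rewrite uE /digits3 all_cat => /and3P[_ /andP[_ ?] _]; constructor 1.
case: z' d4' {uE z0} => [_|c z' d3'].
  constructor 3; split=> //; rewrite catA beta_cat //= ?a0 //.
  by apply: inv_digit_le => //; exact: beta_ge0.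
by constructor 1.
Qed.
End Construction.

(** * The limit of the words and its rational approximations *)

Section Limit.
Variable R : realType.

Lemma convex_between (x y z : R) : Num.min x y <= z <= Num.max x y ->
  exists2 c, 0 <= c <= 1 & z = (1 - c) * x + c * y.
Proof.
have [->|xy] := eqVneq x y.
  rewrite minxx maxxx => /andP[h1 h2]; exists 0; first by rewrite lexx ler01.
  by rewrite subr0 mul1r mul0r addr0; apply/le_anti/andP.
move=> hz; have d0 : y - x != 0 by rewrite subr_eq0 eq_sym.
exists ((z - x) / (y - x)); last by field.
move: hz; have [lxy|lyx|E] := ltgtP x y => /andP[h1 h2].
- by rewrite divr_ge0 ?subr_ge0 ?ler_pdivrMr ?subr_gt0 ?mul1r ?lerD2r // ltW.
- rewrite -(opprB x z) -(opprB x y) invrN mulrNN divr_ge0 ?subr_ge0 // ?(ltW lyx) //.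
  by rewrite ler_pdivrMr ?subr_gt0 // mul1r lerD2l lerN2.
by rewrite E eqxx in xy.
Qed.

Lemma cf_between w (t : R) : pos_digits w -> 0 <= t <= 1 ->
  Num.min (cf w 0) (cf w 1) <= cf w t <= Num.max (cf w 0) (cf w 1).
Proof.
move=> w0 /(cf_conv w0)[c /andP[c0 c1] ->]; move: (cf w 0) (cf w 1) => x y.
by have [xy|yx] := lerP x y; apply/andP; split; nra.
Qed.

(** The intervals [cf (h n) [0, 1]] are nested and closed, so the supremum of their lower ends lies
    in all of them. *)
Lemma nested_limit (h : nat -> seq nat) : (forall n, pos_digits (h n)) ->
  (forall n, exists b, h n.+1 = h n ++ b) ->
  exists alpha : R, forall n, exists2 t : R, 0 <= t <= 1 & alpha = cf (h n) t.
Proof.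
move=> h0 hS.
have hle m n : (m <= n)%N -> exists b, h n = h m ++ b.
  move/subnKC <-; elim: (n - m)%N => [|k [b E]]; first by exists [::]; rewrite addn0 cats0.
  by have [c Ec] := hS (m + k)%N; exists (b ++ c); rewrite addnS Ec E catA.
pose lo n : R := Num.min (cf (h n) 0) (cf (h n) 1).
pose hi n : R := Num.max (cf (h n) 0) (cf (h n) 1).
have in_all m n : (m <= n)%N -> lo m <= cf (h n) 0 <= hi m.
  move=> /hle[b E]; rewrite E cf_cat; apply: cf_between => //.
  apply: cf01; last by rewrite lexx ler01.
  by have := h0 n; rewrite E pos_cat => /andP[].
have lohi m n : lo m <= hi n.
  have /andP[h1 _] := in_all m (maxn m n) (leq_maxl m n).
  have /andP[_ h2] := in_all n (maxn m n) (leq_maxr m n).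
  exact: le_trans h1 h2.
exists (sup (range lo)) => n.
have hub : has_ubound (range lo) by exists (hi 0%N) => _ [m _ <-]; exact: lohi.
have h1 : lo n <= sup (range lo) by apply: ub_le_sup => //; exists n.
have h2 : sup (range lo) <= hi n.
  by apply: ge_sup; [exists (lo 0%N), 0%N|move=> _ [m _ <-]; exact: lohi].
have [|c hc ->] := @convex_between (cf (h n) 0) (cf (h n) 1) (sup (range lo)).
  by apply/andP.
have [t ht <-] := cf_onto (h0 n) hc.
by exists t.
Qed.

Lemma coprime_convergent w : coprimez (num w).1 (den w).1.
Proof.
have E := cont_det w; apply/coprimezP.
exists (- (-1) ^+ size w * (den w).2%:Z, (-1) ^+ size w * (num w).2%:Z) => /=.
have S2 : (-1) ^+ size w * (-1) ^+ size w = 1 :> int by rewrite -exprMn mulrNN mulr1 expr1n.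
by rewrite -[RHS]S2 -[X in _ = _ * X]E !PoszM; ring.
Qed.

Lemma infinite_unbounded (A : set (int * nat)) :
  (forall n, exists2 pq, A pq & (n <= pq.2)%N) -> infinite_set A.
Proof.
move=> h /finite_seqP[s E]; have [pq] := h (\sum_(x <- s) x.2).+1.
rewrite E /= => ps; rewrite (big_rem _ ps) /= => h1.
by move: h1; rewrite ltnNge leq_addr.
Qed.

Lemma no_good_approximation (gamma : R) (varpi : nat -> R) h (t : R) (p : int) (q : nat) :
  5 < gamma -> (forall n, 0 <= varpi n) -> admissible gamma varpi h -> 0 <= t <= 1 ->
  (0 < q < (den h).1)%N ->
  1 / (gamma * q%:R ^+ 2) * (1 - varpi q / q%:R ^+ 2) <= `|cf h t - p%:~R / q%:R|.
Proof.
move=> g5 varpi_ge0 [h0 adm] ht /[dup]/andP[q0 _] /den_bracket[x [d [y [hE qx xq]]]].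
have := h0; rewrite hE -cat_rcons pos_cat => /andP[w0 y0].
have := w0; rewrite pos_rcons => /andP[d0 x0].
have qR : 0 < q%:R :> R by rewrite ltr0n.
have q2 : 0 < q%:R ^+ 2 :> R by rewrite exprn_gt0.
have gq0 : 0 < gamma * q%:R ^+ 2 by rewrite mulr_gt0 //; lra.
have le1 : 1 / (gamma * q%:R ^+ 2) * (1 - varpi q / q%:R ^+ 2) <= 1 / (gamma * q%:R ^+ 2).
  by rewrite ger_pMr ?divr_gt0 // gerBl divr_ge0 // ltW.
have [E|X0] := eqVneq (p * (den x).1%:Z) (q%:Z * (num x).1%:Z); last first.
  apply: le_trans le1 _.
  have hq : ((den x).1 <= q < (den (rcons x d)).1)%N by rewrite qx.
  have := far_from_nonconvergent w0 (cf01 y0 ht) hq X0.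
  rewrite -cf_cat; apply: le_trans.
  have q4 : 0 < 4%:R * q%:R ^+ 2 :> R by rewrite mulr_gt0.
  rewrite div1r lef_pV2 ?posrE //; apply: ler_wpM2r; [exact: ltW|lra].
have [l4 lP] := adm _ _ _ hE _ ht; have hxy := h0; rewrite hE in hxy.
have xR : 0 < (den x).1%:R :> R by rewrite ltr0n den_gt0.
have t0 : 0 <= t by case/andP: ht.
have l0 : 0 < d%:R + cf y t + beta R x.
  by rewrite ltr_wpDr ?beta_ge0 // ltr_wpDr ?cf_ge0 // ltr0n.
have -> : p%:~R / q%:R = (num x).1%:R / (den x).1%:R :> R.
  apply/eqP; rewrite eqr_div ?lt0r_neq0 //.
  by have := congr1 (fun z : int => z%:~R : R) E; rewrite !rmorphM /= -!pmulrn (mulrC q%:R) => ->.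
rewrite cat_rcons cf_approx //.
have cop : coprime (den x).1 (num x).1.
  by have := coprime_convergent x; rewrite coprimez_sym.
have /dvdnP[m qE] : ((den x).1 %| q)%N.
  rewrite -(Gauss_dvdl _ cop); have := congr1 absz E; rewrite !abszM /= => <-.
  exact: dvdn_mull.
move: (_ + _ + _) l4 lP l0 => l l4 lP l0.
have [m2|m1] := leqP 2 m.
  have xl0 : 0 < (den x).1%:R ^+ 2 * l by rewrite mulr_gt0 ?exprn_gt0.
  apply: le_trans le1 _; rewrite div1r lef_pV2 ?posrE //.
  have m2R : 2%:R <= m%:R :> R by rewrite ler_nat.
  rewrite qE natrM exprMn mulrA mulrC; apply: ler_wpM2r; first by rewrite exprn_ge0 // ltW.
  apply: le_trans l4 _; rewrite mulrC; apply: ler_wpM2l; first by lra.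
  by nra.
have qE' : q = (den x).1.
  by move: m1 q0; rewrite qE; case: (m) => [|[|//]]; rewrite ?mul0n ?mul1n.
rewrite -qE' in lP *.
have := varpi_ge0 q; move: (q%:R ^+ 2) (varpi q) q2 lP gq0 => z v z0 lP gz v0.
rewrite -[leRHS]mul1r ler_pdivlMr ?mulr_gt0 //.
have -> : 1 / (gamma * z) * (1 - v / z) * (z * l) = l * (z - v) / (gamma * z).
  by field; rewrite !lt0r_neq0 //; lra.
by rewrite ler_pdivrMr // mul1r.
Qed.
End Limit.

Theorem theorem3 (R : realType) (gamma : R) (varpi : nat -> R)
    (hgamma : 5 < gamma)
    (varpi_ge0 : forall n : nat, 0 <= varpi n)
    (varpi_incr : {homo varpi : m n / (m <= n)%N >-> m <= n})
    (varpi_cvg : varpi n @[n --> \oo] --> +oo) :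
  exists alpha : R,
    infinite_set [set pq : int * nat |
      [/\ (0 < pq.2)%N, coprimez pq.1 (pq.2%:Z) &
          `|alpha - pq.1%:~R / pq.2%:R| < 1 / (gamma * pq.2%:R ^+ 2)]] /\
    finite_set [set pq : int * nat |
      (0 < pq.2)%N /\
      `|alpha - pq.1%:~R / pq.2%:R| <
        1 / (gamma * pq.2%:R ^+ 2) * (1 - varpi pq.2 / pq.2%:R ^+ 2)].
Proof.
have varpi_unb (A : R) : exists n, A <= varpi n.
  have /cvgryPge/(_ A)[n _ hn] := varpi_cvg.
  by exists n; apply: hn => /=.
have [a [a0 sa ha]] := special_digit hgamma.
(* Admissibility is bundled with the word, so that choice gives a function that can be iterated. *)
have stepP (h : {h | admissible gamma varpi h}) : exists h' : {h | admissible gamma varpi h},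
    exists x y, sval h' = sval h ++ x ++ a :: y /\
      forall t : R, 0 <= t <= 1 -> gamma < a%:R + cf y t + beta R (sval h ++ x).
  have [x [y [adm H]]] := extend hgamma varpi_ge0 varpi_incr varpi_unb a0 sa ha (svalP h).
  by exists (exist _ _ adm), x, y.
have [step stepE] := choice stepP.
have adm0 : admissible gamma varpi [::] by split=> // -[].
pose h n := sval (iter n step (exist _ _ adm0)).
have admh n : admissible gamma varpi (h n) := svalP _.
have hS n : exists x y, h n.+1 = h n ++ x ++ a :: y /\
    forall t : R, 0 <= t <= 1 -> gamma < a%:R + cf y t + beta R (h n ++ x) := stepE _.
have size_h n : (n <= size (h n))%N.
  elim: n => // n IH; have [x [y [-> _]]] := hS n.
  by rewrite !size_cat /= !addnS ltnS (leq_trans IH) // leq_addr.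
have h0 n := (admh n).1.
have [|alpha alphaE] := @nested_limit R h h0.
  by move=> n; have [x [y [-> _]]] := hS n; eexists.
exists alpha; split.
  (* The index [n.+1] makes up for the one lost in [den_ge_size]. *)
  apply: infinite_unbounded => n; have [x [y [E big]]] := hS n.+1.
  have [t ht ->] := alphaE n.+2.
  have w0 := h0 n.+2; rewrite E catA in w0 *.
  have x0 : pos_digits (h n.+1 ++ x) by move: w0; rewrite pos_cat => /andP[].
  exists ((num (h n.+1 ++ x)).1%:Z, (den (h n.+1 ++ x)).1); last first.
    rewrite -ltnS (leq_trans _ (den_ge_size x0)) // size_cat.
    by rewrite (leq_trans (size_h n.+1)) // leq_addr.
  have q0 := den_gt0 x0.
  split=> //=; first exact: coprime_convergent.
  have t0 : 0 <= t by case/andP: ht.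
  rewrite -pmulrn cf_approx // div1r.
  have q2 : 0 < (den (h n.+1 ++ x)).1%:R ^+ 2 :> R by rewrite exprn_gt0 // ltr0n.
  have l0 := big _ ht.
  have g0 : 0 < gamma by lra.
  rewrite ltf_pV2 ?posrE; first by rewrite (mulrC gamma) ltr_pM2l.
    by rewrite mulr_gt0 // (lt_trans g0).
  by rewrite mulr_gt0.
(* The set is even empty: [h q.+2] has at least [q + 2] digits, hence a denominator greater than
   [q]. *)
rewrite [X in finite_set X](_ : _ = set0) //; apply/seteqP; split=> // -[p q] /= [q0].
have [t ht ->] := alphaE q.+2.
have hq : (0 < q < (den (h q.+2)).1)%N.
  by rewrite q0 -ltnS (leq_trans _ (den_ge_size (h0 _))) // (leq_trans _ (size_h _)).
by have := no_good_approximation p hgamma varpi_ge0 (admh _) ht hq; rewrite leNgt => /negP.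
Qed.
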